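(* Let $n\ge 2$ and let $\eta=(\eta_1,\dots,\eta_n)\in\mathbb{R}^n$ have pairwise distinct coordinates. Let $X(t)=(X_1(t),\dots,X_n(t))$, where $X_1,\dots,X_n$ are independent standard one-dimensional Brownian motions with $X_i(0)=\eta_i$, and let $T=\inf\{s\ge 0: X_i(s)=X_j(s)\text{ for some }i\ne j\}$. Then, as $t\to\infty$, the conditional distribution of $|X(t)|/\sqrt t$ given $\{T>t\}$ converges weakly to the distribution at time $1$ of the Bessel process with parameter $n(n+1)/2$ started at $0$, that is, to the distribution of $|Z|$ where $Z$ is a standard normal random vector in $\mathbb{R}^{n(n+1)/2}$.
   Context: $|\cdot|$ denotes the Euclidean norm. The Bessel process with parameter $d$ (a positive integer) is the radial part of $d$-dimensional standard Brownian motion. *)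

(* Defs.v *)
From HB Require Import structures.
From mathcomp Require Import all_boot all_order all_algebra.
From mathcomp Require Import all_classical all_reals all_analysis.

Set Implicit Arguments.
Unset Strict Implicit.
Unset Printing Implicit Defensive.

Import Order.TTheory GRing.Theory Num.Theory.
Import numFieldTopology.Exports numFieldNormedType.Exports.

Local Open Scope classical_set_scope.
Local Open Scope ring_scope.

(* A real-valued process is a function B : R -> Omega -> R of which only the
   values B t with 0 <= t matter. *)

(* The library norm on 'rV[R]_k is the sup norm, hence this definition. *)
Definition enorm (R : realType) (k : nat) (x : 'I_k -> R) : R :=
  Num.sqrt (\sum_(i < k) x i ^+ 2).

(* Subfamilies are covered by taking some of the events equal to setT. *)
Definition independent_RVs (d : measure_display) (Omega : measurableType d)
    (R : realType) (P : probability Omega R) (k : nat)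
    (Y : 'I_k -> Omega -> R) : Prop :=
  forall A : 'I_k -> set R, (forall i, measurable (A i)) ->
    P (\bigcap_i (Y i @^-1` A i)) = (\prod_(i < k) P (Y i @^-1` A i))%E.

Definition process_sigma (d : measure_display) (Omega : measurableType d)
    (R : realType) (B : R -> Omega -> R) : set (set Omega) :=
  <<s [set E | exists t (A : set R),
         [/\ 0 <= t, measurable A & E = B t @^-1` A]] >>.

Definition independent_processes (d : measure_display)
    (Omega : measurableType d) (R : realType) (P : probability Omega R)
    (k : nat) (X : 'I_k -> R -> Omega -> R) : Prop :=
  forall E : 'I_k -> set Omega, (forall i, process_sigma (X i) (E i)) ->
    P (\bigcap_i E i) = (\prod_(i < k) P (E i))%E.

(* The second parameter of normal_prob is the standard deviation; its value 0
   does not denote a Dirac mass, hence the strict inequality s < t.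
   Every path is continuous, so that events such as {t < collision time} are
   measurable without completing the probability space. *)
Record brownian_motion (d : measure_display) (Omega : measurableType d)
    (R : realType) (P : probability Omega R) (x : R) (B : R -> Omega -> R)
    : Prop := BrownianMotion {
  bm_measurable : forall t, 0 <= t -> measurable_fun setT (B t) ;
  bm_start : {ae P, forall w, B 0 w = x} ;
  bm_continuous : forall w, {within `[0, +oo[, continuous (B ^~ w)} ;
  bm_increments : forall (m : nat) (t : nat -> R),
    0 <= t 0%N -> (forall i, t i <= t i.+1) ->
    independent_RVs P (fun i : 'I_m => B (t i.+1) \- B (t i)) ;
  bm_gaussian : forall s t, 0 <= s -> s < t ->
    forall A : set R, measurable A ->
      P ((B t \- B s) @^-1` A) = normal_prob 0 (Num.sqrt (t - s)) A }.

Definition brownian_motion_dim (d : measure_display)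
    (Omega : measurableType d) (R : realType) (P : probability Omega R)
    (k : nat) (x : 'I_k -> R) (X : 'I_k -> R -> Omega -> R) : Prop :=
  (forall i, brownian_motion P (x i) (X i)) /\ independent_processes P X.

Definition bessel_process (d : measure_display) (Omega : measurableType d)
    (R : realType) (P : probability Omega R) (k : nat) (r : R)
    (rho : R -> Omega -> R) : Prop :=
  exists (x : 'I_k -> R) (W : 'I_k -> R -> Omega -> R),
    [/\ brownian_motion_dim P x W, enorm x = r &
        forall t w, 0 <= t -> rho t w = enorm (fun i => W i t w)].

Definition standard_normal_vector (d : measure_display)
    (Omega : measurableType d) (R : realType) (P : probability Omega R)
    (k : nat) (Z : 'I_k -> Omega -> R) : Prop :=
  [/\ forall i, measurable_fun setT (Z i),
      forall i (A : set R), measurable A ->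
        P (Z i @^-1` A) = normal_prob 0 1 A
    & independent_RVs P Z].

(* Equal to +oo on the paths without collision. *)
Definition collision_time (Omega : Type) (R : realType) (k : nat)
    (X : 'I_k -> R -> Omega -> R) (w : Omega) : \bar R :=
  ereal_inf [set s%:E | s in
    [set s : R | 0 <= s /\ exists i j : 'I_k, i != j /\ X i s w = X j s w]].

(* Identically 0 when P A = 0; otherwise, for measurable A, the probability
   P(. | A). *)
Definition conditional_probability (d : measure_display)
    (Omega : measurableType d) (R : realType) (P : probability Omega R)
    (A : set Omega) : set Omega -> \bar R :=
  fun E => (P (E `&` A) * ((fine (P A))^-1)%:E)%E.

Definition weak_cvg (R : realType) (I : Type) (F : set_system I)
    (mu : I -> set R -> \bar R) (nu : set R -> \bar R) : Prop :=
  forall f : R -> R, continuous f -> bounded_fun f ->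
    (\int[mu t]_x (f x)%:E)%E @[t --> F] --> (\int[nu]_x (f x)%:E)%E.

(* Main.v *)
Require Import Defs.
From HB Require Import structures.
From mathcomp Require Import all_boot all_order all_algebra fingroup perm.
From mathcomp Require Import all_classical all_reals all_analysis.
From mathcomp Require Import measurable_realfun ring lra.

(* Reflection. Let V be the Vandermonde product and M = n(n-1)/2 its degree. For
   antisymmetric g, exchanging the two colliding coordinates after the first
   collision gives E[g(X(t)); T <= t] = 0; applied to g(x) = f(|x|) sgn V(x),
   whose sign is frozen at sgn V(eta) before T, this yields
     sgn V(eta) E[f(|X(t)|); T > t] = E[f(|X(t)|) sgn V(X(t))].
   On paths this is done along finite grids, with an approximate collision and a
   continuous approximation of the sign.
   Small drift. Dividing by sqrt t turns X(t) into a standard normal vector N with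
   the small mean e eta, e = 1/sqrt t, and the Gaussian density gives, up to a
   factor not depending on f, E[f(|N|) sgn V(N) exp(e <eta, N>)]. Antisymmetrising
   exp(e <eta, x>) over the permutations of x kills all the terms of order less
   than M in e and leaves a multiple of e^M V(eta) V(x), hence
     E[f(|X(t)|/sqrt t) | T > t] --> E[f(|N|) |V(N)|] / E[|V(N)|].
   Radial law. As |V| is homogeneous of degree M, the law of |N| biased by |V(N)|
   has density proportional to r^(n+M-1) exp(-r^2/2), which is the law of the norm
   of a standard normal vector in dimension n + M = n(n+1)/2. *)

Set Implicit Arguments.
Unset Strict Implicit.
Unset Printing Implicit Defensive.
Import Order.TTheory GRing.Theory Num.Theory.
Import numFieldTopology.Exports numFieldNormedType.Exports.
Local Open Scope classical_set_scope.
Local Open Scope ring_scope.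

(** * Densities, independence and change of measure *)

(** The argument uses no strong Markov property, no product measure and no polar coordinates. The
    collision time is replaced by the first success in a finite list of tests on a grid. At that
    time two coordinates are only close, so exchanging their later increments leaves a small error
    at the endpoint; this is why the antisymmetric function has to be continuous. Three limits
    follow in a fixed order: for each tolerance the mesh is taken so fine that undetected collisions
    have small probability, then the tolerance vanishes, and last the smoothed sign tends to the
    sign. The Gaussian identities for shifts, scalings and relabellings of coordinates are instances
    of one change of measure for independent coordinates, checked on rectangles. The vector N is the
    increment of X between times 0 and 1, on the given space. The survival probability is the case f
    = 1 of the expectation, so the common factor, of order t^(-M/2), cancels in a quotient; its
    constant is nonzero because V(eta) is, and because some monomial survives antisymmetrisation. *)

Section density.
Local Open Scope ereal_scope.
Context d (T : measurableType d) (R : realType).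
Variables (mu : {measure set T -> \bar R}) (w : T -> R).
Hypotheses (mw : measurable_fun setT w) (w0 : forall x, (0 <= w x)%R).

(** The proofs [mw] and [w0] are arguments so that the measure structure can be inferred from the
    term [weighted mw w0] alone. *)
Definition weighted (mw : measurable_fun setT w)
    (w0 : forall x, (0 <= w x)%R) (A : set T) : \bar R :=
  \int[mu]_(x in A) (w x)%:E.

Let mwE : measurable_fun setT (EFin \o w).
Proof. exact/measurable_EFinP. Qed.

Let weighted0 : weighted mw w0 set0 = 0.
Proof. exact: integral_set0. Qed.

Let weighted_ge0 A : 0 <= weighted mw w0 A.
Proof. by apply: integral_ge0 => x _; rewrite lee_fin. Qed.

Let weighted_sigma_additive : semi_sigma_additive (weighted mw w0).
Proof.
move=> F mF tF mUF; rewrite /weighted ge0_integral_bigcup//; last 2 first.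
- exact: measurable_funTS.
- by move=> x _; rewrite lee_fin.
apply: is_cvg_ereal_nneg_natsum_cond => n _ _.
by apply: integral_ge0 => x _; rewrite lee_fin.
Qed.

HB.instance Definition _ := isMeasure.Build _ _ _ (weighted mw w0)
  weighted0 weighted_ge0 weighted_sigma_additive.

Import HBNNSimple.

Lemma ge0_integral_weighted (f : T -> \bar R) :
  measurable_fun setT f -> (forall x, 0 <= f x) ->
  \int[weighted mw w0]_x f x = \int[mu]_x (f x * (w x)%:E).
Proof.
move=> mf f0.
pose f_ := nnsfun_approx measurableT mf.
have f_cvg x : (f_ n x)%:E @[n --> \oo] --> f x by exact: cvg_nnsfun_approx.
have f_nd x m n : (m <= n)%N -> (f_ m x <= f_ n x)%R.
  by move=> mn; exact/lefP/nd_nnsfun_approx.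
transitivity (limn (fun n => \int[weighted mw w0]_x (f_ n x)%:E)).
  rewrite -monotone_convergence//.
  - by apply: eq_integral => y _; apply/esym/cvg_lim => //; exact: f_cvg.
  - by move=> n; exact/measurable_EFinP.
  - by move=> n y _; rewrite lee_fin.
  - by move=> y _ m n mn; rewrite lee_fin f_nd.
transitivity (limn (fun n => \int[mu]_x ((f_ n x)%:E * (w x)%:E))); last first.
  rewrite -monotone_convergence//.
  - apply: eq_integral => y _; apply/cvg_lim => //.
    by apply: cvgeZr => //; exact: f_cvg.
  - by move=> n; apply: emeasurable_funM => //; exact/measurable_EFinP.
  - by move=> n y _; rewrite mule_ge0 ?lee_fin.
  - by move=> y _ m n mn; rewrite lee_wpmul2r ?lee_fin// f_nd.
congr (limn _); apply/funext => n.
rewrite integralT_nnsfun sintegralE.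
transitivity (\int[mu]_x (\sum_(y \in range (f_ n))
    (y * \1_(f_ n @^-1` [set y]) x)%:E * (w x)%:E)).
  rewrite ge0_integral_fsum//.
  - apply: eq_fsbigr => r; rewrite inE => -[x _ fx].
    under [RHS]eq_integral do rewrite EFinM -muleA.
    rewrite ge0_integralZl_EFin//.
    + congr (_ * _); rewrite -[LHS]/(\int[mu]_(x in f_ n @^-1` [set r]) (w x)%:E).
      rewrite integral_mkcond epatch_indic.
      by apply: eq_integral => z _; rewrite muleC.
    + by move=> z _; rewrite mule_ge0 ?lee_fin.
    + by apply: emeasurable_funM => //; exact/measurable_EFinP.
    + by rewrite -fx.
  - move=> r; apply: emeasurable_funM => //.
    by apply/measurable_EFinP/measurable_funM.
  - by move=> r x _; rewrite mule_ge0//;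
    [exact: nnfun_muleindic_ge0|rewrite lee_fin].
apply: eq_integral => x _; rewrite [in RHS]fimfunE -fsumEFin//.
by rewrite ge0_mule_fsuml// => r; exact: nnfun_muleindic_ge0.
Qed.

End density.

Section independence.
Local Open Scope ereal_scope.
Context (R : realType) (I : finType).

(** The index type is an arbitrary finite type because increments along a grid are indexed by pairs
    (coordinate, step). *)
Definition independent d (T : measurableType d) (P : probability T R)
    (Y : I -> T -> R) : Prop :=
  (forall i, measurable_fun setT (Y i)) /\
  forall A : I -> set R, (forall i, measurable (A i)) ->
    P (\bigcap_i (Y i @^-1` A i)) = \prod_i P (Y i @^-1` A i).

Lemma prod_indic (T : Type) (A : I -> set T) (x : I -> T) :
  (\prod_i \1_(A i) (x i) = \1_[set y : I -> T | forall i, A i (y i)] x :> R)%R.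
Proof.
have [Ax|/existsNP[i Ai]] := pselect (forall i, A i (x i)).
  by rewrite [RHS]indicE mem_set// big1// => i _; rewrite indicE mem_set.
by rewrite (bigD1 i)//= indicE memNset// mul0r indicE memNset.
Qed.

Context d (T : measurableType d) (P : probability T R) (Y : I -> T -> R).
Hypothesis iY : independent P Y.

Lemma integral_prod_independent (phi : I -> R -> R) :
  (forall i, measurable_fun setT (phi i)) -> (forall i x, (0 <= phi i x)%R) ->
  (forall i, \int[P]_w (phi i (Y i w))%:E < +oo) ->
  \int[P]_w (\prod_i phi i (Y i w))%:E = \prod_i \int[P]_w (phi i (Y i w))%:E.
Proof.
have [mY IY] := iY.
have mYA i A : measurable A -> measurable (Y i @^-1` A).
  by move=> mA; rewrite -[X in measurable X]setTI; exact: mY.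
(* Indicators are replaced by the [phi i] one index at a time. *)
have [s sI] : exists s : seq I, forall i, i \notin s -> exists2 A : set R,
    measurable A & phi i = \1_A by exists (enum I) => i; rewrite mem_enum.
elim: s => [|i s IH] in phi sI * => mphi phi0 phioo.
  have /choice[A mA] : forall i, exists A : set R,
      measurable A /\ phi i = \1_A.
    by move=> i; have [//|A] := sI i; exists A.
  have -> : (fun w => (\prod_i phi i (Y i w))%:E) =
            (fun w => (\1_(\bigcap_i (Y i @^-1` A i)) w)%:E).
    apply/funext => w; congr (_%:E).
    under eq_bigr do rewrite (mA _).2.
    rewrite (prod_indic A (Y^~ w)) !indicE; congr ((_ : bool)%:R).
    by apply/idP/idP; rewrite !inE /= => H i; [move=> _|]; exact: H.
  rewrite integral_indic//; last first.
    by apply: fin_bigcap_measurable => // i _; apply: mYA; exact: (mA i).1.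
  rewrite setIT; transitivity (\prod_i P (Y i @^-1` A i)).
    by apply: IY => i; exact: (mA i).1.
  apply: eq_bigr => i _; rewrite (mA i).2.
  transitivity (\int[P]_w (\1_(Y i @^-1` A i) w)%:E); last by [].
  by rewrite integral_indic ?setIT//; apply: mYA; exact: (mA i).1.
pose W w := (\prod_(j | j != i) phi j (Y j w))%R.
pose c := \prod_(j | j != i) \int[P]_w (phi j (Y j w))%:E.
have mW : measurable_fun setT W.
  rewrite /W; under eq_fun do rewrite big_mkcond.
  apply: measurable_prod => j _; case: (j != i) => //.
  exact: measurableT_comp.
have W0 w : (0 <= W w)%R by exact: prodr_ge0.
have c0 : 0 <= c by apply: prode_ge0 => j _; apply: integral_ge0 => w _;
  rewrite lee_fin.
have cfin : c \is a fin_num.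
  rewrite /c; elim/big_ind: _ => //; first exact: fin_numM.
  move=> j _; rewrite ge0_fin_numE//.
  by apply: integral_ge0 => w _; rewrite lee_fin.
(* With [phi i] replaced by an indicator, the induction hypothesis says that under the density [W]
   the law of [Y i] is [c] times its law under [P]. Integrating the original [phi i] against both
   laws concludes. *)
have key A : measurable A ->
    \int[P]_(w in Y i @^-1` A) (W w)%:E = c * P (Y i @^-1` A).
  move=> mA; pose phi' j := if j == i then \1_A else phi j.
  have mphi' j : measurable_fun setT (phi' j).
    by rewrite /phi'; case: eqP => // _; exact: measurable_indic.
  have phi'0 j x : (0 <= phi' j x)%R by rewrite /phi'; case: eqP.
  have phi'i : \int[P]_w (phi' i (Y i w))%:E = P (Y i @^-1` A).
    rewrite /phi' eqxx.
    transitivity (\int[P]_w (\1_(Y i @^-1` A) w)%:E); first by [].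
    by rewrite integral_indic ?setIT//; exact: mYA.
  have phi'E j : j != i -> phi' j = phi j by rewrite /phi' => /negbTE ->.
  have := IH phi' _ mphi' phi'0 _.
  rewrite (bigD1 i)//= phi'i muleC; under eq_bigr => j ji do rewrite phi'E//.
  rewrite -/c => <-.
  - rewrite integral_mkcond epatch_indic; apply: eq_integral => w _ /=.
    rewrite (bigD1 i)//= /phi' eqxx -EFinM mulrC; congr (_ * _)%:E.
    by apply: eq_bigr => j /negbTE ->.
  - move=> j js; have [->|ji] := eqVneq j i.
      by rewrite /phi' eqxx; exists A.
    by rewrite phi'E//; apply: sI; rewrite inE negb_or ji.
  - move=> j; have [->|ji] := eqVneq j i; last by rewrite phi'E.
    by rewrite phi'i (le_lt_trans (probability_le1 _ _)) ?ltry//; exact: mYA.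
rewrite [RHS](bigD1 i)//= -/c muleC.
transitivity (\int[P]_w ((phi i (Y i w))%:E * (W w)%:E)).
  by apply: eq_integral => w _; rewrite (bigD1 i).
have mphiY : measurable_fun setT (fun w => (phi i (Y i w))%:E).
  by apply/measurable_EFinP; exact: measurableT_comp.
rewrite -(ge0_integral_weighted P mW W0)//; last by move=> w; rewrite lee_fin.
pose c' := NngNum (fine_ge0 c0).
transitivity (\int[pushforward (weighted P mW W0) (Y i)]_y (phi i y)%:E).
  rewrite ge0_integral_pushforward//; first exact/measurable_EFinP.
  by move=> y _; rewrite lee_fin.
pose PY : {measure set R -> \bar R} :=
  measure_function_pushforward__canonical__measure_function_Measure P (mY i).
transitivity (\int[mscale c' PY]_y (phi i y)%:E).
  apply: eq_measure_integral => A mA _.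
  by rewrite [LHS]key// -[X in X * _ = _](fineK cfin).
rewrite ge0_integral_mscale//=; last 2 first.
- exact/measurable_EFinP.
- by move=> y _; rewrite lee_fin.
rewrite fineK// ge0_integral_pushforward//; first exact/measurable_EFinP.
by move=> y _; rewrite lee_fin.
Qed.

End independence.

(** * Laws of finite families of random variables *)

Section product_space.
Context (R : realType) (I : finType).

(** A generating pi-system: finite measures on [rvect] that agree on rectangles are equal. *)
Definition rectangles : set (set (I -> R)) :=
  [set B | exists2 A : I -> set R, forall i, measurable (A i) &
           B = [set x | forall i, A i (x i)]].

Definition rvect := g_sigma_algebraType rectangles.

Lemma setI_closed_rectangles : setI_closed rectangles.
Proof.
move=> _ _ [A mA ->] [B mB ->]; exists (fun i => A i `&` B i).
  by move=> i; exact: measurableI.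
apply/seteqP; split => [x [Ax Bx] i|x AB] /=; first by split; [exact: Ax|exact: Bx].
by split => i; case: (AB i).
Qed.

Lemma measurable_coord i : measurable_fun setT (fun x : rvect => x i).
Proof.
move=> _ A mA; rewrite setTI; apply: sub_sigma_algebra.
exists (fun j => if j == i then A else setT).
  by move=> j; case: eqP.
apply/seteqP; split => [x /= Ax j|x /(_ i)]; last by rewrite eqxx.
by case: eqP => [->|].
Qed.

Lemma measurable_rvect d (T : measurableType d) (Y : I -> T -> R) :
  (forall i, measurable_fun setT (Y i)) ->
  measurable_fun setT (fun w => (Y ^~ w) : rvect).
Proof.
move=> mY; apply: (@measurability _ _ T rvect setT _ rectangles) => //.
move=> _ [_ [A mA ->] <-]; rewrite setTI.
rewrite (_ : _ @^-1` _ = \bigcap_i (Y i @^-1` A i)).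
  apply: fin_bigcap_measurable => // i _.
  by rewrite -[X in measurable X]setTI; exact: mY.
by apply/seteqP; split => w /= H i; [move=> _|]; exact: H.
Qed.

Section change_of_measure.
Context d (T : measurableType d) (P : probability T R) (Y : I -> T -> R).
Context d' (T' : measurableType d') (P' : probability T' R)
  (Y' : I -> T' -> R).
Variable rho : I -> R -> R.
Hypotheses (iY : independent P Y) (iY' : independent P' Y').
Hypothesis mrho : forall i, measurable_fun setT (rho i).
Hypothesis rho0 : forall i x, 0 <= rho i x.
Hypothesis rhoE : forall i A, measurable A ->
  P' (Y' i @^-1` A) = (\int[P]_(w in Y i @^-1` A) (rho i (Y i w))%:E)%E.

Let W w := \prod_i rho i (Y i w).

Let mY : measurable_fun setT (fun w => (Y ^~ w) : rvect).
Proof. exact: measurable_rvect iY.1. Qed.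

Let mY' : measurable_fun setT (fun w => (Y' ^~ w) : rvect).
Proof. exact: measurable_rvect iY'.1. Qed.

Let mW : measurable_fun setT W.
Proof.
apply: measurable_prod => i _; apply: measurableT_comp => //.
exact: iY.1.
Qed.

Let W0 w : 0 <= W w.
Proof. exact: prodr_ge0. Qed.

(** By independence the densities [rho i] multiply, so that the law of [Y'] and the law of [Y]
    weighted by [W] agree on rectangles, hence everywhere. The two families may live on different
    spaces. *)
Lemma ge0_change_of_measure (F : rvect -> \bar R) : measurable_fun setT F ->
  (forall x, 0 <= F x)%E ->
  (\int[P']_w F (Y' ^~ w) = \int[P]_w (F (Y ^~ w) * (W w)%:E))%E.
Proof.
move=> mF F0.
have mFY : measurable_fun setT (fun w => F (Y ^~ w)).
  exact: (measurableT_comp mF mY).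
rewrite -(ge0_integral_weighted P mW W0)//.
rewrite -(ge0_integral_pushforward mY' P' measurableT mF)//.
rewrite -(ge0_integral_pushforward mY (weighted P mW W0) measurableT mF)//.
apply: eq_measure_integral => B mB _.
apply: (@measure_unique _ R rvect rectangles (fun=> setT) _ _ _ _ (pushforward
  P' (fun w => (Y' ^~ w) : rvect)) (pushforward (weighted P mW W0) (fun w => (Y
    ^~ w) : rvect))) => //.
- exact: setI_closed_rectangles.
- by move=> _; exists (fun=> setT) => //; apply/seteqP.
- by apply/seteqP; split => // x _; exists 0%N.
- move=> _ [A mA ->].
  have YE S (U : I -> S -> R) : (fun w => (U ^~ w)) @^-1` [set x | forall i,
    A i (x i)] =
      \bigcap_i (U i @^-1` A i).
    by apply/seteqP; split => w /= H i; [move=> _|]; exact: H.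
  rewrite -[LHS]/(P' ((fun w => (Y' ^~ w)) @^-1` _)) YE iY'.2//.
  transitivity (\prod_i \int[P]_w (\1_(A i) (Y i w) * rho i (Y i w))%:E)%E.
    apply: eq_bigr => i _; rewrite rhoE// integral_mkcond epatch_indic.
    by apply: eq_integral => w _; rewrite -EFinM mulrC.
  rewrite -(integral_prod_independent iY (phi := fun i x => \1_(A i) x * rho i x)).
  + rewrite -[RHS]/(\int[P]_(w in _ @^-1` _) (W w)%:E)%E.
    rewrite [RHS]integral_mkcond epatch_indic; apply: eq_integral => w _.
    by rewrite big_split/= prod_indic -EFinM mulrC.
  + by move=> i; apply: measurable_funM => //; exact: measurable_indic.
  + by move=> i x; rewrite mulr_ge0.
  + move=> i; rewrite (_ : (\int[P]_w _ = P' (Y' i @^-1` A i))%E).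
      rewrite (le_lt_trans (probability_le1 _ _)) ?ltry//.
      by rewrite -[X in measurable X]setTI; exact: iY'.1.
    rewrite rhoE// [RHS]integral_mkcond epatch_indic.
    by apply: eq_integral => w _; rewrite /= -EFinM mulrC.
- by move=> _; rewrite [ltLHS]probability_setT ltry.
Qed.

Lemma change_of_measure (F : rvect -> R) : measurable_fun setT F ->
  (\int[P']_w (F (Y' ^~ w))%:E = \int[P]_w (F (Y ^~ w) * W w)%:E)%E.
Proof.
move=> mF; rewrite [LHS]integralE [RHS]integralE.
have mFE : measurable_fun setT (EFin \o F) by exact/measurable_EFinP.
congr (_ - _)%E.
- transitivity (\int[P']_w (EFin \o F)^\+ (Y' ^~ w))%E.
    by apply: eq_integral => w _; rewrite !funeposE.
  rewrite ge0_change_of_measure//; last exact: measurable_funepos.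
  apply: eq_integral => w _; rewrite !funeposE/= -!EFin_max -EFinM.
  by rewrite mulrC maxr_pMr// mulr0 mulrC.
- transitivity (\int[P']_w (EFin \o F)^\- (Y' ^~ w))%E.
    by apply: eq_integral => w _; rewrite !funenegE.
  rewrite ge0_change_of_measure//; last exact: measurable_funeneg.
  apply: eq_integral => w _; rewrite !funenegE/= -!EFin_max -EFinM.
  by rewrite mulrC maxr_pMr// mulr0 mulrN mulrC.
Qed.

End change_of_measure.

End product_space.

(** * Gaussian shifts and scalings *)

Section affine_normal.
Context (R : realType).
Notation mu := (@lebesgue_measure R).

Let aff (c b : R) : measurableTypeR R -> measurableTypeR R :=
  fun x : R => c * x + b.

Let maff c b : measurable_fun setT (aff c b).
Proof.
suff : measurable_fun setT (fun x : R => c * x + b) by [].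
by apply: measurable_funD => //; exact: measurable_funM.
Qed.

Let muaff c b : {measure set (measurableTypeR R) -> \bar R} :=
  measure_function_pushforward__canonical__measure_function_Measure mu
    (maff c b).

Let mpdf m s (A : set (measurableTypeR R)) :
  measurable_fun A (fun x : measurableTypeR R => (normal_pdf m s x)%:E).
Proof.
apply: measurable_funTS.
by apply/measurable_EFinP; exact: measurable_normal_pdf.
Qed.

Lemma lebesgue_measure_affine (c b : R) (c0 : 0 < c) (A : set R) :
  measurable A -> mu A = mscale (NngNum (ltW c0)) (muaff c b) A.
Proof.
move=> mA.
apply: lebesgue_measure_unique => // _ [[u v] _ <-].
rewrite -[RHS]/(c%:E * mu (aff c b @^-1` `]u, v]))%E.
have -> : aff c b @^-1` `]u, v] = `](u - b) / c, (v - b) / c]%classic.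
  apply/seteqP; split => x /=; rewrite !in_itv/= /aff => /andP[h1 h2];
    apply/andP; split.
  - by rewrite ltr_pdivrMr// mulrC ltrBlDr.
  - by rewrite ler_pdivlMr// mulrC lerBrDr.
  - by move: h1; rewrite ltr_pdivrMr// mulrC ltrBlDr.
  - by move: h2; rewrite ler_pdivlMr// mulrC lerBrDr.
rewrite [in LHS]lebesgue_measure_itv/= [in RHS]lebesgue_measure_itv/= !lte_fin.
rewrite ltr_pM2r ?invr_gt0// ltrD2r; case: ifPn => _; last by rewrite mule0.
by rewrite -!EFinD -EFinM -mulrBl mulrC divfK ?gt_eqF// opprB addrA addrNK.
Qed.

Lemma normal_prob_affine (m s c b : R) (A : set R) : s != 0 -> 0 < c ->
  measurable A ->
  normal_prob m s ((fun x => c * x + b) @^-1` A) =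
  normal_prob (c * m + b) (c * s) A.
Proof.
move=> s0 c0 mA.
have cs0 : c * s != 0 by rewrite mulf_neq0// gt_eqF.
have pdfE x : normal_pdf m s x =
    c * normal_pdf (c * m + b) (c * s) (c * x + b).
  rewrite !normal_pdfE// mulrA /normal_peak /normal_fun; congr (_ * expR _).
    rewrite (_ : (c * s) ^+ 2 * pi *+ 2 = c ^+ 2 * (s ^+ 2 * pi *+ 2)).
      by rewrite [in RHS]sqrtrM ?sqr_ge0// sqrtr_sqr gtr0_norm// invfM mulrA
        divff ?gt_eqF// mul1r.
    by ring.
  have cn0 : c != 0 by rewrite gt_eqF.
  by field; rewrite ?s0 ?cn0.
rewrite /normal_prob.
transitivity (\int[muaff c b]_(x in A)
   (c * normal_pdf (c * m + b) (c * s) x)%:E)%E.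
  rewrite ge0_integral_pushforward//.
  - by apply: eq_integral => x _; rewrite pdfE.
  - apply/measurable_funTS/measurable_EFinP/measurable_funM => //.
    exact: measurable_normal_pdf.
  - by move=> x _; rewrite lee_fin mulr_ge0 ?normal_pdf_ge0 ?ltW.
under eq_integral do rewrite EFinM.
rewrite ge0_integralZl_EFin//; last 2 first.
- by move=> x _; rewrite lee_fin normal_pdf_ge0.
- exact: ltW.
transitivity (\int[mscale (NngNum (ltW c0)) (muaff c b)]_(x in A)
   (normal_pdf (c * m + b) (c * s) x)%:E)%E.
  rewrite ge0_integral_mscale//.
  by move=> x _; rewrite lee_fin normal_pdf_ge0.
apply: eq_measure_integral => B mB _; exact/esym/lebesgue_measure_affine.
Qed.

(** The density is positive everywhere, so a set that is null for the normal law is null for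
    Lebesgue measure. *)
Lemma normal_prob_itv_gt0 (m s a b : R) : s != 0 -> a < b ->
  (0 < normal_prob m s `]a, b[)%E.
Proof.
move=> s0 ab; rewrite lt_neqAle measure_ge0 andbT eq_sym; apply/negP => /eqP N0.
have : (\int[mu]_(x in `]a, b[) `|(normal_pdf m s x)%:E| = 0)%E.
  by rewrite -[RHS]N0; apply: eq_integral => x _;
    rewrite gee0_abs// lee_fin normal_pdf_ge0.
move/ae_eq_integral_abs => /(_ (measurable_itv _)) /(_ _)[|N [mN N00 sub]].
  exact: mpdf.
have : (mu `]a, b[ <= mu N)%E.
  apply: le_measure; rewrite ?inE//.
  apply: subset_trans sub => x abx /= /(_ abx) [] /eqP.
  by rewrite normal_pdfE// gt_eqF// mulr_gt0 ?expR_gt0// normal_peak_gt0.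
by rewrite N00 lebesgue_measure_itv/= lte_fin ab -EFinD lee_fin subr_le0 leNgt ab.
Qed.

End affine_normal.

Section standard_normals.
Local Open Scope ereal_scope.
Context (R : realType).

Section change_of_law.
Context d (T : measurableType d) (P : probability T R) (Z : T -> R).
Hypothesis mZ : measurable_fun setT Z.
Hypothesis PZ : forall A : set R, measurable A ->
  P (Z @^-1` A) = normal_prob 0 1 A.

Lemma ge0_integral_normal (f : R -> R) : measurable_fun setT f ->
  (forall x, 0 <= f x)%R ->
  \int[P]_w (f (Z w))%:E =
  \int[lebesgue_measure]_x (f x * normal_pdf 0 1 x)%:E.
Proof.
move=> mf f0; have mfE : measurable_fun setT (EFin \o f) by exact/measurable_EFinP.
transitivity (\int[weighted lebesgue_measure (measurable_normal_pdf 0 1)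
    (normal_pdf_ge0 0 1)]_x (f x)%:E).
  transitivity (\int[pushforward P (Z : T -> measurableTypeR R)]_x (f x)%:E).
    by rewrite ge0_integral_pushforward// => x _; rewrite lee_fin.
  by apply: eq_measure_integral => A mA _; exact: PZ.
by rewrite ge0_integral_weighted.
Qed.

Lemma normal_prob_density (m s : R) (rho : R -> R) (A : set R) :
  measurable_fun setT rho -> (forall x, 0 <= rho x)%R ->
  (forall x, normal_pdf m s x = rho x * normal_pdf 0 1 x)%R -> measurable A ->
  normal_prob m s A = \int[P]_(w in Z @^-1` A) (rho (Z w))%:E.
Proof.
move=> mrho rho0 rhoE mA.
rewrite /normal_prob integral_mkcond [RHS]integral_mkcond !epatch_indic.
transitivity (\int[P]_w (\1_A (Z w) * rho (Z w))%:E); last first.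
  by apply: eq_integral => w _ /=; rewrite -EFinM mulrC.
rewrite (@ge0_integral_normal (fun x => \1_A x * rho x)%R).
- by apply: eq_integral => x _ /=; rewrite rhoE -EFinM mulrC mulrA.
- by apply: measurable_funM => //; exact: measurable_indic.
- by move=> x; rewrite mulr_ge0.
Qed.

End change_of_law.

Lemma normal_pdf_shift (a x : R) :
  (normal_pdf a 1 x = expR (a * x - a ^+ 2 / 2) * normal_pdf 0 1 x)%R.
Proof.
rewrite !normal_pdfE ?oner_eq0// /normal_fun mulrCA -expRD; congr (_ * expR _)%R.
by rewrite expr1n; field.
Qed.

Lemma normal_pdf_scale (c x : R) : (0 < c)%R ->
  (normal_pdf 0 c x =
   c^-1 * expR ((1 - c ^- 2) * x ^+ 2 / 2) * normal_pdf 0 1 x)%R.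
Proof.
move=> c0; have cn0 : c != 0%R by rewrite gt_eqF.
rewrite !normal_pdfE ?oner_eq0// /normal_fun mulrACA -expRD; congr (_ * expR _)%R.
  rewrite /normal_peak (_ : c ^+ 2 * pi *+ 2 = c ^+ 2 * (1 ^+ 2 * pi *+ 2))%R.
    by rewrite [in LHS]sqrtrM ?sqr_ge0// sqrtr_sqr gtr0_norm// invfM.
  by ring.
by rewrite expr1n; field.
Qed.

Section vectors.
Context (I : finType).

Definition standard_normals d (T : measurableType d) (P : probability T R)
    (N : I -> T -> R) :=
  independent P N /\ forall i (A : set R), measurable A ->
    P (N i @^-1` A) = normal_prob 0 1 A.

Context d (T : measurableType d) (P : probability T R) (N : I -> T -> R).
Hypothesis sN : standard_normals P N.

(** The Cameron-Martin formula: the shifted vector [Y] on its own space is traded for the centred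
    [N] and an exponential tilt. *)
Lemma integral_shift_normals (a : I -> R) d' (T' : measurableType d')
    (P' : probability T' R) (Y : I -> T' -> R) (F : rvect R I -> R) :
  independent P' Y ->
  (forall i (A : set R), measurable A ->
    P' (Y i @^-1` A) = normal_prob (a i) 1 A) ->
  measurable_fun setT F ->
  \int[P']_w (F (Y ^~ w))%:E =
  \int[P]_w (F (N ^~ w) * \prod_i expR (a i * N i w - a i ^+ 2 / 2))%:E.
Proof.
move=> iY PY mF; have mrho i : measurable_fun setT (fun x : R => expR (a i * x -
  a i ^+ 2 / 2)).
  by apply: measurableT_comp => //; apply: measurable_funB => //;
    exact: measurable_funM.
apply: (@change_of_measure _ _ _ _ P N _ _ P' Y
  (fun i x => expR (a i * x - a i ^+ 2 / 2)) sN.1 iY mrho) => //.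
move=> i A mA; rewrite PY// (normal_prob_density (sN.1.1 i) (sN.2 i) (mrho i))//.
by move=> x; exact: normal_pdf_shift.
Qed.

Lemma integral_scale_normals (c : R) (F : rvect R I -> R) : (0 < c)%R ->
  measurable_fun setT F ->
  \int[P]_w (F (fun i => c * N i w)%R)%:E =
  \int[P]_w (F (N ^~ w) *
             \prod_i (c^-1 * expR ((1 - c ^- 2) * N i w ^+ 2 / 2)))%:E.
Proof.
move=> c0 mF; have mrho : measurable_fun setT
    (fun x : R => c^-1 * expR ((1 - c ^- 2) * x ^+ 2 / 2))%R.
  apply: measurable_funM => //; apply: measurableT_comp => //.
  by do 2 apply: measurable_funM => //; exact: exprn_measurable.
have mcN i : measurable_fun setT (fun w => c * N i w)%R.
  by apply: measurable_funM => //; exact: sN.1.1.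
(* The term [+ 0] gives the scaling the affine form expected by [normal_prob_affine]. *)
have pre i A : (fun w => c * N i w)%R @^-1` A =
    N i @^-1` ((fun x => c * x + 0)%R @^-1` A).
  by apply/seteqP; split => w /=; rewrite addr0.
have maff : measurable_fun setT (fun x : R => c * x + 0)%R.
  by apply: measurable_funD => //; exact: measurable_funM.
have mpre (A : set R) : measurable A -> measurable ((fun x => c * x + 0)%R @^-1` A).
  by move=> mA; rewrite -[X in measurable X]setTI; exact: maff.
apply: (@change_of_measure _ _ _ _ P N _ _ P (fun i w => c * N i w)%R
  (fun _ x => c^-1 * expR ((1 - c ^- 2) * x ^+ 2 / 2))%R sN.1 _ (fun=> mrho)) => //.
- split=> // A mA.
  under eq_bigcapr do rewrite pre.
  under eq_bigr do rewrite pre.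
  by apply: sN.1.2 => i; exact: mpre.
- by move=> i x; rewrite mulr_ge0 ?expR_ge0 ?invr_ge0 ?ltW.
- move=> i A mA; rewrite pre sN.2; last exact: mpre.
  rewrite normal_prob_affine ?oner_eq0// mulr0 addr0 mulr1.
  apply: (normal_prob_density (sN.1.1 i) (sN.2 i) mrho) => //.
    by move=> x; rewrite mulr_ge0 ?expR_ge0 ?invr_ge0 ?ltW.
  by move=> x; exact: normal_pdf_scale.
Qed.

(** The moment generating function is read off from the total mass 1 of the shifted density. *)
Lemma integral_expR_normal (i : I) (a : R) :
  \int[P]_w (expR (a * N i w))%:E = (expR (a ^+ 2 / 2))%:E.
Proof.
have mrho b : measurable_fun setT (fun x : R => expR (a * x - b)).
  by apply: measurableT_comp => //; apply: measurable_funB => //;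
    exact: measurable_funM.
have := normal_prob_density (sN.1.1 i) (sN.2 i) (mrho _) _ (normal_pdf_shift a)
  measurableT.
rewrite preimage_setT probability_setT => /(_ (fun=> expR_ge0 _)) e.
transitivity (\int[P]_w ((expR (a ^+ 2 / 2))%:E * (expR (a * N i w - a ^+ 2 /
  2))%:E)).
  by apply: eq_integral => w _; rewrite -EFinM -expRD addrCA subrr addr0.
rewrite ge0_integralZl_EFin ?expR_ge0//; last first.
  by apply/measurable_EFinP; apply: (measurableT_comp (mrho _)); exact: sN.1.1.
by rewrite -e mule1.
Qed.

(** Supplies the dominating function of all later integrability proofs. It factorises over the
    coordinates, and [expR (K * |x|)] is at most [expR (K * x) + expR (- K * x)]. *)
Lemma integral_expR_sum_normals_lty (K : R) :
  \int[P]_w (expR (K * \sum_i `|N i w|))%:E < +oo.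
Proof.
have mabs (i : I) : measurable_fun setT (fun x : R => expR (K * `|x|)).
  apply: measurableT_comp => //; apply: measurable_funM => //.
have fin i : \int[P]_w (expR (K * `|N i w|))%:E < +oo.
  apply: (@le_lt_trans _ _ (\int[P]_w ((expR (K * N i w))%:E + (expR (- K * N i
    w))%:E))).
    apply: ge0_le_integral => //.
    - by apply/measurable_EFinP; apply: (measurableT_comp (mabs i)); exact: sN.1.1.
    - apply: emeasurable_funD; apply/measurable_EFinP;
      apply: measurableT_comp => //;
      apply: measurable_funM => //; exact: sN.1.1.
    - move=> w ?; rewrite -EFinD lee_fin.
      have [_|_] := ler0P (N i w); first by rewrite mulrN mulNr lerDr expR_ge0.
      by rewrite lerDl expR_ge0.
  rewrite ge0_integralD//.
  - by rewrite !integral_expR_normal ltry.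
  - by apply/measurable_EFinP; apply: measurableT_comp => //;
      apply: measurable_funM => //; exact: sN.1.1.
  - by apply/measurable_EFinP; apply: measurableT_comp => //;
      apply: measurable_funM => //; exact: sN.1.1.
under eq_integral do rewrite mulr_sumr expR_sum.
rewrite (integral_prod_independent sN.1 (phi := fun _ x => expR (K * `|x|))) //.
suff : \prod_i \int[P]_w (expR (K * `|N i w|))%:E \is a fin_num.
  by rewrite ge0_fin_numE// prode_ge0// => i _; exact: integral_ge0.
elim/big_ind : _ => // [|i _]; first exact: fin_numM.
by rewrite ge0_fin_numE//; exact: integral_ge0.
Qed.

End vectors.

Section reindexing.
Context (I : finType) d (T : measurableType d) (P : probability T R)
  (Y : I -> T -> R) (p : {perm I}).
Hypothesis iY : independent P Y.

Lemma independent_perm : independent P (fun i => Y (p i)).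
Proof.
split=> [i|A mA]; first exact: iY.1.
have := iY.2 (fun i => A ((p^-1)%g i)) (fun i => mA _).
rewrite (reindex_inj (@perm_inj _ p))/=.
under eq_bigr do rewrite permK.
move=> <-; congr (P _); apply/seteqP; split => w H i _ /=.
  by have := H ((p^-1)%g i) Logic.I; rewrite /= permKV.
by have := H (p i) Logic.I; rewrite /= permK.
Qed.

(** A change of measure with all densities equal to 1. It serves both to exchange rows of increments
    in the reflection and to antisymmetrise the exponential. *)
Lemma integral_perm_independent (F : rvect R I -> R) :
  (forall i (A : set R), measurable A -> P (Y (p i) @^-1` A) = P (Y i @^-1` A)) ->
  measurable_fun setT F ->
  \int[P]_w (F (fun i => Y (p i) w))%:E = \int[P]_w (F (Y ^~ w))%:E.
Proof.
move=> YE mF.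
rewrite (@change_of_measure _ _ _ _ P Y _ _ P (fun i => Y (p i))
  (fun _ _ => 1%R) iY independent_perm) //.
- by apply: eq_integral => w _; rewrite big1 ?mulr1.
- move=> i A mA; rewrite YE// integral_cst ?mul1e//.
  by rewrite -[X in measurable X]setTI; exact: iY.1.
Qed.

End reindexing.

End standard_normals.

(** * The Vandermonde determinant and antisymmetrised powers *)

Section vandermonde.
Context (R : comNzRingType) (n : nat).
Implicit Types x y : 'I_n -> R.

(** The determinant form gives antisymmetry, homogeneity and the expansion over permutations; signs
    and bounds are read off from the product form [vdm_prod]. *)
Definition vdm x : R := \det (\matrix_(i < n, j < n) x j ^+ i).

Lemma vdm_prod x : vdm x = \prod_(i < n) \prod_(j < n | (i < j)%N) (x j - x i).
Proof.
have -> : vdm x = \det (Vandermonde n (\row_j x j)).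
  by congr (\det _); apply/matrixP => i j; rewrite !mxE.
rewrite det_Vandermonde; apply: eq_bigr => i _; apply: eq_bigr => j _.
by rewrite !mxE.
Qed.

Lemma vdm_perm x (s : {perm 'I_n}) :
  vdm (fun i => x (s i)) = (-1) ^+ s * vdm x.
Proof.
rewrite /vdm (_ : (\matrix_(i, j) _) = col_perm s (\matrix_(i < n, j < n) x j ^+
  i)).
  by rewrite col_permE det_mulmx det_perm odd_permV mulrC.
by apply/matrixP => i j; rewrite !mxE.
Qed.

Lemma vdm_scale c x : vdm (fun i => c * x i) = c ^+ 'C(n, 2) * vdm x.
Proof.
rewrite /vdm (_ : (\matrix_(i, j) _) =
    diag_mx (\row_(i < n) c ^+ i) *m (\matrix_(i < n, j < n) x j ^+ i)).
  rewrite det_mulmx det_diag; congr (_ * _).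
  under eq_bigr do rewrite mxE.
  by rewrite prodrXr -bin2_sum big_mkord.
by apply/matrixP => i j; rewrite mul_diag_mx !mxE exprMn.
Qed.

(** When a power of a sum is expanded, [f] chooses one term in each of the [m] factors; this is the
    exponent of the variable [i] in the resulting monomial. *)
Definition fiber_card m (f : {ffun 'I_m -> 'I_n}) (i : 'I_n) : nat :=
  #|[pred k | f k == i]|.

Lemma sum_fiber_card m (f : {ffun 'I_m -> 'I_n}) :
  (\sum_(i < n) fiber_card f i)%N = m.
Proof.
rewrite -[RHS](card_ord m) -sum1_card (partition_big f xpredT)//=.
by apply: eq_bigr => i _; rewrite sum1_card.
Qed.

Lemma expr_sum_ffun m (y : 'I_n -> R) :
  (\sum_i y i) ^+ m =
  \sum_(f : {ffun 'I_m -> 'I_n}) \prod_i y i ^+ fiber_card f i.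
Proof.
rewrite -[in LHS](card_ord m) -prodr_const bigA_distr_bigA/=.
apply: eq_bigr => f _; rewrite (partition_big f xpredT)//=.
apply: eq_bigr => i _; rewrite (eq_bigr (fun=> y i)) ?prodr_const//.
by move=> k /eqP ->.
Qed.

Let alt (c : 'I_n -> nat) x : R := \det (\matrix_(i < n, j < n) x j ^+ c i).

Let alt_noninj c x : ~ injective c -> alt c x = 0.
Proof.
move=> ninj; have [i [j [ij cij]]] : exists i j : 'I_n, i != j /\ c i = c j.
  apply: contrapT => h; apply: ninj => i j cij; apply: contrapT => /eqP ij.
  by apply: h; exists i, j.
by apply: (@determinant_alternate _ _ _ i j) => // k; rewrite !mxE cij.
Qed.

Let alt_perm (t : {perm 'I_n}) x : alt (fun i => t i) x = (-1) ^+ t * vdm x.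
Proof.
rewrite /alt (_ : (\matrix_(i, j) _) = row_perm t (\matrix_(i < n, j < n) x j ^+
  i)).
  by rewrite row_permE det_mulmx det_perm.
by apply/matrixP => i j; rewrite !mxE.
Qed.

(** The values of [c] below [n] occupy distinct slots among [0, ..., n - 1]. The values that are at
    least [n] are as many as the free slots, and each exceeds any slot by at least 1. The extra
    cardinal makes equality force all values below [n]. *)
Lemma sum_inj_ge (c : 'I_n -> nat) : injective c ->
  (\sum_(i < n) i + #|[pred i | n <= c i]| <= \sum_(i < n) c i)%N.
Proof.
move=> cinj; case: n c cinj => [|n'] c cinj.
  by rewrite !big_ord0 eq_card0// => -[].
pose A := [set i | (c i < n'.+1)%N]%SET.
pose g i : 'I_n'.+1 := inord (c i).
have gE i : i \in A -> g i = c i :> nat by rewrite inE => ?; rewrite /g inordK.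
have ginj : {in A &, injective g}.
  by move=> i j iA jA /(congr1 val)/=; rewrite !gE// => /cinj.
have cardB : #|[pred i | (n'.+1 <= c i)%N]| = #|~: (g @: A)|.
  have -> : #|[pred i | (n'.+1 <= c i)%N]| = #|~: A|.
    by apply: eq_card => i; rewrite !inE -leqNgt.
  by rewrite [LHS]cardsCs finset.setCK [RHS]cardsCs finset.setCK card_in_imset.
rewrite (bigID (mem (g @: A)))/= big_imset//=.
rewrite [leqRHS](bigID (mem A))/= -addnA leq_add//.
  by rewrite leq_eqVlt; apply/orP; left; apply/eqP; apply: eq_bigr => i iA;
    rewrite gE.
apply: (@leq_trans (\sum_(i | i \notin A) n'.+1)%N); last first.
  by apply: leq_sum => i; rewrite inE -leqNgt.
rewrite sum_nat_const.
have -> : #|[pred i | i \notin A]| = #|[pred i | (n'.+1 <= c i)%N]|.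
  by apply: eq_card => i; rewrite !inE -leqNgt.
rewrite mulnS addnC leq_add2l cardB.
apply: (@leq_trans (\sum_(i | i \notin g @: A) n')%N).
  by apply: leq_sum => i _; rewrite -ltnS.
by rewrite sum_nat_const; apply: eq_leq; congr (_ * _)%N; apply: eq_card => i;
  rewrite !inE.
Qed.

Let signed_sum m x y : R :=
  \sum_(s : {perm 'I_n}) (-1) ^+ s * (\sum_i x i * y (s i)) ^+ m.

(** After expansion, the signed sum over [s] of one monomial in the permuted [y] is the Leibniz
    formula for [alt]. *)
Let signed_sumE m x y : signed_sum m x y =
  \sum_(f : {ffun 'I_m -> 'I_n})
    (\prod_i x i ^+ fiber_card f i) * alt (fiber_card f) y.
Proof.
rewrite /signed_sum; under eq_bigr do rewrite expr_sum_ffun mulr_sumr.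
rewrite exchange_big/=; apply: eq_bigr => f _.
rewrite /alt /determinant mulr_sumr; apply: eq_bigr => s _.
rewrite mulrCA -big_split/=; congr (_ * _); apply: eq_bigr => i _.
by rewrite mxE exprMn.
Qed.

(* A monomial survives antisymmetrisation only if its exponents are distinct,
   so that its degree is at least [0 + 1 + ... + (n - 1)]. *)
Lemma signed_sum_eq0 m x y : (m < 'C(n, 2))%N ->
  \sum_(s : {perm 'I_n}) (-1) ^+ s * (\sum_i x i * y (s i)) ^+ m = 0.
Proof.
move=> mn; rewrite -[LHS]/(signed_sum m x y) signed_sumE big1// => f _.
rewrite alt_noninj ?mulr0// => /sum_inj_ge.
rewrite sum_fiber_card => h; move: mn.
by rewrite -bin2_sum big_mkord ltnNge (leq_trans (leq_addr _ _) h).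
Qed.

(* For [m = 'C(n, 2)] this is the multinomial coefficient
   [m! / (0! 1! ... (n-1)!)]. *)
Definition fiber_count m : nat :=
  #|[pred f : {ffun 'I_m -> 'I_n} | [forall i, fiber_card f i == i]]|.

(** The witness is the sequence that lists each [i] exactly [i] times; its length is
    [0 + 1 + ... + (n - 1)]. *)
Lemma fiber_count_gt0 : (0 < fiber_count 'C(n, 2))%N.
Proof.
pose s := flatten [seq nseq i i | i : 'I_n <- enum 'I_n].
have ss : size s == 'C(n, 2).
  rewrite size_flatten /shape -map_comp sumnE big_map -bin2_sum big_mkord.
  by rewrite big_enum; apply/eqP/eq_bigr => i _; rewrite /= size_nseq.
apply/card_gt0P; exists [ffun k => tnth (Tuple ss) k].
rewrite inE; apply/forallP => i; rewrite /fiber_card -sum1_card.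
under eq_bigl do rewrite inE ffunE.
rewrite -(big_tuple _ _ (Tuple ss) (pred1 i) (fun=> 1%N)) sum1_count/=.
rewrite count_flatten -map_comp sumnE big_map big_enum (bigD1 i)//=.
rewrite count_nseq/= eqxx mul1n big1 ?addn0// => j ji.
by rewrite count_nseq/= (negbTE ji) mul0n.
Qed.

(** In this degree the surviving exponent vectors are exactly the permutations [t] of
    [0, ..., n - 1]. Each arises from the same number of choices [f], and the signed sum of the
    monomials in [x] is again a Vandermonde determinant. *)
Lemma signed_sum_vdm x y :
  \sum_(s : {perm 'I_n}) (-1) ^+ s * (\sum_i x i * y (s i)) ^+ 'C(n, 2) =
  (fiber_count 'C(n, 2))%:R * vdm x * vdm y.
Proof.
rewrite -[LHS]/(signed_sum _ x y) signed_sumE.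
pose E (f : {ffun 'I_('C(n, 2)) -> 'I_n}) (t : {perm 'I_n}) :=
  [forall i, fiber_card f i == t i].
(* Relabelling the values of [f] by the inverse of [t] reduces the count to [t = 1]. *)
have cardE t : #|[pred f | E f t]| = fiber_count 'C(n, 2).
  rewrite /fiber_count -!sum1_card.
  pose h (u : {perm 'I_n}) (f : {ffun 'I_('C(n, 2)) -> 'I_n}) := [ffun k => u (f
    k)].
  rewrite (reindex (h (t^-1)%g)); last first.
    exists (h t) => f _; apply/ffunP => k; rewrite !ffunE ?permKV ?permK//.
  apply: eq_bigl => f; rewrite !inE /E.
  apply/forallP/forallP => H i.
    have /eqP := H ((t^-1)%g i); rewrite permKV => <-; apply/eqP.
    by apply: eq_card => k; rewrite !inE ffunE (inj_eq perm_inj).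
  rewrite -(eqP (H (t i))); apply/eqP.
  by apply: eq_card => k; rewrite !inE ffunE -(inj_eq (@perm_inj _ t)) permKV.
(* The inner sum has one term if the exponents of [f] are distinct, and is empty otherwise, in which
   case [alt] vanishes. *)
transitivity (\sum_(f : {ffun 'I_('C(n, 2)) -> 'I_n}) \sum_(t | E f t)
    (\prod_i x i ^+ t i) * ((-1) ^+ t * vdm y)).
  apply: eq_bigr => f _.
  have [finj|ninj] := pselect (injective (fiber_card f)); last first.
    rewrite alt_noninj// mulr0 big1// => t /forallP ft; exfalso; apply: ninj.
    by move=> i j; rewrite (eqP (ft i)) (eqP (ft j)) => /ord_inj/perm_inj.
  have flt i : (fiber_card f i < n)%N.
    have hM : (\sum_(i < n) fiber_card f i = \sum_(i < n) i)%N.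
      by rewrite sum_fiber_card -bin2_sum big_mkord.
    have := sum_inj_ge finj; rewrite hM.
    rewrite -[X in (_ <= X)%N -> _]addn0 leq_add2l leqn0 => /eqP/card0_eq/(_ i).
    by rewrite inE ltnNge => ->.
  have tinj : injective (fun i => Ordinal (flt i)).
    by move=> i j /(congr1 val)/= /finj.
  rewrite (big_pred1 (perm tinj)) => [|t].
    rewrite -alt_perm; congr (_ * _).
      by apply: eq_bigr => i _; rewrite permE.
    by congr (\det _); apply/matrixP => i j; rewrite !mxE permE.
  apply/forallP/eqP => [H|-> i]; last by rewrite permE.
  by apply/permP => i; apply: ord_inj; rewrite permE/= (eqP (H i)).
rewrite (exchange_big_dep xpredT)//=.
under eq_bigr => t _ do rewrite sumr_const cardE mulrA -mulr_natl mulrA.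
rewrite -mulr_suml; congr (_ * _).
rewrite -mulr_sumr; congr (_ * _).
rewrite /vdm -det_tr /determinant; apply: eq_bigr => t _.
by rewrite mulrC; congr (_ * _); apply: eq_bigr => i _; rewrite !mxE.
Qed.

End vandermonde.

Lemma vdm_neq0 (R : idomainType) n (x : 'I_n -> R) : injective x -> vdm x != 0.
Proof.
move=> x_inj; rewrite vdm_prod; apply/prodf_neq0 => i _.
apply/prodf_neq0 => j ij; rewrite subr_eq0.
by apply/eqP => /x_inj ji; move: ij; rewrite ji ltnn.
Qed.

Section exp_taylor.
Context (R : realType).

(** The tail of the series, shifted by [m], is dominated by the whole series at the absolute value
    of [y], since [(i + m)!] is at least [i!]. This crude constant suffices. *)
Lemma expR_taylor m (y : R) :
  `|expR y - \sum_(k < m) y ^+ k / k`!%:R| <= `|y| ^+ m * expR `|y|.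
Proof.
have le_series N (z : R) : 0 <= z -> \sum_(k < N) z ^+ k / k`!%:R <= expR z.
  move=> z0.
  have /cvg_lim <- // : series (exp_coeff z) n @[n --> \oo] --> expR z.
    exact: is_cvg_series_exp_coeff.
  rewrite -(big_mkord xpredT (fun k => z ^+ k / k`!%:R)).
  apply: (@nondecreasing_cvgn_le _ (series (exp_coeff z))).
    apply: nondecreasing_series => k _ _; exact: exp_coeff_ge0.
  exact: is_cvg_series_exp_coeff.
have cvgy : `|series (exp_coeff y) N - \sum_(k < m) y ^+ k / k`!%:R| @[N -->
  \oo] -->
    `|expR y - \sum_(k < m) y ^+ k / k`!%:R|.
  apply: cvg_norm; apply: cvgB; last exact: cvg_cst.
  exact: is_cvg_series_exp_coeff.
have /cvg_lim <- // := cvgy.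
apply: limr_le; first by apply/cvg_ex; eexists; exact: cvgy.
near=> N.
have mN : (m <= N)%N by near: N; exact: nbhs_infty_ge.
rewrite /series/= -(big_mkord xpredT (fun k => y ^+ k / k`!%:R)).
rewrite (_ : \sum_(0 <= k < N) exp_coeff y k = \sum_(0 <= k < m) exp_coeff y k +
    \sum_(m <= k < N) exp_coeff y k); last by rewrite -big_cat_nat.
rewrite addrAC subrr add0r.
apply: le_trans (ler_norm_sum _ _ _) _.
rewrite -{1}(add0n m) big_addn big_mkord.
apply: (@le_trans _ _ (\sum_(i < N - m) `|y| ^+ m * (`|y| ^+ i / i`!%:R))).
  apply: ler_sum => i _; rewrite /exp_coeff normrM normrX exprD.
  rewrite (mulrC (`|y| ^+ i)) -mulrA ler_wpM2l ?exprn_ge0// ler_wpM2l ?exprn_ge0//.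
  rewrite ger0_norm// lef_pV2 ?posrE ?ltr0n ?fact_gt0// ler_nat.
  by apply: leq_fact; rewrite leq_addr.
by rewrite -mulr_sumr ler_wpM2l ?exprn_ge0// le_series.
Unshelve. all: by end_near. Qed.

End exp_taylor.

(** * Radial laws *)

Lemma measurable_sg (R : realType) : measurable_fun setT (@Num.sg R).
Proof.
rewrite (_ : Num.sg = fun x : R => \1_(`]0, +oo[%classic) x - \1_(`]-oo,
  0[%classic) x).
  by apply: measurable_funB; exact: measurable_indic.
apply/funext => x; rewrite !indicE !mem_setE !in_itv/= andbT.
by case: sgrP => _; rewrite ?subr0 ?sub0r.
Qed.

Section measurability.
Context (R : realType) (n : nat).

Lemma enorm_ge0 (x : 'I_n -> R) : 0 <= enorm x.
Proof. exact: sqrtr_ge0. Qed.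

Lemma sqr_enorm (x : 'I_n -> R) : enorm x ^+ 2 = \sum_i x i ^+ 2.
Proof. by rewrite sqr_sqrtr// sumr_ge0// => i _; exact: sqr_ge0. Qed.

Lemma enorm_scale (c : R) (x : 'I_n -> R) : 0 <= c ->
  enorm (fun i => c * x i) = c * enorm x.
Proof.
move=> c0; rewrite /enorm; under eq_bigr do rewrite exprMn.
by rewrite -mulr_sumr sqrtrM ?sqr_ge0// sqrtr_sqr ger0_norm.
Qed.

Lemma enorm_perm (x : 'I_n -> R) (s : {perm 'I_n}) :
  enorm (fun i => x (s i)) = enorm x.
Proof. by rewrite /enorm [in RHS](reindex_inj (@perm_inj _ s)). Qed.

Lemma measurable_sqrt : measurable_fun setT (@Num.sqrt R).
Proof. by apply: continuous_measurable_fun; exact: sqrt_continuous. Qed.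

Lemma measurable_enorm :
  measurable_fun setT (fun x : rvect R 'I_n => enorm x).
Proof.
apply: (measurableT_comp measurable_sqrt).
by apply: measurable_sum => i; apply: measurable_funX; exact: measurable_coord.
Qed.

Lemma measurable_vdm : measurable_fun setT (fun x : rvect R 'I_n => vdm x).
Proof.
rewrite (_ : (fun x => _) = (fun x : rvect R 'I_n =>
    \prod_(i < n) \prod_(j < n) if (i < j)%N then x j - x i else 1)).
  apply: measurable_prod => i _; apply: measurable_prod => j _.
  case: (i < j)%N => //.
  by apply: measurable_funB; exact: measurable_coord.
apply/funext => x; rewrite vdm_prod.
by apply: eq_bigr => i _; rewrite big_mkcond.
Qed.

End measurability.

Section boxes.
Context (R : realType) (I : finType) d (T : measurableType d)
  (P : probability T R) (N : I -> T -> R) (sN : standard_normals P N).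

Lemma standard_normals_box_gt0 (a b : I -> R) : (forall i, a i < b i) ->
  (0 < P (\bigcap_i (N i @^-1` `]a i, b i[)))%E.
Proof.
move=> ab; rewrite sN.1.2//.
elim/big_ind : _ => //; first by move=> x y; exact: mule_gt0.
by move=> i _; rewrite sN.2// normal_prob_itv_gt0// oner_eq0.
Qed.

Lemma measurable_box (a b : I -> R) :
  measurable (\bigcap_i (N i @^-1` `]a i, b i[)).
Proof.
apply: fin_bigcap_measurable => // i _.
by rewrite -[X in measurable X]setTI; apply: sN.1.1.
Qed.

End boxes.

(** * Homogeneous weights and the scaling of balls *)

Section radial_mass.
Local Open Scope ereal_scope.
Context (R : realType) (n : nat) d (T : measurableType d)
  (P : probability T R) (N : 'I_n -> T -> R) (sN : standard_normals P N).
Variables (m : nat) (W : rvect R 'I_n -> R).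
Hypotheses (mW : measurable_fun setT W) (W0 : forall x, (0 <= W x)%R).
Hypothesis WZ : forall c x, (0 < c)%R -> W (fun i => c * x i)%R = (c ^+ m * W x)%R.

(** The exponential cancels the Gaussian density: the weighted law of [N] is, up to a constant, [W]
    times Lebesgue measure, so that it inherits the homogeneity of both. *)
Definition radial_weight (x : rvect R 'I_n) : R :=
  (W x * expR (enorm x ^+ 2 / 2))%R.

Lemma measurable_radial_weight : measurable_fun setT radial_weight.
Proof.
apply: measurable_funM => //; apply: measurableT_comp => //.
by apply: measurable_funM => //; apply: measurable_funX; exact: measurable_enorm.
Qed.

Lemma radial_weight_ge0 x : (0 <= radial_weight x)%R.
Proof. by rewrite mulr_ge0// expR_ge0. Qed.

Let mNv : measurable_fun setT (fun w => (N ^~ w) : rvect R 'I_n).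
Proof. exact: measurable_rvect sN.1.1. Qed.

Definition radial_mass (r : R) : \bar R :=
  \int[P]_w (\1_(`]-oo, r[%classic) (enorm (N ^~ w)) * radial_weight (N ^~ w))%:E.

Lemma radial_massE (r : R) : (0 < r)%R ->
  radial_mass r = (r ^+ (n + m))%:E * radial_mass 1.
Proof.
move=> r0; have rn0 : r != 0%R by rewrite gt_eqF.
(* The exponent is chosen so that [F] at [r * N] gives [r ^+ m] times the mass of the unit ball,
   while the scaling density multiplied by [F] at [N] gives [r ^- n] times the mass of the ball of
   radius [r]. *)
pose F (x : rvect R 'I_n) := (\1_(`]-oo, r[%classic) (enorm x) *
  (W x * expR (enorm x ^+ 2 / (2 * r ^+ 2))))%R.
have mF : measurable_fun setT F.
  apply: measurable_funM.
    by apply: measurableT_comp; [exact: measurable_indic|exact: measurable_enorm].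
  apply: measurable_funM => //; apply: measurableT_comp => //.
  by apply: measurable_funM => //; apply: measurable_funX; exact: measurable_enorm.
have mG s : measurable_fun setT (fun w => (\1_(`]-oo, s[%classic) (enorm (N ^~ w)) *
    radial_weight (N ^~ w))%:E).
  apply/measurable_EFinP; apply: measurable_funM.
    apply: (measurableT_comp (measurable_indic _)) => //.
    exact: measurableT_comp (@measurable_enorm R n) mNv.
  exact: measurableT_comp measurable_radial_weight mNv.
have G0 s w : 0 <= (\1_(`]-oo, s[%classic) (enorm (N ^~ w)) * radial_weight (N
  ^~ w))%:E.
  by rewrite lee_fin mulr_ge0// radial_weight_ge0.
have /= := integral_scale_normals sN r0 mF.
rewrite (_ : \int[P]_w _ = (r ^+ m)%:E * radial_mass 1); last first.
  rewrite -ge0_integralZl_EFin//; last by rewrite exprn_ge0 ?ltW.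
  apply: eq_integral => w _;
    rewrite -EFinM /F /radial_weight WZ// enorm_scale ?ltW//.
  congr (_%:E); rewrite !indicE.
  have -> : ((r * enorm (N ^~ w))%R \in `]-oo, r[%classic) =
            (enorm (N ^~ w) \in `]-oo, 1%R[%classic).
    apply/idP/idP; rewrite !inE/= !in_itv/=.
      by rewrite -[X in (_ < X)%R -> _]mulr1 ltr_pM2l.
    by rewrite -[X in _ -> (_ < X)%R]mulr1 ltr_pM2l.
  have -> : ((r * enorm (N ^~ w)) ^+ 2 / (2 * r ^+ 2) = enorm (N ^~ w) ^+ 2 / 2)%R.
    by field.
  by ring.
rewrite [X in _ = X](_ : _ = (r ^- n)%:E * radial_mass r); last first.
  rewrite -ge0_integralZl_EFin//; last by rewrite invr_ge0 exprn_ge0 ?ltW.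
  apply: eq_integral => w _; rewrite -EFinM /F /radial_weight.
  rewrite big_split/= prodr_const card_ord -expR_sum -mulr_suml -mulr_sumr
    -sqr_enorm.
  rewrite exprVn mulrCA; congr (_%:E); rewrite -!mulrA; congr (_ * (_ * (_ * _)))%R.
  rewrite -expRD; congr expR; field.
  by rewrite rn0.
move=> e; rewrite exprD EFinM -muleA e muleA -EFinM mulfV ?mul1e//.
by rewrite expf_neq0.
Qed.

Lemma radial_mass_npos (r : R) : (r <= 0)%R -> radial_mass r = 0.
Proof.
move=> r0; rewrite /radial_mass integral0_eq// => w _.
rewrite indicE memNset ?mul0r//= in_itv/=; apply/negP; rewrite -leNgt.
by rewrite (le_trans r0)// enorm_ge0.
Qed.

Lemma radial_mass1_lty : \int[P]_w (W (N ^~ w))%:E < +oo -> radial_mass 1 < +oo.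
Proof.
move=> Woo; apply: (@le_lt_trans _ _ (\int[P]_w ((expR (1 / 2))%:E * (W (N ^~
  w))%:E))).
  apply: ge0_le_integral => //.
  - by move=> w _; rewrite lee_fin mulr_ge0// radial_weight_ge0.
  - apply/measurable_EFinP; apply: measurable_funM.
      apply: (measurableT_comp (measurable_indic _)) => //.
      exact: measurableT_comp (@measurable_enorm R n) mNv.
    exact: measurableT_comp measurable_radial_weight mNv.
  - apply: measurable_funeM; apply/measurable_EFinP.
    exact: measurableT_comp mW mNv.
  - move=> w _; rewrite -EFinM lee_fin indicE.
    case: (boolP (_ \in _)) => [|_].
      rewrite inE/= in_itv/= => N1;
        rewrite (_ : true%:R = 1%R)// mul1r /radial_weight [leRHS]mulrC ler_wpM2l//.
      rewrite ler_expR ler_pM2r// -[leRHS](expr1n _ 2).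
      by rewrite lerXn2r ?nnegrE ?enorm_ge0// ltW.
    by rewrite (_ : false%:R = 0%R)// mul0r mulr_ge0 ?expR_ge0.
rewrite ge0_integralZl_EFin ?expR_ge0//.
- by rewrite lte_mul_pinfty// lee_fin expR_ge0.
- by move=> w _; rewrite lee_fin.
- by apply/measurable_EFinP; exact: measurableT_comp mW mNv.
Qed.

End radial_mass.

Section radial_law.
Local Open Scope ereal_scope.
Context (R : realType) (n : nat) d (T : measurableType d)
  (P : probability T R) (N : 'I_n -> T -> R) (sN : standard_normals P N).
Variables (m : nat) (W : rvect R 'I_n -> R).
Hypotheses (mW : measurable_fun setT W) (W0 : forall x, (0 <= W x)%R).
Hypothesis WZ : forall c x, (0 < c)%R -> W (fun i => c * x i)%R = (c ^+ m * W x)%R.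
Hypothesis Woo : \int[P]_w (W (N ^~ w))%:E < +oo.
Context d' (T' : measurableType d') (P' : probability T' R)
  (Z : 'I_(n + m) -> T' -> R) (sZ : standard_normals P' Z).

Let mNv : measurable_fun setT (fun w => (N ^~ w) : rvect R 'I_n).
Proof. exact: measurable_rvect sN.1.1. Qed.

Let mZv : measurable_fun setT (fun w => (Z ^~ w) : rvect R 'I_(n + m)).
Proof. exact: measurable_rvect sZ.1.1. Qed.

(** The law of the norm of [Z] is the case of a constant weight, of degree 0, in dimension [n + m];
    both masses then scale with the same exponent. *)
Let one (x : rvect R 'I_(n + m)) : R := 1%R.

Let one0 x : (0 <= one x)%R. Proof. exact: ler01. Qed.

Let mone : measurable_fun setT one. Proof. exact: measurable_cst. Qed.

Let oneZ c x : (0 < c)%R -> one (fun i => c * x i)%R = (c ^+ 0 * one x)%R.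
Proof. by rewrite expr0 mulr1. Qed.

Let uN w := radial_weight W (N ^~ w).
Let uZ w := radial_weight one (Z ^~ w).

Let muN : measurable_fun setT uN.
Proof. exact: measurableT_comp (measurable_radial_weight mW) mNv. Qed.

Let muZ : measurable_fun setT uZ.
Proof. exact: measurableT_comp (measurable_radial_weight mone) mZv. Qed.

Let uN0 w : (0 <= uN w)%R. Proof. exact: radial_weight_ge0. Qed.
Let uZ0 w : (0 <= uZ w)%R. Proof. exact: radial_weight_ge0. Qed.

Let eN w := enorm (N ^~ w).
Let eZ w := enorm (Z ^~ w).

Let meN : measurable_fun setT eN.
Proof. exact: measurableT_comp (@measurable_enorm R n) mNv. Qed.

Let meZ : measurable_fun setT eZ.
Proof. exact: measurableT_comp (@measurable_enorm R (n + m)) mZv. Qed.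

Let lawN : {measure set R -> \bar R} :=
  measure_function_pushforward__canonical__measure_function_Measure
    (weighted P muN uN0) meN.
Let lawZ : {measure set R -> \bar R} :=
  measure_function_pushforward__canonical__measure_function_Measure
    (weighted P' muZ uZ0) meZ.

Let GN := radial_mass P N W 1.
Let GZ := radial_mass P' Z one 1.

Let lawN_itv (r : R) : lawN `]-oo, r[%classic = radial_mass P N W r.
Proof.
rewrite -[LHS]/(\int[P]_(w in _ @^-1` _) (uN w)%:E) integral_mkcond epatch_indic.
by apply: eq_integral => w _; rewrite /= -EFinM mulrC.
Qed.

Let lawZ_itv (r : R) : lawZ `]-oo, r[%classic = radial_mass P' Z one r.
Proof.
rewrite -[LHS]/(\int[P']_(w in _ @^-1` _) (uZ w)%:E) integral_mkcond epatch_indic.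
by apply: eq_integral => w _; rewrite /= -EFinM mulrC.
Qed.

Let GN_lty : GN < +oo.
Proof. exact: (radial_mass1_lty sN). Qed.

Let GZ_lty : GZ < +oo.
Proof.
apply: (radial_mass1_lty sZ mone one0).
rewrite -[ltLHS]/(\int[P']_(w in setT) cst 1 w).
by rewrite integral_cst// mul1e (le_lt_trans (probability_le1 _ _)) ?ltry.
Qed.

Let GN_ge0 : 0 <= GN.
Proof. by apply: integral_ge0 => w _;
  rewrite lee_fin mulr_ge0// radial_weight_ge0. Qed.

Let GZ_gt0 : 0 < GZ.
Proof.
(* On the box of half-side [e] each square is at most [e], so that the squared norm is at most
   [(n + m) * e], which is less than 1. *)
pose e : R := ((n + m).+1%:R^-1)%R.
have e0 : (0 < e)%R by rewrite invr_gt0 ltr0n.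
pose B := \bigcap_i (Z i @^-1` `](- e)%R, e[).
have B0 : 0 < P' B.
  by apply: (standard_normals_box_gt0 sZ (a := fun=> (- e)%R) (b := fun=> e)) =>
    i; rewrite gtrN.
have mB : measurable B by exact: (measurable_box sZ (fun=> (- e)%R) (fun=> e)).
apply: (lt_le_trans B0).
apply: (@le_trans _ _ (\int[P']_w (\1_B w)%:E)).
  by rewrite integral_indic// setIT.
apply: ge0_le_integral => //.
- by apply/measurable_EFinP; exact: measurable_indic.
- apply/measurable_EFinP; apply: measurable_funM => //.
  by apply: (measurableT_comp (measurable_indic _)).
- move=> w _; rewrite lee_fin indicE.
  case: (boolP (w \in B)) => [|_]; last by rewrite mulr_ge0// radial_weight_ge0.
  rewrite inE => Bw; rewrite indicE mem_set/=.
    by rewrite mul1r /radial_weight mul1r -expR0 ler_expR divr_ge0 ?sqr_ge0.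
  rewrite in_itv/= -(@expr_lt1 _ 2)// ?enorm_ge0// sqr_enorm.
  apply: (@le_lt_trans _ _ (\sum_(i < n + m) e)%R).
    apply: ler_sum => i _; have := Bw i Logic.I;
      rewrite /= in_itv/= -ltr_norml => Zi.
    rewrite -real_normK ?num_real// expr2 -[leRHS]mulr1.
    have e1 : (e <= 1)%R by rewrite invf_le1 ?ltr0n// ler1n.
    by apply: ler_pM => //; [exact: ltW|exact: le_trans (ltW Zi) e1].
  rewrite sumr_const card_ord -mulr_natl.
  by rewrite ltr_pdivrMr ?ltr0n// mul1r ltr_nat.
Qed.

(** Cross-multiplied so that [GN = 0] needs no separate case. Open rays form a generating pi-system,
    and there [radial_massE] decides. *)
Let law_eq A : measurable A ->
  mscale (NngNum (fine_ge0 (ltW GZ_gt0))) lawN A =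
  mscale (NngNum (fine_ge0 GN_ge0)) lawZ A.
Proof.
have fGN : GN \is a fin_num by rewrite ge0_fin_numE.
have fGZ : GZ \is a fin_num by rewrite ge0_fin_numE//; exact: ltW GZ_gt0.
pose lN : {measure set R -> \bar R} := mscale (NngNum (fine_ge0 (ltW GZ_gt0))) lawN.
pose lZ : {measure set R -> \bar R} := mscale (NngNum (fine_ge0 GN_ge0)) lawZ.
move=> mA; refine (@measure_unique _ R R (@RGenInftyO.G R)
  (fun k => `]-oo, k%:R[%classic) (RGenInftyO.measurableE R) _ _ _ lN lZ _ _ A mA).
- move=> _ _ [x ->] [y ->]; exists (Num.min x y).
  by apply/seteqP; split => z /=; rewrite !in_itv/= lt_min => /andP.
- by move=> k; exists k%:R.
- apply/seteqP; split => // x _; exists (Num.truncn `|x|).+1 => //=.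
  rewrite in_itv/= (le_lt_trans (ler_norm _))// truncnS_gt//.
- move=> _ [r ->].
  rewrite -[LHS]/((fine GZ)%:E * lawN `]-oo, r[%classic) -[RHS]/((fine GN)%:E *
    lawZ `]-oo, r[%classic).
  rewrite !fineK// lawN_itv lawZ_itv.
  have [r0|r0] := leP r 0%R; first by rewrite !radial_mass_npos// !mule0.
  rewrite (radial_massE sN mW W0 WZ r0) (radial_massE sZ mone one0 oneZ r0).
  by rewrite addn0 -/GN -/GZ muleA muleC (muleC GZ).
- move=> k; rewrite -[ltLHS]/((fine GZ)%:E * lawN `]-oo, (k%:R : R)[%classic).
  rewrite lte_mul_pinfty// ?lee_fin ?fine_ge0 ?ltW// lawN_itv.
  have [k0|k0] := leP (k%:R : R) 0%R; first by rewrite radial_mass_npos.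
  rewrite (radial_massE sN mW W0 WZ k0) lte_mul_pinfty// lee_fin exprn_ge0//.
Qed.

(* By homogeneity and Gaussian scaling, the masses that [W(N) exp(|N|^2/2)] and
   [exp(|Z|^2/2)] give to the ball of radius [r] both are [r ^+ (n + m)] times
   their values at [r = 1], so that the two radial laws are proportional. *)
Lemma integral_radial (f : R -> R) : measurable_fun setT f ->
  (forall x, 0 <= f x)%R ->
  \int[P]_w (f (enorm (N ^~ w)) * W (N ^~ w))%:E =
  \int[P]_w (W (N ^~ w))%:E * \int[P']_w (f (enorm (Z ^~ w)))%:E.
Proof.
have key (g : R -> R) : measurable_fun setT g -> (forall x, 0 <= g x)%R ->
    GZ * \int[P]_w (g (enorm (N ^~ w)) * W (N ^~ w))%:E =
    GN * \int[P']_w (g (enorm (Z ^~ w)))%:E.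
  (* This factor undoes the exponential in [radial_weight]. *)
  move=> mg g0; pose h (r : R) := (g r * expR (- (r ^+ 2 / 2)))%R.
  have mh : measurable_fun setT h.
    apply: measurable_funM => //; apply: measurableT_comp => //.
    apply: measurableT_comp => //.
    by apply: measurable_funM => //; exact: exprn_measurable.
  have h0 r : (0 <= h r)%R by rewrite mulr_ge0 ?expR_ge0.
  have mhE : measurable_fun setT (EFin \o h) by exact/measurable_EFinP.
  have fGN : GN \is a fin_num by rewrite ge0_fin_numE.
  have fGZ : GZ \is a fin_num by rewrite ge0_fin_numE//; exact: ltW GZ_gt0.
  have : \int[mscale (NngNum (fine_ge0 (ltW GZ_gt0))) lawN]_r (h r)%:E =
         \int[mscale (NngNum (fine_ge0 GN_ge0)) lawZ]_r (h r)%:E.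
    by apply: eq_measure_integral => A mA _; exact: law_eq.
  rewrite !ge0_integral_mscale//; try by move=> r _; rewrite lee_fin.
  rewrite /= !fineK// !ge0_integral_pushforward//; try by move=> r _;
    rewrite lee_fin.
  have mhN : measurable_fun setT ((fun y : R => (h y)%:E) \o eN) by
    exact: measurableT_comp mhE meN.
  have mhZ : measurable_fun setT ((fun y : R => (h y)%:E) \o eZ) by
    exact: measurableT_comp mhE meZ.
  rewrite !ge0_integral_weighted//; try by (move=> w; rewrite lee_fin).
  move=> e.
  transitivity (GZ * \int[P]_x ((h (eN x))%:E * (uN x)%:E)).
    congr (_ * _); apply: eq_integral => w _.
    rewrite -EFinM /h /uN /radial_weight /eN; congr (_%:E).
    have E x : (expR (- x) * expR x = 1 :> R)%R by rewrite -expRD addNr expR0.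
    by rewrite mulrCA -!mulrA E mulr1 mulrC.
  rewrite [LHS]e; congr (_ * _); apply: eq_integral => w _.
  rewrite -EFinM /h /uZ /radial_weight /eZ mul1r -mulrA; congr (_%:E).
  by rewrite -expRD addNr expR0 mulr1.
(* The instance [g = 1] identifies [GN] as [GZ] times the expectation of [W(N)]; then [GZ] is
   cancelled. *)
move=> mf f0; have := key f mf f0;
  have := key (cst 1%R) (measurable_cst _) (fun=> ler01).
have -> : \int[P']_w (cst 1 (enorm (Z ^~ w)))%:E = 1.
  rewrite -[LHS]/(\int[P']_(w in setT) cst 1 w).
  by rewrite integral_cst// mul1e; exact: probability_setT.
rewrite mule1 => <-.
have -> : \int[P]_w (cst 1 (enorm (N ^~ w)) * W (N ^~ w))%:E =
    \int[P]_w (W (N ^~ w))%:E by apply: eq_integral => w _; rewrite /= mul1r.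
rewrite -muleA => e.
have fGZ : GZ \is a fin_num by rewrite ge0_fin_numE//; exact: ltW GZ_gt0.
have gn0 : fine GZ != 0%R by rewrite gt_eqF// fine_gt0// GZ_gt0 GZ_lty.
rewrite -[LHS]mul1e -[RHS]mul1e -(mulVf gn0) EFinM -!muleA fineK//.
by rewrite e.
Qed.

End radial_law.

(** * The reflection principle for random walks *)

Section bounded_integrals.
Context d (T : measurableType d) (R : realType) (P : probability T R).

Lemma integrable_bounded (f : T -> R) (C : R) : measurable_fun setT f ->
  (forall x, `|f x| <= C) -> P.-integrable setT (EFin \o f).
Proof.
move=> mf fC; apply: measurable_bounded_integrable => //.
  by rewrite [ltLHS]probability_setT ltry.
exists C; split; first exact: num_real.
by move=> y Cy x _ /=; rewrite (le_trans (fC x))// ltW.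
Qed.

End bounded_integrals.

Section reflection.
Context (R : realType) (n K : nat) (eta : 'I_n -> R).

Let I : finType := ('I_n * 'I_K)%type.

Definition walk (a : rvect R I) (m : nat) (i : 'I_n) : R :=
  eta i + \sum_(l < K | (l < m)%N) a (i, l).

Lemma measurable_walk m i : measurable_fun setT (fun a => walk a m i).
Proof.
apply: measurable_funD => //.
rewrite (_ : (fun a => _) =
    (fun a : rvect R I => \sum_(l < K) if (l < m)%N then a (i, l) else 0)).
  apply: measurable_sum => l; case: (l < m)%N => //; exact: measurable_coord.
by apply/funext => a; rewrite big_mkcond.
Qed.

(** A test is a time together with a pair of coordinates. A list of tests sorted by time is scanned
    by induction, and its first success stands for the first collision. *)
Definition wclose (e : R) (a : rvect R I) (t : nat * ('I_n * 'I_n)) : bool :=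
  (t.2.1 != t.2.2) && (`|walk a t.1 t.2.1 - walk a t.1 t.2.2| <= e).

Let bad e (ts : seq (nat * ('I_n * 'I_n))) (a : rvect R I) : R :=
  (has (wclose e a) ts)%:R.

Let measurable_wclose e t : measurable_fun setT (fun a => (wclose e a t)%:R : R).
Proof.
rewrite /wclose; case: (t.2.1 != t.2.2) => /=; last exact: measurable_cst.
rewrite (_ : (fun a => _) =
  (fun a => \1_(`]-oo, e]%classic) `|walk a t.1 t.2.1 - walk a t.1 t.2.2|)).
  apply: (measurableT_comp (measurable_indic _)) => //.
  apply: measurableT_comp => //.
  by apply: measurable_funB; exact: measurable_walk.
by apply/funext => a; rewrite indicE mem_setE.
Qed.

Let bad_rcons e ts t a :
  bad e (rcons ts t) a = bad e ts a + (1 - bad e ts a) * (wclose e a t)%:R.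
Proof.
rewrite /bad has_rcons; case: (has _ ts); rewrite ?orbT/=.
  by rewrite subrr mul0r addr0.
by rewrite orbF subr0 mul1r add0r.
Qed.

Let measurable_bad e ts : measurable_fun setT (bad e ts).
Proof.
elim/last_ind: ts => [|ts t IH]; first exact: measurable_cst.
rewrite (_ : bad _ _ = fun a => bad e ts a + (1 - bad e ts a) * (wclose e a t)%:R).
  apply: measurable_funD => //; apply: measurable_funM;
    last exact: measurable_wclose.
  exact: measurable_funB.
by apply/funext => a; exact: bad_rcons.
Qed.

Let bad_01 e ts a : 0 <= bad e ts a <= 1.
Proof. by rewrite /bad; case: has; rewrite ?lexx ?ler01. Qed.

Let swap_fun (m : nat) (p : 'I_n * 'I_n) (u : I) : I :=
  if (u.2 < m)%N then u else (tperm p.1 p.2 u.1, u.2).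

Let swap_inj m p : injective (swap_fun m p).
Proof.
apply: (can_inj (g := swap_fun m p)) => -[i l]; rewrite /swap_fun/=.
by case h: (l < m)%N => /=; rewrite h ?tpermK.
Qed.

Let swap m p (a : rvect R I) : rvect R I := fun u => a (perm (@swap_inj m p) u).

Let walk_swap m p a m' : (m' <= m)%N -> walk (swap m p a) m' = walk a m'.
Proof.
move=> m'm; apply/funext => i; rewrite /walk; congr (_ + _).
apply: eq_bigr => l lm; rewrite /swap permE /swap_fun/=.
by rewrite (leq_trans lm).
Qed.

Let wclose_swap e m p a t : (t.1 <= m)%N ->
  wclose e (swap m p a) t = wclose e a t.
Proof. by move=> tm; rewrite /wclose walk_swap. Qed.

(** The steps after time [m] are exchanged but the positions at time [m] are not, so the only error
    at the endpoint is the gap between the two coordinates at time [m]. *)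
Let swapped_walk m p a (i : 'I_n) :
  walk (swap m p a) K (tperm p.1 p.2 i) =
  walk a K i + (walk a m (tperm p.1 p.2 i) - walk a m i).
Proof.
have split b j : walk b K j =
    walk b m j + \sum_(l < K | ~~ (l < m)%N) b (j, l).
  rewrite /walk -addrA; congr (_ + _).
  rewrite -(bigID (fun l : 'I_K => (l < m)%N) xpredT)/=.
  by apply: eq_bigl => l; rewrite ltn_ord.
rewrite split walk_swap// split.
rewrite [X in _ + X = _](_ : _ = \sum_(l < K | ~~ (l < m)%N) a (i, l)).
  by ring.
apply: eq_bigr => l lm; rewrite /swap permE /swap_fun/= (negbTE lm)/=.
by rewrite tpermK.
Qed.

Context d (T : measurableType d) (P : probability T R) (xi : I -> T -> R).
Hypothesis ixi : independent P xi.
Hypothesis xiE : forall i j l (A : set R), measurable A ->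
  P (xi (i, l) @^-1` A) = P (xi (j, l) @^-1` A).
Variables (g : rvect R 'I_n -> R) (C : R).
Hypotheses (mg : measurable_fun setT g) (gC : forall x, `|g x| <= C).
Hypothesis gN : forall i j x, i != j -> g (fun k => x (tperm i j k)) = - g x.

Let mxi : measurable_fun setT (fun w => (xi ^~ w) : rvect R I).
Proof. exact: measurable_rvect ixi.1. Qed.

Let mgK (h : rvect R I -> 'I_n -> R) :
  (forall i, measurable_fun setT (fun a => h a i)) ->
  measurable_fun setT (fun a => g (h a)).
Proof.
by move=> mh; apply: (measurableT_comp mg);
  exact: (measurable_rvect (fun i => mh i)).
Qed.

Let mwalkK (i : 'I_n) : measurable_fun setT (fun a => walk a K i).
Proof. exact: measurable_walk. Qed.

Let sorted_times (ts : seq (nat * ('I_n * 'I_n))) :=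
  pairwise (fun t u => (t.1 <= u.1)%N) ts.

Let pert m p a : 'I_n -> R := fun i => walk (swap m p a) K (tperm p.1 p.2 i).

Let measurable_pert m p i : measurable_fun setT (fun a => pert m p a i).
Proof.
rewrite (_ : (fun a => _) = (fun a => walk a K i +
    (walk a m (tperm p.1 p.2 i) - walk a m i))).
  by apply: measurable_funD; [|apply: measurable_funB]; exact: measurable_walk.
by apply/funext => a; exact: swapped_walk.
Qed.

Let pert_close e m p a : 0 <= e -> wclose e a (m, p) ->
  forall i, `|pert m p a i - walk a K i| <= e.
Proof.
move=> e0 /andP[/= pn pe] i; rewrite /pert swapped_walk addrAC subrr add0r.
by case: tpermP => [->|->|] //; rewrite ?subrr ?normr0// distrC.
Qed.

Let norm_pm_le (b x : R) : 0 <= b <= 1 -> `|x| <= C -> `|b * x| <= C.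
Proof.
move=> /andP[b0 b1] xC; rewrite normrM (ger0_norm b0).
by apply: le_trans xC; rewrite ler_piMl.
Qed.

(* Interchanging rows [p.1] and [p.2] of [xi] after time [m] preserves the law
   and moves the endpoint of the walk to a reflection of [pert]. *)
Let swap_integral m p (G : rvect R I -> R) : p.1 != p.2 ->
  measurable_fun setT G -> (forall a, 0 <= G a <= 1) ->
  (forall a, G (swap m p a) = G a) ->
  \int[P]_w (G (xi ^~ w) * g (walk (xi ^~ w) K)) =
  - \int[P]_w (G (xi ^~ w) * g (pert m p (xi ^~ w))).
Proof.
move=> pn mG G01 Gs.
have mF : measurable_fun setT (fun a => G a * g (walk a K)).
  by apply: measurable_funM => //; exact: (mgK mwalkK).
have mF' : measurable_fun setT (fun a => G a * g (pert m p a)).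
  by apply: measurable_funM => //; apply: mgK => i; exact: measurable_pert.
transitivity (\int[P]_w (G (swap m p (xi ^~ w)) * g (walk (swap m p (xi ^~ w)) K))).
  congr fine; apply/esym.
  apply: (integral_perm_independent (F := fun a => G a * g (walk a K))
    (p := perm (@swap_inj m p)) ixi _ mF).
  by move=> [i l] A mA; rewrite permE /swap_fun/=; case: ifP => // _; exact: xiE.
rewrite -mulN1r -RintegralZl//; last first.
  apply: (@integrable_bounded _ _ _ P _ C); first exact: measurableT_comp mF' mxi.
  by move=> w; exact: norm_pm_le.
apply: eq_Rintegral => w _; rewrite Gs mulrCA; congr (_ * _).
by rewrite mulN1r /pert (gN _ pn) opprK.
Qed.

(** Decomposing according to the first successful test, each piece satisfies [2 * E[G g(walk)] =
    E[G (g(walk) - g(pert))]]. The clause that [Phi] vanishes where no test succeeds ensures that on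
    each path at most one piece is nonzero, so that the bound does not grow with the number of
    tests. *)
Let reflection_seq e (ts : seq (nat * ('I_n * 'I_n))) : 0 <= e ->
  sorted_times ts ->
  exists Phi : rvect R I -> R,
    [/\ measurable_fun setT Phi,
        \int[P]_w Phi (xi ^~ w) =
          2 * \int[P]_w (bad e ts (xi ^~ w) * g (walk (xi ^~ w) K)) &
        forall a, exists2 y : 'I_n -> R, forall i, `|y i - walk a K i| <= e &
          `|Phi a| <= `|g (walk a K) - g y| /\ (bad e ts a = 0 -> Phi a = 0)].
Proof.
move=> e0; elim/last_ind: ts => [_|ts [m p] IH].
  exists (fun=> 0); split => //.
    rewrite /bad/=; under [in RHS]eq_Rintegral do rewrite mul0r.
    by rewrite !Rintegral_cst// !mul0r mulr0.
  move=> a; exists (walk a K) => //; first by move=> i; rewrite subrr normr0.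
  by rewrite subrr.
rewrite /sorted_times pairwise_rcons => /andP[/allP tsm /IH].
move=> [Phi [mPhi PhiE PhiB]].
have [pE|pn] := eqVneq p.1 p.2.
  exists Phi; split => //.
    rewrite PhiE; congr (_ * _); apply: eq_Rintegral => w _.
    by rewrite bad_rcons /wclose/= pE eqxx mulr0 addr0.
  move=> a; have [y ye [Phiy Phi0]] := PhiB a; exists y => //; split => //.
  by rewrite bad_rcons /wclose/= pE eqxx mulr0 addr0.
(* The indicator that [(m, p)] is the first success. All earlier tests concern times up to [m], so
   it is invariant under the swap. *)
pose G a := (1 - bad e ts a) * (wclose e a (m, p))%:R.
have mG : measurable_fun setT G.
  apply: measurable_funM; last exact: measurable_wclose.
  exact: measurable_funB.
have G01 a : 0 <= G a <= 1.
  rewrite /G /bad; case: has; rewrite ?subrr ?mul0r ?lexx ?ler01//.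
  by rewrite subr0 mul1r; case: wclose; rewrite ?lexx ?ler01.
have Gs a : G (swap m p a) = G a.
  rewrite /G /bad wclose_swap//; congr ((1 - _%:R) * _); congr nat_of_bool.
  by apply: eq_in_has => t /tsm; exact: wclose_swap.
pose F a := G a * (g (walk a K) - g (pert m p a)).
have mwK : measurable_fun setT (fun a => g (walk a K)) by exact: mgK.
have mpK : measurable_fun setT (fun a => g (pert m p a)).
  by apply: mgK => i; exact: measurable_pert.
have mF : measurable_fun setT F by apply: measurable_funM => //;
  exact: measurable_funB.
have int1 (b h : rvect R I -> R) : measurable_fun setT b -> (forall a, 0 <= b a
  <= 1) ->
    measurable_fun setT h -> (forall a, `|h a| <= C) ->
    P.-integrable setT (EFin \o (fun w => b (xi ^~ w) * h (xi ^~ w))).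
  move=> mb b01 mh hC; apply: (@integrable_bounded _ _ _ P _ C).
    by apply: measurable_funM; [exact: measurableT_comp mb mxi|
      exact: measurableT_comp mh mxi].
  by move=> w; exact: norm_pm_le.
have FE : \int[P]_w F (xi ^~ w) = 2 * \int[P]_w (G (xi ^~ w) * g (walk (xi ^~ w)
  K)).
  under eq_Rintegral do rewrite /F mulrBr.
  rewrite RintegralB//; last 2 first.
  - exact: (int1 G (fun a => g (walk a K)) mG G01 mwK (fun=> gC _)).
  - exact: (int1 G (fun a => g (pert m p a)) mG G01 mpK (fun=> gC _)).
  by rewrite [X in _ = 2 * X](swap_integral pn mG G01 Gs) {1}(swap_integral pn
    mG G01 Gs); ring.
have PhiC a : `|Phi a| <= C + C.
  have [y _ [h _]] := PhiB a; apply: (le_trans h).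
  by rewrite (le_trans (ler_normB _ _))// lerD.
exists (fun a => Phi a + F a); split.
- exact: measurable_funD.
- rewrite RintegralD//; last 2 first.
  + apply: (@integrable_bounded _ _ _ P _ (C + C)) => //;
    exact: measurableT_comp mPhi mxi.
  + apply: (@integrable_bounded _ _ _ P _ (C + C));
    first exact: measurableT_comp mF mxi.
    move=> w; rewrite /F normrM; have /andP[g0 g1] := G01 (xi ^~ w).
    rewrite (ger0_norm g0) (le_trans (ler_piMl _ g1))//.
    by rewrite (le_trans (ler_normB _ _))// lerD.
  rewrite PhiE FE -mulrDr -RintegralD//; last 2 first.
  + exact: (int1 (bad e ts) (fun a => g (walk a K)) (measurable_bad e ts)
    (bad_01 e ts) mwK (fun=> gC _)).
  + exact: (int1 G (fun a => g (walk a K)) mG G01 mwK (fun=> gC _)).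
  congr (_ * _); apply: eq_Rintegral => w _.
  by rewrite bad_rcons -mulrDl.
- move=> a; have [y ye [Phiy Phi0]] := PhiB a.
  have [h|h] := boolP (has (wclose e a) ts).
    have Fa0 : F a = 0 by rewrite /F /G /bad h subrr !mul0r.
    exists y => //; rewrite Fa0 addr0; split=> //.
    by rewrite /bad has_rcons h orbT => /eqP; rewrite oner_eq0.
  have b0 : bad e ts a = 0 by rewrite /bad (negbTE h).
  rewrite Phi0// add0r.
  have [c|c] := boolP (wclose e a (m, p)).
    exists (pert m p a); first exact: pert_close.
    rewrite /F /G b0 c subr0 !mul1r; split => //.
    by rewrite /bad has_rcons c => /eqP; rewrite oner_eq0.
  exists (walk a K); first by move=> i; rewrite subrr normr0.
  by rewrite /F /G (negbTE c) mulr0 mul0r normr0 normr_ge0.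
Qed.

Definition wgood (e : R) (a : rvect R I) : bool :=
  [forall m : 'I_K.+1, [forall i : 'I_n, [forall j : 'I_n,
    (i != j) ==> (e < `|walk a m i - walk a m j|)]]].

Let tests : seq (nat * ('I_n * 'I_n)) :=
  sort (fun t u => (t.1 <= u.1)%N)
    [seq (val u.1, u.2) | u <- enum {: 'I_K.+1 * ('I_n * 'I_n)}].

Let bad_tests e a : has (wclose e a) tests = ~~ wgood e a.
Proof.
apply/hasP/idP => [[t]|].
  rewrite mem_sort => /mapP[[m [i j]] _ -> /andP[/= ij close]].
  apply/negP => /forallP/(_ m)/forallP/(_ i)/forallP/(_ j).
  by rewrite ij/= ltNge close.
rewrite negb_forall => /existsP[m]; rewrite negb_forall => /existsP[i].
rewrite negb_forall => /existsP[j]; rewrite negb_imply -leNgt => /andP[ij close].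
exists (val m, (i, j)); last by rewrite /wclose/= ij.
by rewrite mem_sort; apply/mapP; exists (m, (i, j)) => //; rewrite mem_enum.
Qed.

(** All grid times and pairs are tested. The bound on [Phi] depends on [e] but not on [K], which
    lets the mesh be chosen after the tolerance. *)
Lemma reflection e : 0 <= e ->
  exists Phi : rvect R I -> R,
    [/\ measurable_fun setT Phi,
        \int[P]_w Phi (xi ^~ w) =
          2 * \int[P]_w ((~~ wgood e (xi ^~ w))%:R * g (walk (xi ^~ w) K)) &
        forall a, exists2 y : 'I_n -> R, forall i, `|y i - walk a K i| <= e &
          `|Phi a| <= `|g (walk a K) - g y|].
Proof.
move=> e0; have [|Phi [mPhi PhiE PhiB]] := @reflection_seq e tests e0.
  rewrite /sorted_times -sorted_pairwise; last by move=> x y z; exact: leq_trans.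
  by apply: sort_sorted => x y; exact: leq_total.
exists Phi; split => //.
  by rewrite PhiE; congr (_ * _); apply: eq_Rintegral => w _;
    rewrite /bad bad_tests.
by move=> a; have [y ye [Phiy _]] := PhiB a; exists y.
Qed.

End reflection.

(** * The reflection principle for continuous paths *)

Section bounded_convergence.
Context d (T : measurableType d) (R : realType) (P : probability T R).

Lemma Rintegral_bounded_cvg (f_ : nat -> T -> R) (f : T -> R) (C : R) :
  (forall k, measurable_fun setT (f_ k)) -> measurable_fun setT f ->
  (forall k x, `|f_ k x| <= C) -> (forall x, f_ k x @[k --> \oo] --> f x) ->
  \int[P]_x f_ k x @[k --> \oo] --> \int[P]_x f x.
Proof.
move=> mf_ mf fC f_f.
have fCl x : `|f x| <= C.
  have /cvg_lim <- // : `|f_ k x| @[k --> \oo] --> `|f x| by apply: cvg_norm;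
    exact: f_f.
  apply: limr_le; last by apply: nearW => k; exact: fC.
  by apply/cvg_ex; eexists; apply: cvg_norm; exact: f_f.
apply: fine_cvg.
rewrite fineK; last by apply: integrable_fin_num => //;
  exact: (@integrable_bounded _ _ _ P _ C).
apply: (@dominated_cvg _ _ _ P _ _ (fun k x => (f_ k x)%:E) (fun x => (f x)%:E)
  (fun=> C%:E)) => //.
- by move=> k; exact/measurable_EFinP.
- by move=> x _; apply: cvg_EFin; [exact: nearW|exact: f_f].
- apply: (@integrable_bounded _ _ _ P (fun=> C) `|C|); first exact: measurable_cst.
  by [].
- by move=> k x _; rewrite lee_fin.
Qed.

End bounded_convergence.

(** * Detecting collisions of continuous paths on a grid *)

Section no_collision.
Context d (T : measurableType d) (R : realType) (n : nat)
  (Z : 'I_n -> R -> T -> R).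
Hypothesis mZ : forall i s, 0 <= s -> measurable_fun setT (Z i s).
Hypothesis cZ : forall i w, {within `[0, +oo[, continuous ((Z i)^~ w)}.
Variable (t : R).
Hypothesis t0 : 0 < t.

Definition no_collision (w : T) : Prop :=
  forall s, 0 <= s <= t -> forall i j, i != j -> Z i s w != Z j s w.

Definition grid (K l : nat) : R := t * (l%:R / K%:R).

Lemma grid_itv K l : (l <= K)%N -> 0 <= grid K l <= t.
Proof.
move=> lK; rewrite /grid mulr_ge0 ?divr_ge0 ?(ltW t0)//=.
rewrite -[leRHS]mulr1 ler_pM2l//.
(* For [K = 0] the inverse is 0 by convention and the grid is the single point 0. *)
have [->|K0] := posnP K; first by rewrite invr0 mulr0.
by rewrite ler_pdivrMr ?ltr0n// mul1r ler_nat.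
Qed.

Definition separated (e : R) (K : nat) (w : T) : bool :=
  [forall l : 'I_K.+1, [forall i : 'I_n, [forall j : 'I_n,
    (i != j) ==> (e < `|Z i (grid K l) w - Z j (grid K l) w|)]]].

Lemma path_near (i j : 'I_n) w s0 e : 0 <= s0 -> 0 < e ->
  exists2 del, 0 < del & forall s, 0 <= s -> `|s - s0| < del ->
    `|(Z i s w - Z j s w) - (Z i s0 w - Z j s0 w)| < e.
Proof.
move=> s00 e0.
have h k : (Z k)^~ w s @[s --> within `[0, +oo[ (nbhs s0)] --> Z k s0 w.
  by have /subspace_continuousP := @cZ k w; apply; rewrite /= in_itv/= s00.
have : Z i s w - Z j s w @[s --> within `[0,
  +oo[ (nbhs s0)] --> Z i s0 w - Z j s0 w.
  by apply: cvgB; exact: h.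
move=> /cvgrPdist_lt/(_ e e0); rewrite near_withinE => -[del /= del0 H].
exists del => // s s_ge0 sdel; rewrite distrC; apply: H.
  by rewrite /ball/= distrC.
by rewrite in_itv/= s_ge0.
Qed.

(** On the compact interval each of the finitely many distances attains a positive minimum. *)
Lemma no_collision_separated w : no_collision w ->
  \forall l \near \oo, forall s, 0 <= s <= t -> forall i j, i != j ->
    l.+1%:R^-1 < `|Z i s w - Z j s w|.
Proof.
move=> nc.
suff : \forall l \near \oo, forall p : 'I_n * 'I_n, forall s, 0 <= s <= t ->
    p.1 != p.2 -> l.+1%:R^-1 < `|Z p.1 s w - Z p.2 s w|.
  by apply: filterS => l H s st i j ij; exact: (H (i, j)).
apply: filter_forall => -[i j] /=.
have [ij|ij] := boolP (i == j); first by near=> l.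
have cont : {within `[0, t], continuous (fun s => `|Z i s w - Z j s w|)}.
  have sub : `[0, t]%classic `<=` `[0, +oo[%classic by apply: subset_itvl.
  have ci := continuous_subspaceW sub (@cZ i w).
  have cj := continuous_subspaceW sub (@cZ j w).
  by move=> s; apply: cvg_norm; apply: cvgB; [exact: ci|exact: cj].
have [c cin cmin] := EVT_min (ltW t0) cont.
have c0 : 0 < `|Z i c w - Z j c w|.
  by rewrite normr_gt0 subr_eq0; apply: nc; move: cin; rewrite ?in_itv.
have H := near_infty_natSinv_lt (PosNum c0).
near=> l => s st _; apply: (lt_le_trans (y := `|Z i c w - Z j c w|)).
  by near: l.
by apply: cmin; rewrite in_itv.
Unshelve. all: by end_near. Qed.

Lemma collision_not_separated w e : 0 < e -> ~ no_collision w ->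
  \forall K \near \oo, ~~ separated e K w.
Proof.
move=> e0 /existsNP[s0 /not_implyP[/andP[s00 s0t]]].
move=> /existsNP[i /existsNP[j /not_implyP[ij /negP/negPn/eqP coll]]].
have [del del0 H] := path_near i j w s00 e0.
near=> K.
have K0 : (0 < K)%N by near: K; exact: nbhs_infty_gt.
have Kr0 : 0 < K%:R :> R by rewrite ltr0n.
have tK : t / K%:R < del.
  rewrite ltr_pdivrMr// mulrC -ltr_pdivrMr//.
  by near: K; exact: nbhs_infty_gtr.
(* The collision time in units of the mesh; its integer part is the last grid index before the
   collision, at distance at most [t / K]. *)
pose x := s0 * K%:R / t.
have x0 : 0 <= x by rewrite divr_ge0 ?mulr_ge0// ltW.
pose m := Num.truncn x.
have /andP[mx xm] : m%:R <= x < m.+1%:R by rewrite truncn_itv.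
have mK : (m < K.+1)%N.
  rewrite ltnS -(ler_nat R) (le_trans mx)// /x ler_pdivrMr// mulrC.
  by rewrite ler_pM2l.
have Kn0 : K%:R != 0 :> R by rewrite gt_eqF.
have tn0 : t != 0 by rewrite gt_eqF.
have s0E : s0 = t * (x / K%:R) by rewrite /x; field; rewrite Kn0 tn0.
have gle : grid K m <= s0.
  by rewrite [leRHS]s0E /grid ler_pM2l// ler_pM2r ?invr_gt0.
have gdist : s0 - grid K m < del.
  apply: le_lt_trans tK; rewrite {1}s0E /grid -mulrBr -mulrBl ler_pM2l//.
  rewrite -[leRHS]mul1r ler_pM2r ?invr_gt0// lerBlDl.
  by move: xm; rewrite -natr1 => /ltW.
have g0 : 0 <= grid K m by rewrite /grid mulr_ge0 ?(ltW t0)// divr_ge0.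
apply/negP => /forallP/(_ (Ordinal mK))/forallP/(_ i)/forallP/(_ j).
rewrite ij/= => sep; have := H _ g0.
rewrite coll subrr subr0 ler0_norm ?subr_le0// opprB => /(_ gdist).
by rewrite ltNge (ltW sep).
Unshelve. all: by end_near. Qed.

Lemma measurable_separated e K : measurable [set w | separated e K w].
Proof.
rewrite (_ : [set w | _] = \bigcap_(l : 'I_K.+1) \bigcap_(i : 'I_n) \bigcap_(j :
  'I_n)
    [set w | i != j -> e < `|Z i (grid K l) w - Z j (grid K l) w|]).
  apply: fin_bigcap_measurable => // l _; apply: fin_bigcap_measurable => // i _.
  apply: fin_bigcap_measurable => // j _.
  have [ij|ij] := boolP (i == j).
    rewrite (_ : [set w | _] = setT)//.
    by apply/seteqP; split => // w _ /=; rewrite ij.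
  rewrite (_ : [set w | _] =
      (fun w => `|Z i (grid K l) w - Z j (grid K l) w|) @^-1` `]e, +oo[).
    rewrite -[X in measurable X]setTI.
    have /andP[g0 _] : 0 <= grid K l <= t by apply: grid_itv; rewrite -ltnS.
    suff : measurable_fun setT (fun w => `|Z i (grid K l) w - Z j (grid K l) w|).
      by apply => //; exact: measurable_itv.
    by apply: measurableT_comp => //; apply: measurable_funB; exact: mZ.
  apply/seteqP; split => w /=; rewrite in_itv/= andbT; first exact.
  by [].
apply/seteqP; split => [w /= H l _ i _ j _ /= ij|w /= H].
  by move: H => /forallP/(_ l)/forallP/(_ i)/forallP/(_ j); rewrite ij.
apply/forallP => l; apply/forallP => i; apply/forallP => j; apply/implyP => ij.
exact: (H l _ i _ j _ ij).
Qed.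

(** By continuity, the absence of collision means that some tolerance [1 / (l + 1)] is respected on
    every grid, which is a countable description. *)
Lemma measurable_no_collision : measurable [set w | no_collision w].
Proof.
rewrite (_ : [set w | _] =
    \bigcup_l \bigcap_K [set w | separated l.+1%:R^-1 K w]).
  apply: bigcupT_measurable => l; apply: bigcapT_measurable => K.
  exact: measurable_separated.
apply/seteqP; split => w /=.
  move=> /no_collision_separated[l _ H]; exists l => // K _ /=.
  apply/forallP => m; apply/forallP => i; apply/forallP => j; apply/implyP => ij.
  apply: (H l) => //=; apply: grid_itv; by rewrite -ltnS.
move=> [l _ H]; apply: contrapT => /(collision_not_separated (e := l.+1%:R^-1)).
have l0 : 0 < l.+1%:R^-1 :> R by rewrite invr_gt0.
move=> /(_ l0)[K _ /(_ K (leqnn K))] /=.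
by rewrite (H K Logic.I).
Qed.

End no_collision.

Section reflection_principle.
Context (R : realType) (n : nat) (eta : 'I_n -> R) d (T : measurableType d)
  (P : probability T R) (Y : 'I_n -> R -> T -> R) (t : R).
Hypothesis t0 : 0 < t.
Hypothesis mY : forall i s, 0 <= s -> measurable_fun setT (Y i s).
Hypothesis cY : forall i w, {within `[0, +oo[, continuous ((Y i)^~ w)}.
Hypothesis Y0 : forall i w, Y i 0 w = eta i.

Let incr K (u : 'I_n * 'I_K) : T -> R :=
  Y u.1 (grid t K u.2.+1) \- Y u.1 (grid t K u.2).

Hypothesis iY : forall K, independent P (@incr K).
Hypothesis incrE : forall K i j (l : 'I_K) (A : set R), measurable A ->
  P (incr (i, l) @^-1` A) = P (incr (j, l) @^-1` A).

Variables (g : rvect R 'I_n -> R) (C : R).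
Hypotheses (mg : measurable_fun setT g) (gC : forall x, `|g x| <= C).
Hypothesis gN : forall i j x, i != j -> g (fun k => x (tperm i j k)) = - g x.
Hypothesis cg : forall (x : 'I_n -> R) e, 0 < e -> exists2 del, 0 < del &
  forall y : 'I_n -> R, (forall i, `|y i - x i| <= del) -> `|g x - g y| <= e.

Let walk_grid K m i w : (m <= K)%N ->
  walk eta (fun u => @incr K u w) m i = Y i (grid t K m) w.
Proof.
move=> mK; rewrite /walk.
rewrite -(big_ord_widen K (fun l => Y i (grid t K l.+1) w - Y i (grid t K l) w) mK).
rewrite -(big_mkord xpredT (fun l => Y i (grid t K l.+1) w - Y i (grid t K l) w)).
by rewrite telescope_sumr// {2}/grid mul0r mulr0 Y0 addrC subrK.
Qed.

Let wgood_separated K e w :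
  wgood eta e (fun u => @incr K u w) = separated Y t e K w.
Proof.
apply: eq_forallb => l; apply: eq_forallb => i; apply: eq_forallb => j.
by rewrite !walk_grid// -ltnS.
Qed.

Let sep l K w : R := (separated Y t l.+1%:R^-1 K w)%:R.

Let msep l K : measurable_fun setT (sep l K).
Proof.
rewrite (_ : sep l K = \1_[set w | separated Y t l.+1%:R^-1 K w]).
  by apply: measurable_indic; exact: measurable_separated.
by apply/funext => w; rewrite indicE mem_setE.
Qed.

Let nc w : R := \1_[set w | no_collision Y t w] w.

Let mnc : measurable_fun setT nc.
Proof. by apply: measurable_indic; exact: measurable_no_collision. Qed.

Let nc1 w : no_collision Y t w -> nc w = 1.
Proof. by move=> h; rewrite /nc indicE mem_set. Qed.

Let nc0 w : ~ no_collision Y t w -> nc w = 0.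
Proof. by move=> h; rewrite /nc indicE memNset. Qed.

Let sep_near1 w : no_collision Y t w -> forall K_ : nat -> nat,
  \forall l \near \oo, sep l (K_ l) w = 1.
Proof.
move=> /(no_collision_separated cY t0) H K_; apply: filterS H => l H.
rewrite /sep (_ : separated _ _ _ _ _ = true)//.
apply/forallP => m; apply/forallP => i; apply/forallP => j; apply/implyP => ij.
by apply: H => //; apply: grid_itv => //; rewrite -ltnS.
Qed.

Let gt w : R := g (fun i => Y i t w).

Let mgt : measurable_fun setT gt.
Proof.
apply: (measurableT_comp mg); apply: measurable_rvect => i.
by apply: mY; exact: ltW.
Qed.

Let norm_01 (b x : R) : 0 <= b <= 1 -> `|x| <= C -> `|b * x| <= C.
Proof.
move=> /andP[b0 b1] xC; rewrite normrM (ger0_norm b0).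
by apply: le_trans xC; rewrite ler_piMl.
Qed.

Let sep01 l K w : 0 <= sep l K w <= 1.
Proof. by rewrite /sep; case: separated; rewrite ?lexx ?ler01. Qed.

Let nc01 w : 0 <= nc w <= 1.
Proof. by rewrite /nc indicE; case: (_ \in _); rewrite ?lexx ?ler01. Qed.

Let compl01 (b : R) : 0 <= b <= 1 -> 0 <= 1 - b <= 1.
Proof. by move=> /andP[b0 b1]; rewrite subr_ge0 b1 lerBlDr lerDl b0. Qed.

Let mul01 (b c : R) : 0 <= b <= 1 -> 0 <= c <= 1 -> 0 <= b * c <= 1.
Proof. by move=> /andP[b0 b1] /andP[c0 c1]; rewrite mulr_ge0//= mulr_ile1. Qed.

Let C0 : 0 <= C.
Proof. by apply: le_trans (gC eta). Qed.

(** For a fixed tolerance, every path with a collision is eventually detected as the mesh shrinks;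
    bounded convergence then provides [K]. *)
Let fine_grid l : exists K, (0 < K)%N /\
  \int[P]_w ((1 - nc w) * sep l K w) <= l.+1%:R^-1.
Proof.
have : \int[P]_w ((1 - nc w) * sep l K w) @[K --> \oo] --> \int[P]_w (cst 0 w : R).
  apply: (@Rintegral_bounded_cvg _ _ _ P _ _ 1).
  - move=> K; apply: measurable_funM => //; exact: measurable_funB.
  - exact: measurable_cst.
  - move=> K w; have /andP[h0 h1] := mul01 (compl01 (nc01 w)) (sep01 l K w).
    by rewrite ger0_norm.
  - move=> w /=; have [h|h] := pselect (no_collision Y t w).
      by rewrite nc1// subrr; under eq_fun do rewrite mul0r; exact: cvg_cst.
    apply: cvg_near_cst.
    have l0 : 0 < l.+1%:R^-1 :> R by rewrite invr_gt0.
    apply: filterS (collision_not_separated cY t0 l0 h) => K.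
    by rewrite /sep => /negbTE ->; rewrite mulr0.
rewrite Rintegral_cst// mul0r => /cvgrPdist_le/(_ l.+1%:R^-1).
have l0 : 0 < l.+1%:R^-1 :> R by rewrite invr_gt0.
move=> /(_ l0)[K _ H]; exists K.+1; split => //.
have := H K.+1 (leqnSn K); rewrite sub0r normrN /=; apply: le_trans.
exact: ler_norm.
Qed.

Let reflected l K : (0 < K)%N -> exists Psi : T -> R,
  [/\ measurable_fun setT Psi,
      \int[P]_w Psi w = 2 * \int[P]_w ((1 - sep l K w) * gt w) &
      forall w, exists2 y : 'I_n -> R, forall i, `|y i - Y i t w| <= l.+1%:R^-1 &
        `|Psi w| <= `|gt w - g y|].
Proof.
move=> K0; have gridK : grid t K K = t.
  by rewrite /grid divff ?mulr1// pnatr_eq0 -lt0n.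
have [|Phi [mPhi PhiE PhiB]] :=
  reflection eta (iY K) (@incrE K) mg gC gN (e := l.+1%:R^-1).
  by rewrite invr_ge0.
exists (fun w => Phi (fun u => @incr K u w)); split.
- exact: (measurableT_comp mPhi (measurable_rvect (iY K).1)).
- rewrite PhiE; congr (_ * _); apply: eq_Rintegral => w _.
  rewrite wgood_separated /sep /gt; congr (_ * g _).
    by case: separated; rewrite ?subrr ?subr0.
  by apply/funext => i; rewrite walk_grid// gridK.
- move=> w; have [y ye Phiy] := PhiB (fun u => @incr K u w); exists y.
    by move=> i; have := ye i; rewrite walk_grid// gridK.
  have -> : gt w = g (walk eta (fun u => @incr K u w) K).
    by congr g; apply/funext => i; rewrite walk_grid// gridK.
  by [].
Qed.

(* Reflecting at the first grid time at which two coordinates are [e]-close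
   changes the endpoint by at most [e], whence a vanishing contribution of the
   paths with a collision as [e] tends to [0]. *)
Lemma reflection_principle :
  \int[P]_w (\1_[set w | no_collision Y t w] w * g (fun i => Y i t w)) =
  \int[P]_w g (fun i => Y i t w).
Proof.
have /choice[K_ K_P] := fine_grid.
have /choice[Psi PsiP] : forall l, exists Psi : T -> R,
  [/\ measurable_fun setT Psi,
      \int[P]_w Psi w = 2 * \int[P]_w ((1 - sep l (K_ l) w) * gt w) &
      forall w, exists2 y : 'I_n -> R, forall i, `|y i - Y i t w| <= l.+1%:R^-1 &
        `|Psi w| <= `|gt w - g y|].
  by move=> l; apply: reflected; exact: (K_P l).1.
have int (b : T -> R) : measurable_fun setT b -> (forall w, 0 <= b w <= 1) ->
    P.-integrable setT (EFin \o (fun w => b w * gt w)).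
  move=> mb b01; apply: (@integrable_bounded _ _ _ P _ C).
    exact: measurable_funM.
  by move=> w; apply: norm_01 => //; exact: gC.
have mcn : measurable_fun setT (fun w => 1 - nc w) by exact: measurable_funB.
have mcs l : measurable_fun setT (fun w => 1 - sep l (K_ l) w) by
  exact: measurable_funB.
(* [S1] collects undetected collisions, [S2] is twice the contribution of all flagged paths, and
   [S3] corrects for flagged paths without collision: [1 - nc = (1 - nc) sep + (1 - sep) - nc (1 -
   sep)]. *)
pose S1 l := \int[P]_w ((1 - nc w) * sep l (K_ l) w * gt w).
pose S2 l := \int[P]_w Psi l w.
pose S3 l := \int[P]_w (nc w * (1 - sep l (K_ l) w) * gt w).
pose D := \int[P]_w ((1 - nc w) * gt w).
have DE l : D = S1 l + 2^-1 * S2 l - S3 l.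
  rewrite /S2 /D; have [_ -> _] := PsiP l; rewrite mulKf ?pnatr_eq0//.
  rewrite -RintegralD//; last 2 first.
  - by apply: int => [|w]; [exact: measurable_funM|
    exact: (mul01 (compl01 (nc01 w)) (sep01 l (K_ l) w))].
  - by apply: int => // w; exact: compl01.
  rewrite -RintegralB//; last 2 first.
  - rewrite (_ : _ \o _ = EFin \o (fun w => ((1 - nc w) * sep l (K_ l) w +
        (1 - sep l (K_ l) w)) * gt w)); last first.
      by apply/funext => w; rewrite /= [in RHS]mulrDl.
    apply: int => [|w]; first by apply: measurable_funD => //;
      exact: measurable_funM.
    rewrite /sep; case: separated;
      rewrite ?mulr1 ?mulr0 ?subrr ?subr0 ?addr0 ?add0r//.
      exact: compl01.
    by rewrite lexx ler01.
  - by apply: int => [|w]; [exact: measurable_funM|apply: mul01 => //;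
    exact: compl01].
  by apply: eq_Rintegral => w _; ring.
have invl0 : l.+1%:R^-1 @[l --> \oo] --> (0 : R).
  exact: cvg_harmonic.
have S1_0 : S1 l @[l --> \oo] --> (0 : R).
  apply/norm_cvg0P; apply: (@squeeze_cvgr _ _ _ _ (cst 0) (fun l => C *
    l.+1%:R^-1)).
  - apply: nearW => l; rewrite normr_ge0/=.
    apply: le_trans (le_normr_Rintegral _ _) _ => //.
      by apply: int => [|w]; [exact: measurable_funM|
        exact: (mul01 (compl01 (nc01 w)) (sep01 l (K_ l) w))].
    apply: (@le_trans _ _ (\int[P]_w (C * ((1 - nc w) * sep l (K_ l) w)))).
      apply: le_Rintegral => //.
      + apply: (@integrable_bounded _ _ _ P _ C).
          by apply: measurableT_comp => //; do 2 apply: measurable_funM => //.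
        move=> w; rewrite normr_id; apply: norm_01; last exact: gC.
        exact: (mul01 (compl01 (nc01 w)) (sep01 l (K_ l) w)).
      + apply: (@integrable_bounded _ _ _ P _ C).
          by do 2 apply: measurable_funM => //.
        move=> w; rewrite mulrC; apply: norm_01; last by rewrite ger0_norm.
        exact: (mul01 (compl01 (nc01 w)) (sep01 l (K_ l) w)).
      + move=> w _; have /andP[b0 b1] := mul01 (compl01 (nc01 w)) (sep01 l (K_
        l) w).
        by rewrite normrM ger0_norm// mulrC ler_wpM2r//; exact: gC.
    rewrite RintegralZl//; last first.
      apply: (@integrable_bounded _ _ _ P _ 1); first exact: measurable_funM.
      move=> w; have /andP[b0 b1] := mul01 (compl01 (nc01 w)) (sep01 l (K_ l) w).
      by rewrite ger0_norm.
    by rewrite ler_wpM2l//; exact: (K_P l).2.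
  - exact: cvg_cst.
  - by rewrite -[X in _ --> X](mulr0 C); apply: cvgM => //; exact: cvg_cst.
have S2_0 : S2 l @[l --> \oo] --> (0 : R).
  have -> : (0 : R) = \int[P]_w (cst 0 w : R) by rewrite Rintegral_cst// mul0r.
  apply: (@Rintegral_bounded_cvg _ _ _ P _ _ (C + C)).
  - by move=> l; have [] := PsiP l.
  - exact: measurable_cst.
  - move=> l w; have [_ _ /(_ w)[y _ h]] := PsiP l; apply: (le_trans h).
    by rewrite (le_trans (ler_normB _ _))// lerD//; exact: gC.
  - move=> w; apply/cvgrPdist_le => /= e e0.
    have [del del0 H] := cg (fun i => Y i t w) e0.
    have Hn := near_infty_natSinv_lt (PosNum del0).
    near=> l; rewrite sub0r normrN.
    have [_ _ /(_ w)[y ye h]] := PsiP l; apply: (le_trans h); apply: H => i.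
    apply: (le_trans (ye i)); apply: ltW; by near: l.
have S3_0 : S3 l @[l --> \oo] --> (0 : R).
  have -> : (0 : R) = \int[P]_w (cst 0 w : R) by rewrite Rintegral_cst// mul0r.
  apply: (@Rintegral_bounded_cvg _ _ _ P _ _ C).
  - by move=> l; do 2 apply: measurable_funM => //.
  - exact: measurable_cst.
  - by move=> l w; apply: norm_01; [apply: mul01 => //; exact: compl01|exact: gC].
  - move=> w; have [h|h] := pselect (no_collision Y t w).
      apply: cvg_near_cst; apply: filterS (sep_near1 h K_) => l ->.
      by rewrite subrr mulr0 mul0r.
    by rewrite nc0//; under eq_fun do rewrite !mul0r; exact: cvg_cst.
have D0 : D = 0.
  have h : D @[l --> \oo] --> (0 + 2^-1 * 0 - 0 : R).
    rewrite (_ : (fun _ : nat => D) = (fun l => S1 l + 2^-1 * S2 l - S3 l));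
      last first.
      by apply/funext => l; exact: DE.
    by apply: cvgB => //; apply: cvgD => //; apply: cvgM => //; exact: cvg_cst.
  have := cvg_lim (@Rhausdorff R) h; rewrite lim_cst// mulr0 addr0 subr0.
  by apply.
apply/eqP; rewrite eq_sym -subr_eq0 -RintegralB//; last 2 first.
- by apply: (@integrable_bounded _ _ _ P _ C) => // w; exact: gC.
- by apply: int.
by rewrite -[X in _ == X]D0; apply/eqP; apply: eq_Rintegral => w _;
  rewrite mulrBl mul1r.
Unshelve. all: by end_near. Qed.

End reflection_principle.

(** * Brownian motion before the first collision *)

Section brownian_increments.
Context (R : realType) (n : nat) (eta : 'I_n -> R) d (Omega : measurableType d)
  (P : probability Omega R) (X : 'I_n -> R -> Omega -> R).
Hypothesis hX : brownian_motion_dim P eta X.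

Let bmX i : brownian_motion P (eta i) (X i) := hX.1 i.

Lemma process_sigma_increment i s s' (A : set R) : 0 <= s -> 0 <= s' ->
  measurable A -> process_sigma (X i) ((X i s' \- X i s) @^-1` A).
Proof.
move=> s0 s0' mA.
pose G := [set E | exists u (B : set R),
  [/\ 0 <= u, measurable B & E = X i u @^-1` B]].
have mXG u : 0 <= u ->
    @measurable_fun _ _ (g_sigma_algebraType G) R setT (X i u).
  move=> u0 _ B mB; rewrite setTI; apply: sub_sigma_algebra.
  by exists u, B.
have : @measurable_fun _ _ (g_sigma_algebraType G) R setT (X i s' \- X i s).
  by apply: measurable_funB; exact: mXG.
by move=> /(_ measurableT A mA); rewrite setTI.
Qed.

Lemma measurable_increment i s s' : 0 <= s -> 0 <= s' ->
  measurable_fun setT (X i s' \- X i s).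
Proof. by move=> s0 s0'; apply: measurable_funB;
  exact: (bm_measurable (bmX i)). Qed.

Lemma independent_increment s s' : 0 <= s -> 0 <= s' ->
  independent P (fun i => X i s' \- X i s).
Proof.
move=> s0 s0'; split => [i|A mA]; first exact: measurable_increment.
by apply: hX.2 => i; exact: process_sigma_increment.
Qed.

(** For each coordinate, the joint event on its increments lies in the sigma-algebra of that
    process; independence between processes and then within each one applies. *)
Lemma independent_grid_increments (u : nat -> R) K : 0 <= u 0%N ->
  (forall l, u l <= u l.+1) ->
  independent P (fun p : 'I_n * 'I_K => X p.1 (u p.2.+1) \- X p.1 (u p.2)).
Proof.
move=> u0 uS.
have u_ge0 l : 0 <= u l by elim: l => // l IH; exact: le_trans IH (uS l).
split => [p|A mA]; first exact: measurable_increment.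
pose E i := \bigcap_(l : 'I_K) ((X i (u l.+1) \- X i (u l)) @^-1` A (i, l)).
rewrite (_ : \bigcap_i _ = \bigcap_i E i); last first.
  apply/seteqP; split => w H; first by move=> i _ l _; exact: (H (i, l)).
  by move=> [i l] _; exact: (H i Logic.I l Logic.I).
rewrite hX.2; last first.
  move=> i; apply: (@fin_bigcap_measurable _
    (g_sigma_algebraType [set E | exists u (B : set R),
      [/\ 0 <= u, measurable B & E = X i u @^-1` B]])) => // l _.
  exact: process_sigma_increment.
rewrite [RHS](eq_bigr (fun p : 'I_n * 'I_K =>
  P ((X p.1 (u p.2.+1) \- X p.1 (u p.2))%R @^-1` A (p.1, p.2)))); last by case.
rewrite -(pair_bigA _ (fun (i : 'I_n) (l : 'I_K) =>
  P ((X i (u l.+1) \- X i (u l))%R @^-1` A (i, l))))/=.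
apply: eq_bigr => i _.
exact: (@bm_increments _ _ _ _ _ _ (bmX i) K u u0 uS (fun l => A (i, l)) (fun l
  => mA (i, l))).
Qed.

Lemma standard_normals_increment : standard_normals P (fun i => X i 1 \- X i 0).
Proof.
split; first exact: independent_increment.
by move=> i A mA; rewrite (bm_gaussian (bmX i))// subr0 sqrtr1.
Qed.

(* Almost surely equal to [X i], but started at [eta i] on every path. *)
Definition pinned i s w : R := eta i + (X i s w - X i 0 w).

Lemma measurable_pinned i s : 0 <= s -> measurable_fun setT (pinned i s).
Proof.
by move=> s0; apply: measurable_funD => //; exact: measurable_increment.
Qed.

Lemma continuous_pinned i w : {within `[0, +oo[, continuous ((pinned i)^~ w)}.
Proof.
have cX := @bm_continuous _ _ _ _ _ _ (bmX i) w.
move=> s; apply: cvgD; first exact: cvg_cst.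
by apply: cvgB; [exact: cX|exact: cvg_cst].
Qed.

Lemma pinned0 i w : pinned i 0 w = eta i.
Proof. by rewrite /pinned subrr addr0. Qed.

Lemma pinnedB i s s' : pinned i s' \- pinned i s = X i s' \- X i s.
Proof. by apply/funext => w; rewrite /pinned /=; ring. Qed.

Variable t : R.
Hypothesis t0 : 0 < t.

Lemma pinned_incr_independent K : independent P (fun p : 'I_n * 'I_K =>
  pinned p.1 (grid t K p.2.+1) \- pinned p.1 (grid t K p.2)).
Proof.
under eq_fun do rewrite pinnedB.
apply: (independent_grid_increments (u := grid t K)).
  by rewrite /grid mul0r mulr0.
by move=> l; rewrite /grid ler_pM2l// ler_wpM2r ?invr_ge0// ler_nat.
Qed.

Lemma pinned_incr_law K i j (l : 'I_K) (A : set R) : measurable A ->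
  P ((pinned i (grid t K l.+1) \- pinned i (grid t K l)) @^-1` A) =
  P ((pinned j (grid t K l.+1) \- pinned j (grid t K l)) @^-1` A).
Proof.
move=> mA; rewrite !pinnedB.
have g0 : 0 <= grid t K l by rewrite /grid mulr_ge0 ?divr_ge0// ltW.
(* Strict, as required by [bm_gaussian]; [K] is positive because [l] inhabits ['I_K]. *)
have gS : grid t K l < grid t K l.+1.
  rewrite /grid ltr_pM2l// ltr_pM2r ?ltr_nat// invr_gt0 ltr0n.
  exact: leq_ltn_trans (ltn_ord l).
by rewrite (bm_gaussian (bmX i))// (bm_gaussian (bmX j)).
Qed.

Lemma independent_pinned_scaled :
  independent P (fun i w => pinned i t w / Num.sqrt t).
Proof.
have aff i (A : set R) : (fun w => pinned i t w / Num.sqrt t) @^-1` A =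
    (X i t \- X i 0) @^-1` ((fun x => (eta i + x) / Num.sqrt t) @^-1` A) by [].
have maff i : measurable_fun setT (fun x : R => (eta i + x) / Num.sqrt t).
  by apply: measurable_funM => //; exact: measurable_funD.
have maffA i (A : set R) : measurable A ->
    measurable ((fun x => (eta i + x) / Num.sqrt t) @^-1` A).
  by move=> mA; rewrite -[X in measurable X]setTI; exact: maff.
split => [i|A mA].
  by apply: measurable_funM => //; apply: measurable_pinned; exact: ltW.
under eq_bigcapr do rewrite aff.
under eq_bigr do rewrite aff.
by apply: (independent_increment _ _).2 => // [|i]; [exact: ltW|exact: maffA].
Qed.

Lemma law_pinned_scaled i (A : set R) : measurable A ->
  P ((fun w => pinned i t w / Num.sqrt t) @^-1` A) =
  normal_prob (eta i / Num.sqrt t) 1 A.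
Proof.
move=> mA; have st0 : 0 < Num.sqrt t by rewrite sqrtr_gt0.
rewrite (_ : _ @^-1` A = (X i t \- X i 0) @^-1`
    ((fun x => (Num.sqrt t)^-1 * x + eta i / Num.sqrt t) @^-1` A)); last first.
  by apply/seteqP; split => w /=; rewrite /pinned mulrDl addrC (mulrC (_ - _)).
rewrite (bm_gaussian (bmX i))//; last first.
  rewrite -[X in measurable X]setTI.
  suff : measurable_fun setT (fun x : R => (Num.sqrt t)^-1 * x + eta i /
    Num.sqrt t).
    by apply.
  by apply: measurable_funD => //; exact: measurable_funM.
by rewrite subr0 normal_prob_affine ?gt_eqF ?invr_gt0// mulr0 add0r mulVf ?gt_eqF.
Qed.

End brownian_increments.

Section signed_expectation.
Context (R : realType) (n : nat).

(** Truncation to the interval from -1 to 1, in a form where oddness and continuity are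
    immediate. *)
Definition clip (y : R) : R := (`|y + 1| - `|y - 1|) / 2.

Lemma clip_bound y : `|clip y| <= 1.
Proof.
rewrite /clip normrM [X in _ * X]ger0_norm ?invr_ge0// ler_pdivrMr// mul1r.
apply: le_trans (ler_dist_dist _ _) _.
by rewrite (_ : y + 1 - (y - 1) = 2) ?ger0_norm//; ring.
Qed.

Lemma clipN y : clip (- y) = - clip y.
Proof.
rewrite /clip -(normrN (- y + 1)) -(normrN (- y - 1)) !opprD !opprK.
by rewrite -mulNr opprB.
Qed.

Lemma continuous_clip : continuous clip.
Proof.
move=> y; apply: cvgM; last exact: cvg_cst.
by apply: cvgB; apply: cvg_norm; [apply: cvgD|apply: cvgB] => //; exact: cvg_cst.
Qed.

Lemma clip_ge1 y : 1 <= y -> clip y = 1.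
Proof.
move=> y1; rewrite /clip !ger0_norm ?subr_ge0// ?addr_ge0 ?(le_trans _ y1)//.
by field.
Qed.

Lemma clip_cvg y : clip (k%:R * y) @[k --> \oo] --> Num.sg y.
Proof.
apply: cvg_near_cst.
have [->|y0] := eqVneq y 0.
  by near=> k; rewrite mulr0 sgr0 /clip add0r sub0r normrN subrr mul0r.
near=> k.
have ky : 1 <= k%:R * `|y|.
  rewrite -ler_pdivrMr ?normr_gt0//; near: k; exact: nbhs_infty_ger.
have [ygt0|ylt0] := ltP 0 y.
  by rewrite gtr0_sg// clip_ge1//; rewrite gtr0_norm in ky.
have {}ylt0 : y < 0 by rewrite lt_neqAle y0.
rewrite ltr0_sg// (_ : k%:R * y = - (k%:R * `|y|)); last first.
  by rewrite ltr0_norm// mulrN opprK.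
by rewrite clipN clip_ge1.
Unshelve. all: by end_near. Qed.

(* The reflection principle needs a continuous antisymmetric function; these
   converge to [f |x| sg (vdm x)] as [k] grows. *)
Definition radial_sign (f : R -> R) (k : nat) (x : rvect R 'I_n) : R :=
  f (enorm x) * clip (k%:R * vdm x).

(** Stated on row vectors, whose sup-norm balls are the coordinatewise bounds that the reflection
    principle asks for. *)
Lemma continuous_radial_sign f k : continuous f ->
  continuous (fun v : 'rV[R]_n => radial_sign f k (fun i => v ord0 i)).
Proof.
move=> cf v; have cv i : continuous (fun v : 'rV[R]_n => v ord0 i) by
  exact: coord_continuous.
have FF : Filter (nbhs v) by exact: nbhs_filter.
have big_cvg (op : R -> R -> R) (x0 : R) (r : seq 'I_n) (Q : pred 'I_n)
    (F : 'I_n -> 'rV[R]_n -> R) :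
    (forall F1 F2 : 'rV[R]_n -> R, F1 u @[u --> v] --> F1 v ->
      F2 u @[u --> v] --> F2 v -> op (F1 u) (F2 u) @[u --> v] --> op (F1 v) (F2
        v)) ->
    (forall i, F i u @[u --> v] --> F i v) ->
    \big[op/x0]_(i <- r | Q i) F i u @[u --> v] --> \big[op/x0]_(i <- r | Q i) F
      i v.
  move=> cop cF; elim: r => [|i r IH].
    rewrite big_nil (_ : (fun u : 'rV[R]_n => _) = fun=> x0);
      first exact: cst_continuous.
    by apply/funext => u; rewrite big_nil.
  rewrite big_cons (_ : (fun u : 'rV[R]_n => _) = fun u => if Q i then
      op (F i u) (\big[op/x0]_(i <- r | Q i) F i u) else \big[op/x0]_(i <- r | Q
        i) F i u).
    case: (Q i) => //.
    exact: (cop (F i) (fun u => \big[op/x0]_(i <- r | Q i) F i u) (cF i) IH).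
  by apply/funext => u; rewrite big_cons.
have cvgMR (F1 F2 : 'rV[R]_n -> R) : F1 u @[u --> v] --> F1 v ->
    F2 u @[u --> v] --> F2 v -> F1 u * F2 u @[u --> v] --> F1 v * F2 v.
  by move=> h1 h2; exact: cvgM.
have cvgDR (F1 F2 : 'rV[R]_n -> R) : F1 u @[u --> v] --> F1 v ->
    F2 u @[u --> v] --> F2 v -> F1 u + F2 u @[u --> v] --> F1 v + F2 v.
  by move=> h1 h2; exact: cvgD.
apply: (cvgMR (fun u => f (enorm (fun i => u ord0 i)))
  (fun u => clip (k%:R * vdm (fun i => u ord0 i)))).
  apply: (@continuous_comp _ _ _ (fun v : 'rV[R]_n => enorm (fun i => v ord0 i))
    f); last exact: cf.
  apply: (@continuous_comp _ _ _ (fun v : 'rV[R]_n => \sum_i v ord0 i ^+ 2)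
    Num.sqrt);
    last exact: sqrt_continuous.
  apply: (big_cvg) => // i.
  exact: (cvgMR (fun u => u ord0 i) (fun u => u ord0 i) (cv i v) (cv i v)).
apply: (@continuous_comp _ _ _ (fun v : 'rV[R]_n => k%:R * vdm (fun i => v ord0
  i)) clip);
  last exact: continuous_clip.
apply: (cvgMR (fun=> k%:R)); first exact: cst_continuous.
rewrite vdm_prod (_ : (fun u : 'rV[R]_n => vdm _) = fun u : 'rV[R]_n =>
  \prod_(i < n) \prod_(j < n | (i < j)%N) (u ord0 j - u ord0 i)); last first.
  by apply/funext => u; exact: vdm_prod.
apply: (big_cvg) => // i; apply: (big_cvg) => // j.
by apply: cvgB; exact: cv.
Qed.

Lemma radial_sign_near f k (x : 'I_n -> R) e : continuous f -> 0 < e ->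
  exists2 del, 0 < del & forall y : 'I_n -> R, (forall i, `|y i - x i| <= del) ->
    `|radial_sign f k x - radial_sign f k y| <= e.
Proof.
move=> cf e0.
have rowK (z : 'I_n -> R) : (fun i => (\row_i z i) ord0 i) = z.
  by apply/funext => i; rewrite mxE.
have := @continuous_radial_sign f k cf (\row_i x i).
move=> /cvgrPdist_le/(_ e e0)/nbhs_ballP[del /= del0 H].
exists (del / 2); first by rewrite divr_gt0.
move=> y xy; have := H (\row_i y i); rewrite !rowK; apply.
split => // i j; rewrite !mxE /ball/= distrC (le_lt_trans (xy j))//.
by rewrite ltr_pdivrMr// ltr_pMr// ltr1n.
Qed.

Lemma measurable_radial_sign f k : measurable_fun setT f ->
  measurable_fun setT (radial_sign f k).
Proof.
move=> mf; apply: measurable_funM.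
  by apply: (measurableT_comp mf); exact: measurable_enorm.
apply: measurableT_comp.
  exact: continuous_measurable_fun continuous_clip.
by apply: measurable_funM => //; exact: measurable_vdm.
Qed.

Lemma radial_sign_antisym f k i j x : i != j ->
  radial_sign f k (fun l => x (tperm i j l)) = - radial_sign f k x.
Proof.
move=> ij; rewrite /radial_sign enorm_perm vdm_perm odd_tperm ij expr1 mulN1r.
by rewrite mulrN clipN mulrN.
Qed.

End signed_expectation.

Section sign_persistence.
Context (R : realType) (n : nat) d (T : measurableType d) (Z : 'I_n -> R -> T -> R).
Hypothesis cZ : forall i w, {within `[0, +oo[, continuous ((Z i)^~ w)}.
Variable t : R.
Hypothesis t0 : 0 < t.

(** By the intermediate value theorem no factor [x j - x i] changes sign. *)
Lemma no_collision_sg_vdm w : no_collision Z t w ->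
  Num.sg (vdm (fun i => Z i t w)) = Num.sg (vdm (fun i => Z i 0 w)).
Proof.
move=> nc; rewrite !vdm_prod.
rewrite !(big_morph _ (@sgrM R) (@sgr1 R)); apply: eq_bigr => i _.
rewrite !(big_morph _ (@sgrM R) (@sgr1 R)); apply: eq_bigr => j ij.
pose f s := Z j s w - Z i s w.
have f0 s : 0 <= s <= t -> f s != 0.
  by move=> st; rewrite subr_eq0; apply: nc => //; rewrite neq_ltn ij orbT.
have cf : {within `[0, t], continuous f}.
  have sub : `[0, t]%classic `<=` `[0, +oo[%classic by apply: subset_itvl.
  have ci := continuous_subspaceW sub (@cZ i w).
  have cj := continuous_subspaceW sub (@cZ j w).
  by move=> s; apply: cvgB; [exact: cj|exact: ci].
rewrite -[LHS]/(Num.sg (f t)) -[RHS]/(Num.sg (f 0)).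
have ft : f t != 0 by apply: f0; rewrite lexx ltW.
have f00 : f 0 != 0 by apply: f0; rewrite lexx ltW.
apply: contrapT => sne.
have [] := @IVT _ f 0 t 0 (ltW t0) cf.
  have [ftp|ftn] := ltP 0 (f t); have [f0p|f0n] := ltP 0 (f 0).
  - by exfalso; apply: sne; rewrite !gtr0_sg.
  - by rewrite ge_min f0n/= le_max (ltW ftp) orbT.
  - by rewrite ge_min ftn orbT/= le_max (ltW f0p).
  - have ft' : f t < 0 by rewrite lt_neqAle ft.
    have f0' : f 0 < 0 by rewrite lt_neqAle f00.
    by exfalso; apply: sne; rewrite !ltr0_sg.
by move=> c; rewrite in_itv/= => /f0/eqP.
Qed.

End sign_persistence.

Section survival_expectation.
Context (R : realType) (n : nat) (eta : 'I_n -> R) d (Omega : measurableType d)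
  (P : probability Omega R) (X : 'I_n -> R -> Omega -> R).
Hypothesis hX : brownian_motion_dim P eta X.
Variables (t : R) (f : R -> R) (C : R).
Hypotheses (t0 : 0 < t) (cf : continuous f) (fC : forall x, `|f x| <= C).

Lemma survival_sg_vdm :
  Num.sg (vdm eta) * (\int[P]_w (\1_[set w | no_collision (pinned eta X) t w] w *
    f (enorm (fun i => pinned eta X i t w)))) =
  \int[P]_w (f (enorm (fun i => pinned eta X i t w)) *
             Num.sg (vdm (fun i => pinned eta X i t w))).
Proof.
pose Yt w : rvect R 'I_n := fun i => pinned eta X i t w.
pose nc w : R := \1_[set w | no_collision (pinned eta X) t w] w.
have cY := continuous_pinned hX.
have mY := measurable_pinned hX.
have mf : measurable_fun setT f by exact: continuous_measurable_fun.
have mYt : measurable_fun setT Yt.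
  by apply: measurable_rvect => i; apply: mY; exact: ltW.
have mnc : measurable_fun setT nc.
  by apply: measurable_indic; apply: measurable_no_collision.
have nc01 w : 0 <= nc w <= 1.
  by rewrite /nc indicE; case: (_ \in _); rewrite ?lexx ?ler01.
have gC k (x : rvect R 'I_n) : `|radial_sign f k x| <= C.
  by rewrite normrM -[C]mulr1 ler_pM// clip_bound.
have mg k : measurable_fun setT (fun w => radial_sign f k (Yt w)).
  by apply: (measurableT_comp (measurable_radial_sign k mf)).
have mfe : measurable_fun setT (fun w => f (enorm (Yt w))).
  apply: (measurableT_comp mf); exact: (measurableT_comp (@measurable_enorm R n)).
have msg : measurable_fun setT (fun w => Num.sg (vdm (Yt w))).
  apply: (measurableT_comp (@measurable_sg R)).
  exact: (measurableT_comp (@measurable_vdm R n)).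
have ref k : \int[P]_w (nc w * radial_sign f k (Yt w)) = \int[P]_w radial_sign f
  k (Yt w).
  apply: (@reflection_principle R n eta _ _ P (pinned eta X) t t0 mY cY
    (@pinned0 _ _ _ _ _ _) _ _ (radial_sign f k) C).
  - by move=> K; exact: pinned_incr_independent.
  - by move=> K i j l A; exact: pinned_incr_law.
  - exact: measurable_radial_sign.
  - exact: gC.
  - by move=> i j x; exact: radial_sign_antisym.
  - by move=> x e e0; exact: radial_sign_near.
have lim1 : \int[P]_w radial_sign f k (Yt w) @[k --> \oo] -->
    \int[P]_w (f (enorm (Yt w)) * Num.sg (vdm (Yt w))).
  apply: (@Rintegral_bounded_cvg _ _ _ P _ _ C) => //.
    exact: measurable_funM.
  by move=> w; apply: cvgM; [exact: cvg_cst|exact: clip_cvg].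
have lim2 : \int[P]_w (nc w * radial_sign f k (Yt w)) @[k --> \oo] -->
    \int[P]_w (nc w * (f (enorm (Yt w)) * Num.sg (vdm (Yt w)))).
  apply: (@Rintegral_bounded_cvg _ _ _ P _ _ C) => //.
  - by move=> k; exact: measurable_funM.
  - by do 2 apply: measurable_funM => //.
  - move=> k w; have /andP[b0 b1] := nc01 w; rewrite normrM ger0_norm//.
    by apply: le_trans (gC k (Yt w)); rewrite ler_piMl.
  - move=> w; apply: cvgM; first exact: cvg_cst.
    by apply: cvgM; [exact: cvg_cst|exact: clip_cvg].
have e : \int[P]_w (nc w * (f (enorm (Yt w)) * Num.sg (vdm (Yt w)))) =
    \int[P]_w (f (enorm (Yt w)) * Num.sg (vdm (Yt w))).
  rewrite -(cvg_lim (@Rhausdorff R) lim1) -(cvg_lim (@Rhausdorff R) lim2).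
  by congr (lim (_ @ \oo)); apply/funext => k; exact: ref.
rewrite -[RHS]e -RintegralZl//; last first.
  apply: (@integrable_bounded _ _ _ P _ C); first exact: measurable_funM.
  move=> w; have /andP[b0 b1] := nc01 w; rewrite normrM ger0_norm//.
  by apply: le_trans (fC (enorm (Yt w))); rewrite ler_piMl.
apply: eq_Rintegral => w _; rewrite /nc indicE.
have [h|h] := pselect (no_collision (pinned eta X) t w); last first.
  by rewrite memNset// !mul0r mulr0.
rewrite mem_set//= !mul1r mulrC; congr (_ * _).
rewrite (no_collision_sg_vdm cY t0 h); congr (Num.sg (vdm _)).
by apply/funext => i; rewrite pinned0.
Qed.

End survival_expectation.

(** * Small drift asymptotics *)

Lemma Rintegral_sum d (T : measurableType d) (R : realType)
    (P : probability T R) (J : Type) (r : seq J) (F : J -> T -> R) :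
  (forall j, P.-integrable setT (EFin \o F j)) ->
  P.-integrable setT (EFin \o (fun x => \sum_(j <- r) F j x)) /\
  \int[P]_x (\sum_(j <- r) F j x) = \sum_(j <- r) \int[P]_x F j x.
Proof.
move=> iF; elim: r => [|j r [iS IH]].
  rewrite (_ : (fun x => _) = cst 0); last by apply/funext => x; rewrite big_nil.
  rewrite big_nil Rintegral_cst// mul0r; split => //.
  by apply: (@integrable_bounded _ _ _ P _ 0) => // x; rewrite normr0.
rewrite (_ : (fun x => _) = (fun x => F j x + \sum_(j <- r) F j x)); last first.
  by apply/funext => x; rewrite big_cons.
rewrite big_cons -IH; split; last exact: RintegralD.
exact: (integrableD measurableT (iF j) iS).
Qed.

Section small_drift.
Context (R : realType) (n : nat) d (T : measurableType d)
  (P : probability T R) (N : 'I_n -> T -> R) (sN : standard_normals P N).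
Variable eta : 'I_n -> R.

Let M := 'C(n, 2).

Let mNv : measurable_fun setT (fun w => (N ^~ w) : rvect R 'I_n).
Proof. exact: measurable_rvect sN.1.1. Qed.

(** The exponential of this norm factorises over the coordinates, which makes it convenient for
    domination under independence. *)
Definition l1norm (x : 'I_n -> R) : R := \sum_i `|x i|.

Lemma measurable_l1norm : measurable_fun setT (fun x : rvect R 'I_n => l1norm x).
Proof.
by apply: measurable_sum => i; apply: measurableT_comp => //;
  exact: measurable_coord.
Qed.

Lemma integrable_expR_bound (h : rvect R 'I_n -> R) (C K : R) :
  measurable_fun setT h -> (forall x, `|h x| <= C * expR (K * l1norm x)) ->
  P.-integrable setT (EFin \o (fun w => h (N ^~ w))).
Proof.
move=> mh hC; have mE : measurable_fun setT (fun w => expR (K * l1norm (N ^~ w))).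
  apply: measurableT_comp => //; apply: measurable_funM => //.
  exact: (measurableT_comp measurable_l1norm mNv).
have iE : P.-integrable setT (EFin \o (fun w => expR (K * l1norm (N ^~ w)))).
  apply/integrableP; split; first exact/measurable_EFinP.
  under eq_integral do rewrite /= ger0_norm ?expR_ge0//.
  exact: (integral_expR_sum_normals_lty sN).
have iCE : P.-integrable setT (EFin \o (fun w => C * expR (K * l1norm (N ^~ w)))).
  rewrite (_ : _ \o _ = fun w => (C%:E * (expR (K * l1norm (N ^~ w)))%:E)%E).
    exact: integrableZl.
  by apply/funext => w.
apply: le_integrable iCE => //.
  by apply/measurable_EFinP; exact: measurableT_comp mh mNv.
move=> w _ /=; rewrite lee_fin (le_trans (hC _))//.
exact: ler_norm.
Qed.

(** Each factor is at most [expR (l1norm x)]; padding the product to all [n * n] pairs only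
    increases it. *)
Lemma norm_vdm_le (x : 'I_n -> R) : `|vdm x| <= 1 * expR ((n * n)%:R * l1norm x).
Proof.
have S0 : 0 <= l1norm x by apply: sumr_ge0.
have xS i : `|x i| <= l1norm x.
  by rewrite /l1norm (bigD1 i)//= lerDl sumr_ge0.
rewrite mul1r vdm_prod normr_prod.
apply: (@le_trans _ _ (\prod_(i < n) \prod_(j < n) expR (l1norm x))); last first.
  by rewrite !prodr_const !card_ord -exprM -expRM_natl mulr_natl.
apply: ler_prod => i _; rewrite normr_ge0/= normr_prod big_mkcond/=.
apply: ler_prod => j _; case: ifPn => [ij|_]; last first.
  by rewrite ler01/= -expR0 ler_expR.
rewrite normr_ge0/= (le_trans _ (expR_ge1Dx _))//.
apply: (@le_trans _ _ (l1norm x)); last by rewrite lerDr.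
rewrite (le_trans (ler_normB _ _))// /l1norm (bigD1 i)//= (bigD1 j)//=.
  by rewrite addrA (addrC `|x i|) lerDl sumr_ge0.
by rewrite eq_sym neq_ltn ij.
Qed.

(* Up to the factor [exp (- e^2 |eta|^2 / 2)], the expectation of
   [f |Y| sg (vdm Y)] for a standard normal [Y] shifted by [e eta]. *)
Definition drift_integral (f : R -> R) (e : R) : R :=
  \int[P]_w (f (enorm (N ^~ w)) * Num.sg (vdm (N ^~ w)) *
             expR (e * \sum_i eta i * N i w)).

Let K := l1norm eta.

Let inner_le (x : 'I_n -> R) (s : {perm 'I_n}) :
  `|\sum_i eta i * x (s i)| <= K * l1norm x.
Proof.
apply: le_trans (ler_norm_sum _ _ _) _; rewrite /K {1}/l1norm mulr_suml.
apply: ler_sum => i _; rewrite normrM ler_wpM2l//.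
by rewrite /l1norm (bigD1 (s i))//= lerDl sumr_ge0.
Qed.

Let sg_le1 (x : R) : `|Num.sg x| <= 1.
Proof. by case: sgrP => _; rewrite ?normr0 ?normrN ?normr1 ?ler01. Qed.

Definition drift_remainder e (x : 'I_n -> R) : R :=
  \sum_(s : {perm 'I_n}) (-1) ^+ s * expR (e * \sum_i eta i * x (s i)) -
    e ^+ M / M`!%:R * ((fiber_count n M)%:R * vdm eta * vdm x).

(** Only the Taylor remainders of order [M.+1] are left, one for each of the [n!] permutations. One
    [K] in the exponent comes from [expR_taylor], where [e <= 1] is used, and the other from
    bounding [c ^+ M.+1] by [M.+1! * expR c]. *)
Lemma drift_remainder_le e x : 0 <= e <= 1 ->
  `|drift_remainder e x| <=
  e ^+ M.+1 * ((n`! * M.+1`!)%:R * expR ((K + K) * l1norm x)).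
Proof.
move=> /andP[e0 e1].
have aux (z a b u : R) : z * (a * b * u) = a * u * (z * b) by ring.
pose c (s : {perm 'I_n}) := \sum_i eta i * x (s i).
have -> : drift_remainder e x = \sum_(s : {perm 'I_n}) (-1) ^+ s *
    (expR (e * c s) - \sum_(k < M.+1) (e * c s) ^+ k / k`!%:R).
  rewrite /drift_remainder; under [in RHS]eq_bigr do rewrite mulrBr.
  rewrite sumrB; congr (_ - _).
  under [RHS]eq_bigr do rewrite mulr_sumr.
  rewrite exchange_big/= big_ord_recr/= big1 => [|k _]; last first.
    rewrite (eq_bigr (fun s : {perm 'I_n} => (e ^+ k / k`!%:R) * ((-1) ^+ s * c
      s ^+ k))).
      by rewrite -mulr_sumr signed_sum_eq0 ?mulr0.
    by move=> s _; rewrite exprMn; exact: aux.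
  rewrite add0r (eq_bigr (fun s : {perm 'I_n} => (e ^+ M / M`!%:R) * ((-1) ^+ s
    * c s ^+ M))).
    by rewrite -mulr_sumr signed_sum_vdm.
  by move=> s _; rewrite exprMn; exact: aux.
apply: le_trans (ler_norm_sum _ _ _) _.
apply: (@le_trans _ _ (\sum_(s : {perm 'I_n})
    e ^+ M.+1 * (M.+1`!%:R * expR ((K + K) * l1norm x)))); last first.
  by rewrite sumr_const card_Sn natrM -[leLHS]mulr_natl mulrCA -(mulrA n`!%:R).
apply: ler_sum => s _; rewrite normrM normrX normrN1 expr1n mul1r.
apply: le_trans (expR_taylor _ _) _.
rewrite normrM (ger0_norm e0) exprMn -mulrA ler_wpM2l ?exprn_ge0//.
have c0 : 0 <= `|c s| by [].
have cK : `|c s| <= K * l1norm x by exact: inner_le.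
rewrite mulrDl expRD mulrA ler_pM ?exprn_ge0 ?expR_ge0//; last first.
  rewrite ler_expR (le_trans _ cK)// ler_piMl//.
apply: (@le_trans _ _ (M.+1`!%:R * expR `|c s|)); last first.
  by rewrite ler_wpM2l// ler_expR.
rewrite -ler_pdivrMl ?ltr0n ?fact_gt0// mulrC.
have := expR_ge1Dxn M c0.
by apply: le_trans; rewrite lerDr ler01.
Qed.

Section test_function.
Variables (f : R -> R) (C : R).
Hypotheses (mf : measurable_fun setT f) (fC : forall x, `|f x| <= C).

Let C0 : 0 <= C. Proof. exact: le_trans (fC 0). Qed.

Let hs (x : rvect R 'I_n) : R := f (enorm x) * Num.sg (vdm x).

Let mhs : measurable_fun setT hs.
Proof.
apply: measurable_funM.
  by apply: (measurableT_comp mf); exact: measurable_enorm.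
by apply: (measurableT_comp (@measurable_sg R)); exact: measurable_vdm.
Qed.

Let hs_le x : `|hs x| <= C.
Proof. by rewrite normrM -[C]mulr1 ler_pM. Qed.

Let hs_perm x (s : {perm 'I_n}) : hs (fun i => x (s i)) = (-1) ^+ s * hs x.
Proof.
rewrite /hs enorm_perm vdm_perm sgrM mulrCA; congr (_ * _).
by case: (odd_perm s); rewrite ?expr0 ?sgr1// expr1 sgrN1.
Qed.

Let mexp e (s : {perm 'I_n}) : measurable_fun setT
  (fun x : rvect R 'I_n => expR (e * \sum_i eta i * x (s i))).
Proof.
apply: measurableT_comp => //; apply: measurable_funM => //.
by apply: measurable_sum => i; apply: measurable_funM => //;
  exact: measurable_coord.
Qed.

Let int_exp e (s : {perm 'I_n}) : P.-integrable setT
  (EFin \o (fun w => hs (N ^~ w) * expR (e * \sum_i eta i * N (s i) w))).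
Proof.
apply: (@integrable_expR_bound
  (fun x => hs x * expR (e * \sum_i eta i * x (s i))) C (`|e| * K)).
  by apply: measurable_funM => //; exact: mexp.
move=> x; rewrite normrM (ger0_norm (expR_ge0 _)) ler_pM ?expR_ge0//.
rewrite ler_expR; apply: le_trans (ler_norm _) _; rewrite normrM -mulrA.
by rewrite ler_wpM2l.
Qed.

Lemma integrable_drift e : P.-integrable setT (EFin \o
  (fun w => f (enorm (N ^~ w)) * Num.sg (vdm (N ^~ w)) *
            expR (e * \sum_i eta i * N i w))).
Proof.
apply: eq_integrable (int_exp e 1%g) => // w _.
by rewrite /comp; under eq_bigr do rewrite perm1.
Qed.

(** Permuting the coordinates of [N] preserves its law and multiplies [hs] by the signature. Summing
    over all permutations moves the antisymmetrisation onto the exponential. *)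
Lemma drift_integral_sym e : n`!%:R * drift_integral f e =
  \int[P]_w (hs (N ^~ w) *
    \sum_(s : {perm 'I_n}) (-1) ^+ s * expR (e * \sum_i eta i * N (s i) w)).
Proof.
have step (s : {perm 'I_n}) : drift_integral f e =
    \int[P]_w ((-1) ^+ s * (hs (N ^~ w) * expR (e * \sum_i eta i * N (s i) w))).
  pose F (x : rvect R 'I_n) := hs x * expR (e * \sum_i eta i * x i).
  have mF : measurable_fun setT F.
    apply: measurable_funM => //; rewrite (_ : (fun x => _) =
      fun x : rvect R 'I_n => expR (e * \sum_i eta i * x ((1%g : {perm 'I_n}) i))).
      exact: mexp.
    by apply/funext => x; under [in RHS]eq_bigr do rewrite perm1.
  transitivity (\int[P]_w F (fun i => N (s i) w)).
    congr fine; rewrite (integral_perm_independent sN.1 (p := s) (F := F))//.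
    by move=> i A mA; rewrite !sN.2.
  apply: eq_Rintegral => w _; rewrite /F.
  by rewrite [RHS]mulrA; congr (_ * _); exact: hs_perm.
transitivity (\sum_(s : {perm 'I_n}) drift_integral f e).
  by rewrite sumr_const mulr_natl card_Sn.
transitivity (\sum_(s : {perm 'I_n})
    \int[P]_w ((-1) ^+ s * (hs (N ^~ w) * expR (e * \sum_i eta i * N (s i) w)))).
  by apply: eq_bigr => s _; exact: step.
rewrite -(Rintegral_sum _ _).2; last first.
  move=> s; rewrite (_ : _ \o _ = fun w => (((-1) ^+ s)%:E *
    (hs (N ^~ w) * expR (e * \sum_i eta i * N (s i) w))%:E)%E)//.
  by apply: integrableZl => //; exact: int_exp.
apply: eq_Rintegral => w _; rewrite mulr_sumr; apply: eq_bigr => s _.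
by rewrite mulrCA.
Qed.

(** The sign in [hs] times the [vdm] of the leading term is the absolute value of [vdm]; the
    remainder is integrated against the bound of [drift_remainder_le]. *)
Lemma drift_integral_asymp : exists B : R, forall e, 0 <= e <= 1 ->
  `|n`!%:R * drift_integral f e - e ^+ M / M`!%:R *
     ((fiber_count n M)%:R * vdm eta *
      \int[P]_w (f (enorm (N ^~ w)) * `|vdm (N ^~ w)|))| <= e ^+ M.+1 * B.
Proof.
have sgV (y : R) : Num.sg y * y = `|y| by rewrite [RHS]normrEsg.
have iV : P.-integrable setT
    (EFin \o (fun w => f (enorm (N ^~ w)) * `|vdm (N ^~ w)|)).
  apply: (@integrable_expR_bound
    (fun x => f (enorm x) * `|vdm x|) C (n * n)%:R).
    apply: measurable_funM.
      by apply: (measurableT_comp mf); exact: measurable_enorm.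
    by apply: measurableT_comp => //; exact: measurable_vdm.
  move=> x; rewrite normrM normr_id ler_pM//.
  by rewrite (le_trans (norm_vdm_le x))// mul1r.
have iE : P.-integrable setT (EFin \o (fun w => expR ((K + K) * l1norm (N ^~ w)))).
  apply: (@integrable_expR_bound (fun x => expR ((K + K) * l1norm x)) 1 (K + K)).
    apply: measurableT_comp => //; apply: measurable_funM => //.
    exact: measurable_l1norm.
  by move=> x; rewrite mul1r ger0_norm// expR_ge0.
have aux (g z v u a k : R) : g * z * (u * (k * a * v)) = u * (k * a) * (g * (z *
  v)).
  by ring.
exists (C * ((n`! * M.+1`!)%:R * \int[P]_w expR ((K + K) * l1norm (N ^~ w)))).
move=> e e01; rewrite drift_integral_sym.
have iS : P.-integrable setT (EFin \o (fun w => hs (N ^~ w) *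
    \sum_(s : {perm 'I_n}) (-1) ^+ s * expR (e * \sum_i eta i * N (s i) w))).
  have iF (s : {perm 'I_n}) : P.-integrable setT (EFin \o (fun w =>
      (-1) ^+ s * (hs (N ^~ w) * expR (e * \sum_i eta i * N (s i) w)))).
    exact: (integrableZl measurableT ((-1) ^+ s) (int_exp e s)).
  apply: eq_integrable (Rintegral_sum (index_enum _) iF).1 => // w _ /=; congr EFin.
  by rewrite mulr_sumr; apply: eq_bigr => s _; rewrite mulrCA.
have iR : P.-integrable setT (EFin \o (fun w => hs (N ^~ w) * drift_remainder e
  (N ^~ w))).
  pose a := e ^+ M / M`!%:R * ((fiber_count n M)%:R * vdm eta).
  apply: eq_integrable (integrableB measurableT iS (integrableZl measurableT a
    iV)) => //.
  move=> w _.
  transitivity (EFin (hs (N ^~ w) *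
      \sum_(s : {perm 'I_n}) (-1) ^+ s * expR (e * \sum_i eta i * N (s i) w) -
      a * (f (enorm (N ^~ w)) * `|vdm (N ^~ w)|))) => //.
  rewrite /comp /drift_remainder mulrBr; congr (_ - _)%:E.
  by rewrite -sgV /a; symmetry; exact: aux.
have -> : \int[P]_w (hs (N ^~ w) *
    \sum_(s : {perm 'I_n}) (-1) ^+ s * expR (e * \sum_i eta i * N (s i) w)) =
  \int[P]_w (hs (N ^~ w) * drift_remainder e (N ^~ w)) + e ^+ M / M`!%:R *
     ((fiber_count n M)%:R * vdm eta *
      \int[P]_w (f (enorm (N ^~ w)) * `|vdm (N ^~ w)|)).
  rewrite mulrA -RintegralZl// -RintegralD//;
    last exact: (integrableZl measurableT _ iV).
  apply: eq_Rintegral => w _; rewrite /drift_remainder -sgV mulrBr.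
  by rewrite -[RHS]/(_ - _ + _); rewrite -aux subrK.
rewrite addrK.
apply: le_trans (le_normr_Rintegral _ _) _ => //.
have iZ (k : R) (h : T -> R) : P.-integrable setT (EFin \o h) ->
    P.-integrable setT (EFin \o (fun w => k * h w)).
  exact: (integrableZl measurableT k).
rewrite mulrCA -RintegralZl// -RintegralZl//; last exact: iZ.
rewrite -RintegralZl//; last by do 2 apply: (iZ).
apply: le_Rintegral => //.
- by have := integrable_norm iR; apply: eq_integrable.
- by do 3 apply: (iZ).
move=> w _; rewrite normrM;
  apply: le_trans (ler_pM _ _ (hs_le _) (drift_remainder_le _ e01)) _ => //.
Qed.

End test_function.

Let iV : P.-integrable setT (EFin \o (fun w => `|vdm (N ^~ w)|)).
Proof.
apply: (@integrable_expR_bound (fun x => `|vdm x|) 1 (n * n)%:R).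
  by apply: measurableT_comp => //; exact: measurable_vdm.
by move=> x; rewrite normr_id norm_vdm_le.
Qed.

Lemma Rintegral_norm_vdm_gt0 : 0 < \int[P]_w `|vdm (N ^~ w)|.
Proof.
(* The intervals from [2 i] to [2 i + 1] keep the coordinates at least 1 apart, so that every factor
   of [vdm] is at least 1 on the box. *)
pose a (i : 'I_n) : R := i.*2%:R.
pose B := \bigcap_i (N i @^-1` `]a i, a i + 1[).
have mB : measurable B by exact: (measurable_box sN a (fun i => a i + 1)).
have B0 : (0 < P B)%E.
  by apply: (standard_normals_box_gt0 sN (a := a) (b := fun i => a i + 1)) => i;
    rewrite ltrDl.
have BV w : B w -> 1 <= `|vdm (N ^~ w)|.
  move=> Bw; rewrite vdm_prod normr_prod.
  elim/big_ind : _ => // [x y x1 y1|i _]; first by rewrite mulr_ege1.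
  rewrite normr_prod; elim/big_ind : _ => // [x y x1 y1|j ij];
    first by rewrite mulr_ege1.
  have := Bw i I; have := Bw j I; rewrite /= !in_itv/= => /andP[hj _] /andP[_ hi].
  apply: le_trans (ler_norm _).
  have : a i + 2 <= a j by rewrite /a -natrD ler_nat addn2 -doubleS leq_double.
  by move: hi hj; lra.
rewrite -(@fineK _ (P B)) ?fin_num_measure// lte_fin in B0.
apply: (lt_le_trans B0); rewrite -[leLHS]/(fine (P B)).
have -> : fine (P B) = \int[P]_w (\1_B w : R).
  by rewrite /Rintegral integral_indic// setIT.
apply: le_Rintegral => //.
  by apply: (@integrable_bounded _ _ _ P _ 1) => // x; rewrite indicE;
    case: (_ \in _); rewrite ?normr1 ?normr0.
move=> w _; rewrite indicE; case: (boolP (w \in B)) => [/set_mem/BV//|_].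
exact: normr_ge0.
Qed.

Lemma drift_integral_cvg (f : R -> R) (C : R) :
  measurable_fun setT f -> (forall x, `|f x| <= C) ->
  n`!%:R * drift_integral f (Num.sqrt t)^-1 / (Num.sqrt t)^-1 ^+ M
    @[t --> +oo] -->
  M`!%:R^-1 * ((fiber_count n M)%:R * vdm eta *
      \int[P]_w (f (enorm (N ^~ w)) * `|vdm (N ^~ w)|)).
Proof.
move=> mf fC; have [B hB] := drift_integral_asymp mf fC.
set L := (X in _ --> X).
apply/cvgrPdist_le => eps eps0.
near=> t.
have t1 : 1 <= t by near: t; exact: nbhs_pinfty_ge.
set e := (Num.sqrt t)^-1.
have e0 : 0 < e by rewrite invr_gt0 sqrtr_gt0 (lt_le_trans ltr01).
have e1 : e <= 1.
  rewrite invf_le1 ?sqrtr_gt0 ?(lt_le_trans ltr01)//.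
  by rewrite -[leLHS]sqrtr1 ler_wsqrtr.
have := hB e; rewrite (ltW e0) e1 => /(_ isT) h.
have eM : 0 < e ^+ M by rewrite exprn_gt0.
rewrite distrC -(ler_pM2l eM) -{1}(gtr0_norm eM) -normrM mulrBr.
rewrite (mulrC _ (_ / _)) divfK ?gt_eqF// [X in _ - X]mulrA.
apply: le_trans h _; rewrite exprSr -mulrA ler_wpM2l//; first exact: ltW.
apply: (@le_trans _ _ (e * `|B|)); first by rewrite ler_wpM2l ?(ltW e0)// ler_norm.
rewrite mulrC /e ler_pdivrMr ?sqrtr_gt0 ?(lt_le_trans ltr01)//.
rewrite mulrC -ler_pdivrMr//.
have b0 : 0 <= `|B| / eps by rewrite divr_ge0// ltW.
(* It remains that [t] is eventually at least the square of [|B| / eps]. *)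
rewrite -[leLHS](ger0_norm b0) -sqrtr_sqr ler_wsqrtr//.
Unshelve. all: by end_near. Qed.

Lemma drift_integral_ratio (f : R -> R) (C : R) :
  measurable_fun setT f -> (forall x, `|f x| <= C) -> injective eta ->
  drift_integral f (Num.sqrt t)^-1 / drift_integral (cst 1) (Num.sqrt t)^-1
    @[t --> +oo] -->
  \int[P]_w (f (enorm (N ^~ w)) * `|vdm (N ^~ w)|) / \int[P]_w `|vdm (N ^~ w)|.
Proof.
move=> mf fC eta_inj.
have V0 : vdm eta != 0 by exact: vdm_neq0.
have k0 : (fiber_count n M)%:R != 0 :> R by rewrite pnatr_eq0 -lt0n fiber_count_gt0.
have M0 : M`!%:R != 0 :> R by rewrite pnatr_eq0 -lt0n fact_gt0.
have n0 : n`!%:R != 0 :> R by rewrite pnatr_eq0 -lt0n fact_gt0.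
have I0 : \int[P]_w `|vdm (N ^~ w)| != 0 by rewrite gt_eqF// Rintegral_norm_vdm_gt0.
have cf := drift_integral_cvg mf fC.
have one (x : R) : `|cst (1 : R) x| <= 1 by rewrite normr1.
have c1 := drift_integral_cvg (f := cst 1) (C := 1) (measurable_cst _) one.
have -> : \int[P]_w (f (enorm (N ^~ w)) * `|vdm (N ^~ w)|) / \int[P]_w `|vdm (N
  ^~ w)| =
   M`!%:R^-1 * ((fiber_count n M)%:R * vdm eta *
      \int[P]_w (f (enorm (N ^~ w)) * `|vdm (N ^~ w)|)) *
   (M`!%:R^-1 * ((fiber_count n M)%:R * vdm eta *
      \int[P]_w (cst 1 (enorm (N ^~ w)) * `|vdm (N ^~ w)|)))^-1.
  rewrite (_ : (fun w => cst 1 _ * _) = fun w => `|vdm (N ^~ w)|); last first.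
    by apply/funext => w; rewrite /= mul1r.
  move: (\int[P]_w (_ * _)) (fiber_count n M)%:R k0 (vdm eta) V0 I0 M`!%:R M0.
  move=> a b b0 c c0 I0 g g0; field.
  by rewrite I0 g0 b0 c0.
apply: cvg_trans (cvgM cf (cvgV _ c1)); last first.
  rewrite (_ : (fun w => cst 1 _ * _) = fun w => `|vdm (N ^~ w)|); last first.
    by apply/funext => w; rewrite /= mul1r.
  by rewrite !mulf_neq0// invr_neq0.
apply: near_eq_cvg; near=> t.
have t0 : 0 < t by near: t; exact: nbhs_pinfty_gt.
have e0 : (Num.sqrt t)^-1 ^+ M != 0 by
  rewrite expf_neq0// invr_neq0// gt_eqF// sqrtr_gt0.
set e := (Num.sqrt t)^-1 in e0 *.
transitivity (n`!%:R * drift_integral f e / e ^+ M *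
  (n`!%:R * drift_integral (cst 1) e / e ^+ M)^-1) => //.
by rewrite invfM invrK mulrACA mulVf// mulr1 invfM mulrACA divff// mul1r.
Unshelve. all: by end_near. Qed.

(** The radial identity holds for nonnegative functions; it is applied to [f + C], and the
    contribution of [C] is subtracted. *)
Lemma Rintegral_radial_vdm (f : R -> R) (C : R) d' (T' : measurableType d')
    (P' : probability T' R) (Z : 'I_(n + M) -> T' -> R) :
  standard_normals P' Z -> measurable_fun setT f -> (forall x, `|f x| <= C) ->
  \int[P]_w (f (enorm (N ^~ w)) * `|vdm (N ^~ w)|) =
  \int[P]_w `|vdm (N ^~ w)| * \int[P']_w f (enorm (Z ^~ w)).
Proof.
move=> sZ mf fC.
have mfE : measurable_fun setT (fun x : rvect R 'I_n => f (enorm x)).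
  by apply: (measurableT_comp mf); exact: measurable_enorm.
have mfZ : measurable_fun setT (fun w => f (enorm (Z ^~ w))).
  apply: (measurableT_comp mf).
  exact: (measurableT_comp (@measurable_enorm _ _) (measurable_rvect sZ.1.1)).
have C0 : 0 <= C by exact: le_trans (fC 0).
have fin_V : (\int[P]_w (`|vdm (N ^~ w)|)%:E)%E \is a fin_num by
  exact: integrable_fin_num iV.
have key (g : R -> R) D : measurable_fun setT g -> (forall x, `|g x| <= D) ->
    (forall x, 0 <= g x) ->
    \int[P]_w (g (enorm (N ^~ w)) * `|vdm (N ^~ w)|) =
    \int[P]_w `|vdm (N ^~ w)| * \int[P']_w g (enorm (Z ^~ w)).
  move=> mg gD g0; have mgZ : measurable_fun setT (fun w => g (enorm (Z ^~ w))).
    apply: (measurableT_comp mg).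
    exact: (measurableT_comp (@measurable_enorm _ _) (measurable_rvect sZ.1.1)).
  rewrite {1}/Rintegral (integral_radial (m := M) sN (W := fun x => `|vdm x|) _
    _ _ _ sZ mg g0)//.
  - rewrite fineM//; apply: integrable_fin_num => //.
    exact: (@integrable_bounded _ _ _ P' _ D).
  - by apply: measurableT_comp => //; exact: measurable_vdm.
  - by move=> c x c0; rewrite vdm_scale normrM normrX gtr0_norm.
  - by rewrite ltey_eq fin_V.
have h1 : \int[P]_w (f (enorm (N ^~ w)) * `|vdm (N ^~ w)|) =
    \int[P]_w ((f (enorm (N ^~ w)) + C) * `|vdm (N ^~ w)|) -
    \int[P]_w (C * `|vdm (N ^~ w)|).
  rewrite -RintegralB//.
  - by apply: eq_Rintegral => w _; rewrite mulrDl addrK.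
  - apply: (@integrable_expR_bound
      (fun x => (f (enorm x) + C) * `|vdm x|) (C + C) (n * n)%:R).
      apply: measurable_funM; first exact: measurable_funD.
      by apply: measurableT_comp => //; exact: measurable_vdm.
    move=> x; rewrite normrM normr_id ler_pM//.
      by rewrite (le_trans (ler_normD _ _))// lerD// ger0_norm.
    by rewrite (le_trans (norm_vdm_le x))// mul1r.
  - exact: (integrableZl measurableT C iV).
have h2 : \int[P']_w f (enorm (Z ^~ w)) = \int[P']_w (f (enorm (Z ^~ w)) + C) - C.
  rewrite RintegralD//; last 2 first.
    exact: (@integrable_bounded _ _ _ P' _ C).
    by apply: (@integrable_bounded _ _ _ P' _ C) => //= x; rewrite ger0_norm.
  have -> : \int[P']_w C = C by
    rewrite Rintegral_cst// -[X in C * fine X]/(P' setT) probability_setT mulr1.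
  by rewrite addrK.
rewrite h1 h2 mulrBr RintegralZl// (mulrC C); congr (_ - _).
apply: (key (fun x => f x + C) (C + C)).
- exact: measurable_funD.
- by move=> x; rewrite (le_trans (ler_normD _ _))// lerD// ger0_norm.
- by move=> x; rewrite -lerBlDr sub0r; have := fC x; rewrite ler_norml => /andP[].
Qed.

End small_drift.

(** * The conditional limit law *)

Section conditional_integral.
Context d (Omega : measurableType d) (R : realType) (P : probability Omega R).
Local Open Scope ereal_scope.

(** The conditional probability is recognised as a rescaled restriction of [P], hence as a measure.
    If [A] is null, both sides are 0 since the inverse of 0 is 0. *)
Lemma integral_conditional_probability (A : set Omega) (g : Omega -> R)
    (f : R -> R) (C : R) :
  measurable A -> measurable_fun setT g -> measurable_fun setT f ->
  (forall x, `|f x| <= C)%R ->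
  \int[pushforward (conditional_probability P A) g]_x (f x)%:E =
  (\int[P]_w (\1_A w * f (g w)) / fine (P A))%:E.
Proof.
move=> mA mg mf fC.
have c0 : (0 <= (fine (P A))^-1)%R by rewrite invr_ge0 fine_ge0.
pose c := NngNum c0.
have -> : pushforward (conditional_probability P A) g =
    pushforward (mscale c (mrestr P mA)) g.
  by apply/funext => E; rewrite /pushforward /conditional_probability muleC.
pose wt w : R := ((fine (P A))^-1 * \1_A w)%R.
have mwt : measurable_fun setT wt by exact: measurable_funM.
have wt0 w : (0 <= wt w)%R by rewrite mulr_ge0// indicE.
have mfg : measurable_fun setT (f \o g) by exact: measurableT_comp.
have key (h : R -> \bar R) : measurable_fun setT h -> (forall x, 0 <= h x) ->
    \int[pushforward (mscale c (mrestr P mA)) g]_x h x =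
    \int[P]_w (h (g w) * (wt w)%:E).
  move=> mh h0; rewrite ge0_integral_pushforward//.
  rewrite preimage_setT.
  have mhg : measurable_fun setT (h \o g) by exact: measurableT_comp.
  rewrite (eq_measure_integral (weighted P mwt wt0)); last first.
    move=> E mE _; rewrite /= /mscale /weighted/= /mrestr.
    under eq_integral do rewrite EFinM.
    rewrite ge0_integralZl//.
    - by rewrite integral_indic// setIC.
    - by apply/measurable_EFinP; exact: measurable_funTS.
  by rewrite ge0_integral_weighted// => x; exact: h0.
rewrite integralE key; last 2 first.
  by apply: measurable_funepos; exact/measurable_EFinP.
  by [].
rewrite key; last 2 first.
  by apply: measurable_funeneg; exact/measurable_EFinP.
  by [].
have mfw : measurable_fun setT (fun w => (\1_A w * f (g w))%R) by
  exact: measurable_funM.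
have iF : P.-integrable setT (EFin \o (fun w => (\1_A w * f (g w))%R)).
  apply: (@integrable_bounded _ _ _ P _ C) => // x.
  rewrite normrM -[leRHS]mul1r ler_pM// indicE.
  by case: (_ \in _); rewrite ?normr1 ?normr0.
rewrite mulrC -RintegralZl// /Rintegral fineK; last first.
  apply: integrable_fin_num => //.
  exact: (integrableZl measurableT (fine (P A))^-1%R iF).
rewrite [RHS]integralE; congr (_ - _); apply: eq_integral => w _.
  rewrite muleC -[LHS]/((wt w)%:E * (EFin \o f)^\+ (g w)).
  rewrite !funeposE /= -!EFin_max -EFinM maxr_pMr// mulr0.
  by rewrite /wt -mulrA.
rewrite muleC -[LHS]/((wt w)%:E * (EFin \o f)^\- (g w)).
rewrite !funenegE /= -!EFin_max -EFinM maxr_pMr// mulr0.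
by rewrite /wt mulrN mulrA.
Qed.

Lemma integral_pushforward_bounded (g : Omega -> R) (f : R -> R) (C : R) :
  measurable_fun setT g -> measurable_fun setT f -> (forall x, `|f x| <= C)%R ->
  \int[pushforward P g]_x (f x)%:E = (\int[P]_w f (g w))%:E.
Proof.
move=> mg mf fC; have ifg : P.-integrable setT (EFin \o (fun w => f (g w))).
  by apply: (@integrable_bounded _ _ _ P _ C) => //; exact: measurableT_comp.
rewrite integral_pushforward//; last exact/measurable_EFinP.
by rewrite preimage_setT /Rintegral fineK//; exact: integrable_fin_num.
Qed.

End conditional_integral.

Lemma bounded_fun_normP (R : realType) (f : R -> R) :
  bounded_fun f -> exists C, forall x, `|f x| <= C.
Proof.
by move=> /pinfty_ex_gt0[C _ HC]; exists C => x; exact: HC.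
Qed.

Section collision.
Context (R : realType) (n : nat) d (Omega : measurableType d)
  (X : 'I_n -> R -> Omega -> R).
Hypothesis cX : forall i w, {within `[0, +oo[, continuous ((X i)^~ w)}.

(** The infimum must exceed [t] strictly: by continuity, coordinates that are distinct at [t] remain
    distinct for some time [e] after it, so no collision occurs before [t + e]. *)
Lemma collision_time_gtP t w : 0 <= t ->
  (t%:E < collision_time X w)%E <-> no_collision X t w.
Proof.
move=> t0; split => [tT s /andP[s0 st] i j ij|nc].
  apply/eqP => Xij; move: tT; rewrite ltNge => /negP; apply.
  apply: (@le_trans _ _ s%:E); last by rewrite lee_fin.
  by apply: ereal_inf_lbound; exists s => //; split => //; exists i, j.
have [e e0 He] : exists2 e, 0 < e & forall p : 'I_n * 'I_n, p.1 != p.2 ->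
    forall s, 0 <= s -> `|s - t| < e -> X p.1 s w != X p.2 s w.
  have : \forall e \near 0^'+, forall p : 'I_n * 'I_n, p.1 != p.2 ->
      forall s, 0 <= s -> `|s - t| < e -> X p.1 s w != X p.2 s w.
    apply: filter_forall => -[i j] /=.
    have [ij|ij] := boolP (i == j); first by near=> e.
    have dX : 0 < `|X i t w - X j t w|.
      by rewrite normr_gt0 subr_eq0; apply: nc; rewrite ?t0/=.
    have [del del0 H] := path_near cX i j w t0 dX.
    near=> e => _ s s0 se; apply/eqP => Xij.
    have := H s s0; rewrite Xij subrr sub0r normrN ltxx => F.
    suff : false by []. apply: F; apply: lt_le_trans se _.
    by near: e; apply: nbhs_right_le.
  move=> H; near (0 : R)^'+ => e; exists e.
    by near: e; exact: nbhs_right_gt.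
  by near: e.
apply: (@lt_le_trans _ _ (t + e)%:E); first by rewrite lte_fin ltrDl.
apply: le_ereal_inf_tmp => _ [s [s0 [i [j [ij Xij]]]] <-].
rewrite lee_fin leNgt; apply/negP => ste.
have [st|ts] := leP s t.
  by have := nc s; rewrite s0 st => /(_ isT i j ij); rewrite Xij eqxx.
have := He (i, j) ij s s0; rewrite /= Xij eqxx ger0_norm ?subr_ge0 ?(ltW ts)//.
by rewrite ltrBlDl => /(_ ste).
Unshelve. all: by end_near. Qed.

End collision.

Lemma brownian_motion_start_ae (R : realType) (n : nat) (eta : 'I_n -> R) d
    (Omega : measurableType d) (P : probability Omega R)
    (X : 'I_n -> R -> Omega -> R) : brownian_motion_dim P eta X ->
  {ae P, forall w, forall i, X i 0 w = eta i}.
Proof.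
move=> hX; have h i := bm_start (hX.1 i).
(* Indexed by all natural numbers so that a countable intersection of almost sure events applies. *)
pose P' m w := forall i : 'I_n, val i = m -> X i 0 w = eta i.
have : {ae P, forall w, forall m, P' m w}.
  apply: ae_foralln => m; have [mn|nm] := ltnP m n.
    by apply: filterS (h (Ordinal mn)) => w Xw i im;
      rewrite (_ : i = Ordinal mn)//; exact: val_inj.
  by apply: aeW => w i im; move: (ltn_ord i); rewrite im ltnNge nm.
by apply: filterS => w Pw i; exact: (Pw i).
Qed.

Section limit_law.
Context (R : realType) (n : nat) (eta : 'I_n -> R) (eta_inj : injective eta)
  d (Omega : measurableType d) (P : probability Omega R)
  (X : 'I_n -> R -> Omega -> R).
Hypothesis hX : brownian_motion_dim P eta X.

Let N i := X i 1 \- X i 0.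
Let sN : standard_normals P N := standard_normals_increment hX.

(** The sign of [vdm] is invariant under division by [Num.sqrt t], which turns the endpoint into a
    normal vector of mean [eta / Num.sqrt t]. The prefactor on the right does not involve [f]. *)
Lemma survival_drift t (f : R -> R) C : 0 < t -> continuous f ->
  (forall x, `|f x| <= C) ->
  Num.sg (vdm eta) *
    \int[P]_w (\1_[set w | no_collision (pinned eta X) t w] w *
      f (enorm (fun i => pinned eta X i t w) / Num.sqrt t)) =
  expR (- \sum_i (eta i / Num.sqrt t) ^+ 2 / 2) *
    drift_integral P N eta f (Num.sqrt t)^-1.
Proof.
move=> t0 cf fC; have st0 : 0 < Num.sqrt t by rewrite sqrtr_gt0.
have mf : measurable_fun setT f by exact: continuous_measurable_fun.
have cg : continuous (fun r : R => f (r / Num.sqrt t)).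
  by move=> r; apply: continuous_comp; [apply: cvgM => //; exact: cvg_cst|
    exact: cf].
rewrite (survival_sg_vdm hX t0 cg (fun x => fC _)).
pose F (x : rvect R 'I_n) := f (enorm x) * Num.sg (vdm x).
have mF : measurable_fun setT F.
  apply: measurable_funM.
    by apply: (measurableT_comp mf); exact: measurable_enorm.
  by apply: (measurableT_comp (@measurable_sg R)); exact: measurable_vdm.
transitivity (\int[P]_w F (fun i => pinned eta X i t w / Num.sqrt t)).
  apply: eq_Rintegral => w _; rewrite /F.
  rewrite (_ : (fun i => _ / _) = fun i => (Num.sqrt t)^-1 * pinned eta X i t w).
    rewrite vdm_scale sgrM enorm_scale ?invr_ge0 ?(ltW st0)//.
    by rewrite (@gtr0_sg _ (_ ^+ _)) ?exprn_gt0 ?invr_gt0// mul1r (mulrC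
      (Num.sqrt t)^-1).
  by apply/funext => i; rewrite mulrC.
transitivity (\int[P]_w (F (N ^~ w) *
    \prod_i expR (eta i / Num.sqrt t * N i w - (eta i / Num.sqrt t) ^+ 2 / 2))).
  congr fine; apply: (integral_shift_normals sN) => //.
    exact: independent_pinned_scaled.
  by move=> i A mA; exact: law_pinned_scaled.
rewrite /drift_integral -RintegralZl//.
  apply: eq_Rintegral => w _; rewrite /F -expR_sum sumrB expRD mulr_sumr.
  rewrite mulrA mulrC; congr (_ * (_ * expR _)).
  by apply: eq_bigr => i _; rewrite mulrA (mulrC _ (eta i)).
exact: (integrable_drift sN eta mf fC _).
Qed.

Let pinned_ae : {ae P, forall w, forall i s, pinned eta X i s w = X i s w}.
Proof.
by apply: filterS (brownian_motion_start_ae hX) => w X0 i s;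
  rewrite /pinned X0 addrC subrK.
Qed.

Let survive t := [set w | (t%:E < collision_time X w)%E].

Let surviveE t : 0 <= t -> survive t = [set w | no_collision X t w].
Proof.
move=> t0; apply/seteqP; split => w; rewrite /survive /=.
  by move=> /(collision_time_gtP (fun i => bm_continuous (hX.1 i)) w t0).
by move=> /(collision_time_gtP (fun i => bm_continuous (hX.1 i)) w t0).
Qed.

Let measurable_survive t : 0 < t -> measurable (survive t).
Proof.
move=> t0; rewrite surviveE ?ltW//; apply: measurable_no_collision => //.
  by move=> i s s0; exact: bm_measurable (hX.1 i) _ s0.
by move=> i w; exact: bm_continuous (hX.1 i) w.
Qed.

Let measurable_radius t : 0 <= t ->
  measurable_fun setT (fun w => enorm (fun i => X i t w) / Num.sqrt t).
Proof.
move=> t0; apply: measurable_funM => //.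
apply: (measurableT_comp (@measurable_enorm R n)).
by apply: measurable_rvect => i; exact: bm_measurable (hX.1 i) _ t0.
Qed.

Let survival_pinned t (f : R -> R) : 0 < t -> continuous f ->
  \int[P]_w (\1_(survive t) w * f (enorm (fun i => X i t w) / Num.sqrt t)) =
  \int[P]_w (\1_[set w | no_collision (pinned eta X) t w] w *
    f (enorm (fun i => pinned eta X i t w) / Num.sqrt t)).
Proof.
move=> t0 cf; have t0' := ltW t0.
have mf : measurable_fun setT f by exact: continuous_measurable_fun.
congr fine; apply: ae_eq_integral => //.
- apply/measurable_EFinP; apply: measurable_funM.
    by apply: measurable_indic; exact: measurable_survive.
  by apply: (measurableT_comp mf); exact: measurable_radius.
- apply/measurable_EFinP; apply: measurable_funM.
    apply: measurable_indic; apply: measurable_no_collision => //.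
      exact: (measurable_pinned hX).
    exact: (continuous_pinned hX).
  apply: (measurableT_comp mf); apply: measurable_funM => //.
  apply: (measurableT_comp (@measurable_enorm R n)).
  by apply: measurable_rvect => i; exact: (measurable_pinned hX).
apply: filterS pinned_ae => w pw _; rewrite surviveE//.
have -> : (fun i => pinned eta X i t w) = (fun i => X i t w).
  by apply/funext => i; rewrite pw.
congr (_ * _)%:E; rewrite !indicE; congr (_%:R); congr nat_of_bool.
apply/idP/idP; rewrite !inE => nc s st i j ij.
  by rewrite !pw; exact: nc.
by have := nc s st i j ij; rewrite !pw.
Qed.

Lemma weak_cvg_radius d' (T' : measurableType d') (P' : probability T' R)
    (Z : 'I_(n + 'C(n, 2)) -> T' -> R) : standard_normals P' Z ->
  weak_cvg +oo (fun t : R => pushforward (conditional_probability P (survive t))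
      (fun w => enorm (fun i => X i t w) / Num.sqrt t))
    (pushforward P' (fun w => enorm (Z ^~ w))).
Proof.
move=> sZ f cf /bounded_fun_normP[C fC].
have mf : measurable_fun setT f by exact: continuous_measurable_fun.
have meZ : measurable_fun setT (fun w => enorm (Z ^~ w)).
  exact: (measurableT_comp (@measurable_enorm _ _) (measurable_rvect sZ.1.1)).
rewrite (integral_pushforward_bounded P' meZ mf fC).
have V0 : vdm eta != 0 by exact: vdm_neq0.
have sV0 : Num.sg (vdm eta) != 0 by rewrite sgr_eq0.
have c1 : continuous (cst 1 : R -> R) by exact: cst_continuous.
have b1 (x : R) : `|(cst 1 : R -> R) x| <= 1 by rewrite normr1.
have I0 := Rintegral_norm_vdm_gt0 sN.
have := drift_integral_ratio sN mf fC eta_inj.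
rewrite (Rintegral_radial_vdm sN sZ mf fC) mulrC mulKf ?gt_eqF// => lim.
have {}lim : (drift_integral P N eta f (Num.sqrt t)^-1 /
    drift_integral P N eta (cst 1) (Num.sqrt t)^-1)%:E @[t --> +oo] -->
    (\int[P']_w f (enorm (Z ^~ w)))%:E.
  by apply: cvg_EFin => //; exact: nearW.
apply: cvg_trans lim; apply: near_eq_cvg; near=> t.
have t0 : 0 < t by near: t; exact: nbhs_pinfty_gt.
rewrite (integral_conditional_probability P (measurable_survive t0)
  (measurable_radius (ltW t0)) mf fC).
congr EFin.
(* Writing the denominator as the case [f = 1] lets the sign and the Gaussian prefactor cancel in
   the quotient. *)
have -> : fine (P (survive t)) = \int[P]_w (\1_(survive t) w *
    cst 1 (enorm (fun i => X i t w) / Num.sqrt t)).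
  rewrite (_ : (fun w => _) = \1_(survive t)); last first.
    by apply/funext => w; rewrite /= mulr1.
  by rewrite /Rintegral integral_indic ?setIT//; exact: measurable_survive.
rewrite !survival_pinned//.
have cancel (a b c : R) : c != 0 -> c * a / (c * b) = a / b.
  by move=> c0; rewrite -mulf_div divff// mul1r.
rewrite -[RHS](cancel _ _ (Num.sg (vdm eta)))//.
rewrite (survival_drift t0 cf fC) (survival_drift t0 c1 b1).
by rewrite cancel// gt_eqF// expR_gt0.
Unshelve. all: by end_near. Qed.

End limit_law.

Lemma standard_normal_vectorP d (T : measurableType d) (R : realType)
    (P : probability T R) k (Z : 'I_k -> T -> R) :
  standard_normal_vector P Z -> standard_normals P Z.
Proof. by move=> [mZ lZ iZ]; split => //; split. Qed.

Lemma enorm_eq0 (R : realType) k (x : 'I_k -> R) : enorm x = 0 -> forall i, x i = 0.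
Proof.
move=> x0 i; have : \sum_(i < k) x i ^+ 2 = 0.
  by rewrite -sqr_enorm x0 expr0n.
move=> /eqP; rewrite psumr_eq0 => [/allP/(_ i)|j _]; last exact: sqr_ge0.
by rewrite mem_index_enum => /(_ isT); rewrite /= sqrf_eq0 => /eqP.
Qed.

(** A starting point of norm 0 is the origin, so that [W i 1] is almost surely the increment
    [W i 1 - W i 0], whose family is standard normal. *)
Lemma integral_bessel_process (R : realType) k d (T : measurableType d)
    (P : probability T R) (rho : R -> T -> R) (f : R -> R) (C : R) :
  bessel_process P k 0 rho -> measurable_fun setT f ->
  (forall x, `|f x| <= C) ->
  exists2 Z : 'I_k -> T -> R, standard_normals P Z &
    (\int[pushforward P (rho 1%R)]_x (f x)%:E =
     \int[pushforward P (fun w => enorm (Z ^~ w))]_x (f x)%:E)%E.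
Proof.
move=> [x [W [hW x0 rhoE]]] mf fC.
have sZ := standard_normals_increment hW.
exists (fun i => W i 1 \- W i 0) => //.
have mE (Y : 'I_k -> T -> R) : (forall i, measurable_fun setT (Y i)) ->
    measurable_fun setT (fun w => enorm (Y ^~ w)).
  move=> mY; apply: (measurableT_comp (@measurable_enorm R k)).
  exact: measurable_rvect.
have mW : measurable_fun setT (fun w => enorm (fun i => W i 1 w)).
  by apply: mE => i; exact: bm_measurable (hW.1 i) _ ler01.
have mZ := mE _ sZ.1.1.
rewrite (_ : rho 1 = fun w => enorm (fun i => W i 1 w)); last first.
  by apply/funext => w; exact: rhoE.
rewrite (integral_pushforward_bounded P mW mf fC).
rewrite (integral_pushforward_bounded P mZ mf fC).
congr (fine _)%:E; apply: ae_eq_integral => //.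
- by apply/measurable_EFinP; exact: measurableT_comp.
- by apply/measurable_EFinP; exact: measurableT_comp.
apply: filterS (brownian_motion_start_ae hW) => w W0 _; congr (f (enorm _))%:E.
by apply/funext => i; rewrite /= W0 (enorm_eq0 x0) subr0.
Qed.

Theorem theorem2 (R : realType) (n : nat) (hn : (2 <= n)%N)
    (eta : 'I_n -> R) (heta : injective eta)
    (d : measure_display) (Omega : measurableType d) (P : probability Omega R)
    (X : 'I_n -> R -> Omega -> R) (hX : brownian_motion_dim P eta X) :
  let k := ((n * (n + 1)) %/ 2)%N in
  let cond_law (t : R) : set R -> \bar R :=
    pushforward
      (conditional_probability P [set w | (t%:E < collision_time X w)%E])
      (fun w => enorm (fun i => X i t w) / Num.sqrt t) in
  (forall (d' : measure_display) (Omega' : measurableType d')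
     (P' : probability Omega' R) (rho : R -> Omega' -> R),
     bessel_process P' k 0 rho ->
     weak_cvg +oo cond_law (pushforward P' (rho 1))) /\
  (forall (d' : measure_display) (Omega' : measurableType d')
     (P' : probability Omega' R) (Z : 'I_k -> Omega' -> R),
     standard_normal_vector P' Z ->
     weak_cvg +oo cond_law (pushforward P' (fun w => enorm (fun i => Z i w)))).
Proof.
move=> k cond_law.
(* Pascal's rule for ['C(n.+1, 2)]: the dimension [n] of the space plus the degree of the
   Vandermonde product. *)
have kE : k = (n + 'C(n, 2))%N.
  by rewrite /k divn2 addn1 mulnC -(bin2 n.+1) binS bin1 addnC.
have main d' (T' : measurableType d') (P' : probability T' R) (Z : 'I_k -> T' ->
  R) :
    standard_normals P' Z ->
    weak_cvg +oo cond_law (pushforward P' (fun w => enorm (Z ^~ w))).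
  by move: Z; rewrite kE => Z; exact: (weak_cvg_radius heta hX).
split => d' T' P' Z hZ; last first.
  by apply: main; exact: standard_normal_vectorP.
move=> f cf bf; have [C fC] := bounded_fun_normP bf.
have mf : measurable_fun setT f by exact: continuous_measurable_fun.
have [N sN ->] := integral_bessel_process hZ mf fC.
exact: main sN f cf bf.
Qed.
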